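(* Let $0<\alpha<1$. Then there exists a constant $c_\alpha>0$ depending only on $\alpha$ such that the following holds. Let $n\ge1$ be an integer and suppose $f_0,f_1,\dots,f_n$ are analytic functions on $\mathbb D$ with $$f_j^{(n)}\in\mathcal D_\alpha\cap H^\infty\qquad(0\le j\le n).$$ Assume also that the Wronskian $W:=W(f_0,\dots,f_n)$ satisfies $1/W\in L^\infty(\mathbb T)$. Put $$f_{n+1}=f_0+\dots+f_n.$$ Finally, write $$\mathbf B:=\mathrm{LCM}(B_0,\dots,B_{n+1})\quad\text{and}\quad \mathcal B:=\mathrm{rad}(B_0B_1\cdots B_{n+1}),$$ where $B_j$ is the (possibly infinite) Blaschke product associated with $f_j$ ($0\le j\le n+1$). Then $$c_\alpha\|\mathbf B\|^2_{\mathcal D_\alpha}\le\lambda_\alpha^2+n\mu^2\|\mathcal B\|^2_{\mathcal D_\alpha},$$ with $$\lambda_\alpha:=\|W\|_{\mathcal D_\alpha}\,\|1/W\|_\infty\qquad\text{and}\qquad \mu:=\|W\|_\infty\,\|1/W\|_\infty,$$ where $\|\cdot\|_\infty$ stands for $\|\cdot\|_{L^\infty(\mathbb T)}$.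
   Context: $\mathbb D=\{z\in\mathbb C:|z|<1\}$ and $\mathbb T=\partial\mathbb D$. Functions analytic on $\mathbb D$ are considered on $\mathbb T$ via their nontangential boundary values (defined almost everywhere). $H^\infty$ is the space of bounded analytic functions on $\mathbb D$. For an analytic function $f$ on $\mathbb D$ put $$\|f\|^2_{\mathcal D_\alpha}:=\sum_{k\ge1}k^\alpha|\widehat f(k)|^2\in[0,\infty],\qquad \widehat f(k):=f^{(k)}(0)/k!,$$ and let $\mathcal D_\alpha$ be the space of all analytic $f$ on $\mathbb D$ with $\|f\|_{\mathcal D_\alpha}<\infty$. (The right-hand side of the asserted inequality is allowed to be $+\infty$, namely when $\mathcal B\notin\mathcal D_\alpha$, in which case the inequality is vacuous.) Wronskian: $W(f_0,\dots,f_n)$ is the determinant of the $(n+1)\times(n+1)$ matrix whose rows are $(f_0^{(i)},f_1^{(i)},\dots,f_n^{(i)})$, $i=0,\dots,n$. For a non-null $f\in H^\infty$, let $m\ge0$ be the multiplicity of its zero at the origin and let $a_k$ be its distinct zeros in $\mathbb D\setminus\{0\}$ (finitely or infinitely many), of respective multiplicities $m_k$, so that $\sum_k m_k(1-|a_k|)<\infty$. The Blaschke product associated with $f$ is $$B(z)=z^m\prod_k\left(\frac{\bar a_k}{|a_k|}\,\frac{a_k-z}{1-\bar a_kz}\right)^{m_k},\qquad z\in\mathbb D$$ (empty products equal $1$). For Blaschke products $B_1,\dots,B_s$, their least common multiple $\mathrm{LCM}(B_1,\dots,B_s)$ is the Blaschke product whose zero-set is $\mathcal Z=B_1^{-1}(0)\cup\dots\cup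 B_s^{-1}(0)$, the multiplicity of the zero at $a\in\mathcal Z$ being $\max_{1\le j\le s}m(a,B_j)$, where $m(a,B_j)$ is the multiplicity of $a$ as a zero of $B_j$ ($0$ if $B_j(a)\neq0$). The radical $\mathrm{rad}(B)$ of a Blaschke product $B$ as displayed above is the Blaschke product obtained by replacing $m$ with $\min\{m,1\}$ and each $m_k$ ($\ge1$) with $1$. *)

(* Defs.v *)
From HB Require Import structures.
From mathcomp Require Import all_boot all_order all_algebra.
From mathcomp Require Import finmap.
From mathcomp Require Import complex.
From mathcomp Require Import all_classical all_reals all_analysis.
From mathcomp Require Import ess_sup_inf summability.

Set Implicit Arguments.
Unset Strict Implicit.
Unset Printing Implicit Defensive.

Import Order.TTheory GRing.Theory Num.Theory.
Import ComplexField.Normc.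
Import numFieldNormedType.Exports.

Local Open Scope classical_set_scope.
Local Open Scope complex_scope.
Local Open Scope ring_scope.

(* R[i] as the carrier of a numFieldType: it thereby receives the library's
   topology and normed-module structure over itself, for which derive1 is the
   complex derivative. *)
Notation Cplx R := (R[i]%type : numFieldType).

Section Disk.
Variable R : realType.
Local Notation C := (Cplx R).
Implicit Types (f g : C -> C) (a z : C) (alpha t : R).

(* Functions on the open unit disk D are represented by total functions on C;
   every definition below uses only their values on D, which is open, so that
   derivatives at points of D are not affected by the values outside D. *)

Definition in_disk z : bool := normc z < 1.

Definition analytic_on_disk f : Prop :=
  forall a, in_disk a -> exists c : nat -> C,
    \forall z \near a, series (fun k => c k * (z - a) ^+ k) @ \oo --> f z.

Definition Hinfty f : Prop :=
  analytic_on_disk f /\ exists M : R, forall z, in_disk z -> normc (f z) <= M.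

Definition taylor_coef f (k : nat) : C := derive1n k f 0 / k`!%:R.

Definition dirichlet_norm_sq alpha f : \bar R :=
  (\sum_(1 <= k <oo) (k%:R `^ alpha * normc (taylor_coef f k) ^+ 2)%:E)%E.

Definition dirichlet_norm alpha f : \bar R := sqrte (dirichlet_norm_sq alpha f).

Definition dirichlet alpha f : Prop :=
  analytic_on_disk f /\ (dirichlet_norm_sq alpha f < +oo)%E.

Definition circle_point t : C := cos t +i* sin t.

Definition stolz_region (A : R) (zeta : C) : set C :=
  [set z | in_disk z /\ normc (z - zeta) < A * (1 - normc z)].

Definition nontangential_limit f (zeta l : C) : Prop :=
  forall A : R, 1 < A -> f @ within (stolz_region A zeta) (nbhs zeta) --> l.

(* The default value 0 is taken where there is no nontangential limit; for
   f in H^infty this happens only on a null set. *)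
Definition boundary_value f t : C :=
  xget 0 [set l | nontangential_limit f (circle_point t) l].

Definition circle_measure :=
  mrestr (@lebesgue_measure R) (measurable_itv `[0, 2 * pi[).

Definition norm_Linfty f : \bar R :=
  ess_sup circle_measure (fun t => (normc (boundary_value f t))%:E).

(* The L^infty(T) norm of 1/f.  The inverse is that of \bar R, for which
   0^-1 = +oo: it is finite only if f is bounded away from 0 a.e. on T. *)
Definition norm_Linfty_inv f : \bar R :=
  ess_sup circle_measure (fun t => ((normc (boundary_value f t))%:E^-1)%E).

Definition wronskian (n : nat) (f : 'I_n.+1 -> C -> C) (z : C) : C :=
  \det (\matrix_(i < n.+1, j < n.+1) derive1n i (f j) z).

(* The order of vanishing of f at a (0 if f a != 0). *)
Definition zero_mult f a : nat :=
  xget 0%N [set k | derive1n k f a != 0 /\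
                    forall j, (j < k)%N -> derive1n j f a = 0].

Definition blaschke_factor a z : C :=
  if a == 0 then z else a^*%C / `|a| * ((a - z) / (1 - a^*%C * z)).

(* The Blaschke product with a zero of multiplicity m a at each a in D: the
   limit of the partial products over finite sets of points of D, ordered by
   inclusion; points with m a = 0 contribute the factor 1. *)
Definition blaschke (m : C -> nat) (z : C) : C :=
  lim ((fun S : {fset C} =>
          \prod_(a <- S | in_disk a) blaschke_factor a z ^+ m a) @ totally).

Definition blaschke_of f : C -> C := blaschke (zero_mult f).

Definition blaschke_lcm (s : nat) (B : 'I_s -> C -> C) : C -> C :=
  blaschke (fun a => \max_(j < s) zero_mult (B j) a)%N.

Definition blaschke_rad (B : C -> C) : C -> C :=
  blaschke (fun a => minn (zero_mult B a) 1).

(* (f_0, ..., f_n, f_0 + ... + f_n) *)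
Definition append_sum (n : nat) (f : 'I_n.+1 -> C -> C) (j : 'I_n.+2) : C -> C :=
  if unlift ord_max j is Some i then f i else fun z => \sum_(i < n.+1) f i z.

End Disk.

(* Main.v *)
Require Import Defs.
From mathcomp Require Import all_boot all_order all_algebra.
From mathcomp Require Import finmap.
From mathcomp Require Import complex.
From mathcomp Require Import all_classical all_reals all_analysis.
From mathcomp Require Import ess_sup_inf summability.
From mathcomp Require Import ring lra.

(** The idea is to prove, on each circle of radius [r < 1], an inequality between
    quantities that measure how far functions are from being of constant modulus,
    and to sum these inequalities over [r].

    For [f] in the Hardy space H^2, with squared norm [h2 f] (the sum of the
    squares of the moduli of the Taylor coefficients), let [defect r f] be [h2 f]
    minus the mean of [|f|^2] over the circle of radius [r]. By Parseval it is the
    sum of the [(1 - r^(2k)) |c_k|^2]. For the radii [r_j = 1 - 2^-j] and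
    [0 < alpha < 1], the sum over [j] of [2^(j alpha) (1 - r_j^(2k))] is comparable
    with [k^alpha] ([weight_lower], [weight_upper]). So it suffices to show, for
    all [r], that
      [D^-2 defect r L <= defect r W + n M^2 defect r P],
    where [L] and [P] are the least common multiple and the radical, [D] is the
    norm of [1/W] and [M] that of [W]. The constant then depends on [alpha] only.

    The arithmetic of the Wronskian enters as follows. Expanding along a column,
    possibly after adding the other columns to it, one sees that [W] is a
    combination of the derivatives of order at most [n] of each of the functions
    [f_0, ..., f_(n+1)]. A zero of order [m] of one of them is thus a zero of
    order at least [m - n] of [W] ([zdvd_wronskian]), so that [L] divides
    [W P^n] ([zdvd_mL]).

    Suppose first that the products are finite, and write [W P^n = L G].
    Multiplication by a Blaschke factor is an isometry of H^2, also on functions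
    multiplied by the Szego kernel [k_a] ([h2_moebius]). Hence [G] and [W] have the
    same Berezin transform [Q(a) = (1 - |a|^2) h2 (k_a W)]. It dominates [|G(a)|^2],
    by Cauchy-Schwarz, and [D^-2], by Fatou's lemma, since [|W| >= 1/D] on the
    circle ([h2_szego_ge]); and its mean over [|a| = r] is at most [h2 W]
    ([berezin_mean]). The convex combination
      [|L|^2 |G|^2 + (1 - |L|^2) D^-2 <= Q]
    therefore gives [mean |W P^n|^2 + D^-2 mean (1 - |L|^2) <= h2 W]
    ([finite_comparison]). Since [|W| <= M] inside the disk ([le_boundary_sup]),
    replacing [W P^n] by [W] costs at most [n M^2 mean (1 - |P|^2)].

    For infinite products the inequality is applied to finite subproducts, which
    converge uniformly on circles ([radius_comparison]). That [mean (1 - |B|^2)] is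
    [defect r B] for an infinite Blaschke product [B] means [h2 B = 1]
    ([h2_blaschke]): removing finitely many factors does not change the norm, and
    what is left is close to 1 at the origin. The Blaschke condition itself also
    follows from the isometry ([bcond_zero_mult]).

    The function theory is developed from power series. Division of a series by
    [z - a] yields derivatives and expansions at other points; Parseval yields the
    Cauchy estimates; with compactness of circles they show that a function with
    local expansions is the sum of its Taylor series on the whole disk
    ([analytic_ps]). *)

Set Implicit Arguments.
Unset Strict Implicit.
Unset Printing Implicit Defensive.

Import Order.TTheory GRing.Theory Num.Theory.
Import ComplexField.Normc.
Import numFieldNormedType.Exports.

Local Open Scope classical_set_scope.
Local Open Scope complex_scope.
Local Open Scope ring_scope.

(** * The complex modulus and absolutely convergent series *)

Section ComplexNorm.
Variable R : realType.
Local Notation C := (Cplx R).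
Implicit Types (z w : C) (r e : R).

Lemma normc_ge0 z : 0 <= normc z.
Proof. by case: z => a b; rewrite sqrtr_ge0. Qed.

Lemma normcE_norm z : `|z| = (normc z)%:C.
Proof. by []. Qed.

Lemma normcX z n : normc (z ^+ n) = normc z ^+ n.
Proof.
elim: n => [|n IH]; first by rewrite !expr0 normc1.
by rewrite !exprS normcM IH.
Qed.

Lemma normcB z w : normc (z - w) = normc (w - z).
Proof. by rewrite -normcN opprB. Qed.

Lemma normc_sum I (s : seq I) (P : pred I) (F : I -> C) :
  normc (\sum_(i <- s | P i) F i) <= \sum_(i <- s | P i) normc (F i).
Proof.
elim/big_rec2: _ => [|i y1 y2 _ H]; first by rewrite normc0.
by apply: le_trans (le_normcD _ _) _; rewrite lerD2l.
Qed.

Lemma normc_real r : normc (r%:C : C) = `|r|.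
Proof. by rewrite /normc /= expr0n /= addr0 sqrtr_sqr. Qed.

Lemma normc_nat n : normc (n%:R : C) = n%:R.
Proof. by rewrite -(rmorph_nat (@real_complex_def R _)) normc_real ger0_norm. Qed.

Lemma normc_conj z : normc z^*%C = normc z.
Proof. by case: z => a b; rewrite /normc /= sqrrN. Qed.

Lemma normc_eq0 z : (normc z == 0) = (z == 0).
Proof. by apply/eqP/eqP => [/eq0_normc//|->]; rewrite normc0. Qed.

Lemma normc_gt0 z : (0 < normc z) = (z != 0).
Proof. by rewrite lt_def normc_ge0 andbT normc_eq0. Qed.

Lemma le_normcB z w : normc z - normc w <= normc (z - w).
Proof. by rewrite lerBlDr; apply: le_trans (le_normcD _ _); rewrite subrK. Qed.

Lemma Re_le_normc z : `|complex.Re z| <= normc z.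
Proof.
case: z => a b /=; rewrite -sqrtr_sqr; apply: ler_wsqrtr.
by rewrite lerDl sqr_ge0.
Qed.

Lemma Im_le_normc z : `|complex.Im z| <= normc z.
Proof.
case: z => a b /=; rewrite -sqrtr_sqr; apply: ler_wsqrtr.
by rewrite lerDr sqr_ge0.
Qed.

Lemma normc_sqr z : normc z ^+ 2 = complex.Re z ^+ 2 + complex.Im z ^+ 2.
Proof. by case: z => a b /=; rewrite sqr_sqrtr // addr_ge0 // sqr_ge0. Qed.

Lemma normc_le_ReIm z : normc z <= `|complex.Re z| + `|complex.Im z|.
Proof.
rewrite -ler_sqr ?nnegrE ?normc_ge0 ?addr_ge0 // normc_sqr sqrrD !real_normK ?num_real//.
by rewrite lerD2r lerDl mulrn_wge0 // mulr_ge0.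
Qed.

Lemma in_disk0 : in_disk (0 : C).
Proof. by rewrite /in_disk normc0. Qed.

Lemma cvgcP (T : Type) (F : set_system T) {FF : Filter F} (f : T -> C) (l : C) :
  f @ F --> l <-> forall e, 0 < e -> \forall t \near F, normc (f t - l) < e.
Proof.
split=> [/cvgrPdist_lt H e e0|H].
  have := H e%:C; rewrite ltcR => /(_ e0); apply: filterS => t.
  by rewrite normcE_norm ltcR normcB.
apply/cvgrPdist_lt => -[e i]; rewrite ltcE /= => /andP[/eqP -> e0].
by apply: filterS (H _ e0) => t; rewrite normcE_norm ltcR normcB.
Qed.

(** Real and imaginary parts inherit the hypothesis, and [R] is complete. *)
Lemma cauchy_cvgc (T : Type) (F : set_system T) {FF : ProperFilter F} (f : T -> C) :
  (forall e, 0 < e -> exists x : C, \forall t \near F, normc (f t - x) < e) ->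
  cvg (f @ F).
Proof.
move=> H.
have P (p : C -> R) : (forall z w, p (z - w) = p z - p w) ->
    (forall z, `|p z| <= normc z) -> cvg ((p \o f) @ F).
  move=> pB ple; apply/cauchy_cvgP/cauchy_exP => e e0.
  have [x Hx] := H _ e0; exists (p x).
  apply: filterS Hx => t ht; rewrite /ball /= distrC -pB.
  exact: le_lt_trans (ple _) ht.
have PRe := P (@complex.Re R) (fun z w => raddfB _ z w) Re_le_normc.
have PIm := P (@complex.Im R) (fun z w => raddfB _ z w) Im_le_normc.
apply/cvg_ex; exists (lim ((@complex.Re R \o f) @ F) +i* lim ((@complex.Im R \o f) @ F)).
apply/cvgcP => e e0; have e2 : 0 < e / 2 by rewrite divr_gt0.
move/cvgrPdist_lt : PRe => /(_ _ e2) HR; move/cvgrPdist_lt : PIm => /(_ _ e2) HI.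
near=> t; apply: le_lt_trans (normc_le_ReIm _) _.
by rewrite [e]splitr ltrD // raddfB distrC /=; near: t; [exact: HR|exact: HI].
Unshelve. all: by end_near. Qed.

Lemma cvgc_unique (T : Type) (F : set_system T) {FF : ProperFilter F} (f : T -> C) a b :
  f @ F --> (a : C) -> f @ F --> (b : C) -> a = b.
Proof. by move=> ha hb; apply: (cvg_unique _ ha hb); apply: norm_hausdorff. Qed.

Lemma cvgc_lim (T : Type) (F : set_system T) {FF : ProperFilter F} (f : T -> C) a :
  f @ F --> (a : C) -> lim (f @ F) = a.
Proof. by move=> ha; apply: (cvg_lim _ ha); apply: norm_hausdorff. Qed.

Lemma cvgc_norm (T : Type) (F : set_system T) {FF : Filter F} (f : T -> C) a :
  f @ F --> (a : C) -> (fun t => normc (f t)) @ F --> normc a.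
Proof.
move=> /cvgcP H; apply/cvgrPdist_lt => e e0; apply: filterS (H e e0) => t.
apply: le_lt_trans; rewrite ler_norml.
have := le_normcB (f t) a; have := le_normcB a (f t); rewrite (normcB a (f t)).
by move=> h1 h2; apply/andP; split; lra.
Qed.

Lemma normc_lim_le (T : Type) (F : set_system T) {FF : ProperFilter F} (f : T -> C) a r :
  f @ F --> (a : C) -> (\forall t \near F, normc (f t) <= r) -> normc a <= r.
Proof.
move=> /cvgc_norm h1 h2.
rewrite -(cvg_lim _ h1) //; apply: limr_le => //.
exact: (cvgP _ h1).
Qed.

Lemma seriesS_c (u : nat -> C) n : series u n.+1 = series u n + u n.
Proof. by rewrite !seriesEnat /= big_nat_recr. Qed.

(** The increments of the series are dominated by those of the nondecreasing
    bounded sequence of the sums of moduli. *)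
Lemma absum_cvg (u : nat -> C) (A : R) :
  (forall n, \sum_(k < n) normc (u k) <= A) -> cvgn (series u).
Proof.
move=> H; pose s n := \sum_(k < n) normc (u k).
have s_nd : {homo s : m n / (m <= n)%N >-> m <= n}.
  apply: homo_leq => [x|x y z|n]; [exact: lexx|exact: le_trans|].
  by rewrite /s big_ord_recr /= lerDl normc_ge0.
have cs : cvgn s.
  apply: nondecreasing_is_cvgn => //; exists A => _ [n _ <-]; exact: H.
have sle n : s n <= limn s by apply: nondecreasing_cvgn_le.
have sd m n : (m <= n)%N -> normc (series u n - series u m) <= s n - s m.
  elim: n => [|n IH]; first by rewrite leqn0 => /eqP ->; rewrite !subrr normc0.
  rewrite leq_eqVlt => /predU1P[->|]; first by rewrite !subrr normc0.
  move=> /IH {}IH; rewrite seriesS_c /s big_ord_recr /= -/(s n) addrAC.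
  by apply: le_trans (le_normcD _ _) _; rewrite addrAC lerD2r.
apply: cauchy_cvgc => e e0.
move/cvgrPdist_lt : cs => /(_ e e0) [N _ HN].
exists (series u N); exists N => // n /= Nn.
apply: le_lt_trans (sd _ _ Nn) _; have := HN N (leqnn N).
have := sle n; have := sle N; move=> h1 h2; rewrite ger0_norm ?subr_ge0//.
by move: h1 h2 => /=; lra.
Qed.

End ComplexNorm.

(** * Power series *)

Section RealAux.
Variable R : realType.
Implicit Types (q s : R).

Lemma geo_sum_le q n : 0 <= q -> q < 1 -> \sum_(k < n) q ^+ k <= (1 - q)^-1.
Proof.
move=> q0 q1; have q1' : 0 < 1 - q by rewrite subr_gt0.
rewrite -[leRHS]mul1r ler_pdivlMr // mulrC -opprB mulNr -subrX1 opprB.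
by rewrite gerBl exprn_ge0.
Qed.

(** Each of the [n] terms [q ^+ k], [k < n], is at least [q ^+ n]. *)
Lemma nexp_le q n : 0 <= q -> q < 1 -> n%:R * q ^+ n <= (1 - q)^-1.
Proof.
move=> q0 q1; apply: le_trans (geo_sum_le n q0 q1).
have -> : n%:R * q ^+ n = \sum_(k < n) q ^+ n.
  by rewrite sumr_const card_ord mulr_natl.
by apply: ler_sum => k _; apply: ler_wiXn2l => //; [exact: ltW|exact: ltnW].
Qed.

Lemma cvg_nexp q : 0 <= q -> q < 1 -> (fun n => n%:R * q ^+ n) @ \oo --> (0 : R).
Proof.
move=> q0 q1; pose s := Num.sqrt q.
have s0 : 0 <= s by exact: sqrtr_ge0.
have s2 : s ^+ 2 = q by rewrite sqr_sqrtr.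
have s1 : s < 1 by rewrite -(ltr_pXn2r (n:=2)) ?nnegrE // s2 expr1n.
apply: (@squeeze_cvgr _ _ _ _ (fun=> 0) (fun n => (1 - s)^-1 * s ^+ n)).
- near=> n; apply/andP; split; first by rewrite mulr_ge0 // exprn_ge0.
  rewrite -s2 -exprM mul2n -addnn exprD mulrA.
  by apply: ler_wpM2r; [exact: exprn_ge0|exact: nexp_le].
- exact: cvg_cst.
- by apply: (cvg_geometric (1 - s)^-1); rewrite ger0_norm.
Unshelve. all: by end_near. Qed.

End RealAux.

Section PowerSeries.
Variable R : realType.
Local Notation C := (Cplx R).
Implicit Types (z a b : C) (r s A B rho : R) (c d : nat -> C) (f g : C -> C).

(** The coefficients are kept as an argument, independent of the derivatives of
    [f], so that series can be added, multiplied and divided before anything is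
    known about differentiability; [ps_coefE] makes the link. *)
Definition ps rho f c :=
  forall z, normc z < rho -> series (fun k => c k * z ^+ k) @ \oo --> f z.

(** A total function: it is meaningful where a [coef_bound] holds. *)
Definition psum c z : C := limn (series (fun k => c k * z ^+ k)).

(** Cauchy bounds on the coefficients stand for the radius of convergence. *)
Definition coef_bound c s A := forall k, normc (c k) * s ^+ k <= A.

Lemma series_ordE (u : nat -> C) n : series u n = \sum_(k < n) u k.
Proof. by rewrite seriesEnat /= big_mkord. Qed.

Lemma coef_bound_ge0 c s A : coef_bound c s A -> 0 <= A.
Proof. by move=> /(_ 0%N); rewrite expr0 mulr1; apply: le_trans; exact: normc_ge0. Qed.

Lemma coef_bound_term c s A r k : coef_bound c s A -> 0 <= r -> 0 < s ->
  normc (c k) * r ^+ k <= A * (r / s) ^+ k.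
Proof.
move=> cb r0 s0; have -> : r ^+ k = s ^+ k * (r / s) ^+ k.
  by rewrite -exprMn mulrCA divff ?gt_eqF // mulr1.
by rewrite mulrA ler_wpM2r // exprn_ge0 // divr_ge0 // ltW.
Qed.

Lemma coef_bound_sum c s A r n : coef_bound c s A -> 0 <= r -> r < s ->
  \sum_(k < n) normc (c k) * r ^+ k <= A / (1 - r / s).
Proof.
move=> cb r0 rs; have s0 : 0 < s by exact: le_lt_trans rs.
apply: (@le_trans _ _ (\sum_(k < n) A * (r / s) ^+ k)).
  by apply: ler_sum => k _; exact: coef_bound_term.
rewrite -mulr_sumr ler_wpM2l ?(coef_bound_ge0 cb) //.
apply: geo_sum_le; first by rewrite divr_ge0 // ltW.
by rewrite ltr_pdivrMr // mul1r.
Qed.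

Lemma coef_bound_cvg c s A z : coef_bound c s A -> normc z < s ->
  series (fun k => c k * z ^+ k) @ \oo --> psum c z.
Proof.
move=> cb zs; apply: (@absum_cvg _ _ (A / (1 - normc z / s))) => n.
under eq_bigr do rewrite normcM normcX.
by apply: coef_bound_sum => //; exact: normc_ge0.
Qed.

Lemma coef_bound_psum_le c s A z : coef_bound c s A -> normc z < s ->
  normc (psum c z) <= A / (1 - normc z / s).
Proof.
move=> cb zs; apply: (normc_lim_le (coef_bound_cvg cb zs)).
near=> n; rewrite series_ordE; apply: le_trans (normc_sum _ _ _) _.
under eq_bigr do rewrite normcM normcX.
by apply: coef_bound_sum => //; exact: normc_ge0.
Unshelve. all: by end_near. Qed.

(** The terms of the convergent series at the point [r] tend to 0. *)
Lemma ps_coef_bound rho f c r : ps rho f c -> 0 <= r -> r < rho ->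
  exists A, coef_bound c r A.
Proof.
move=> pf r0 rr; have /pf : normc (r%:C : C) < rho by rewrite normc_real ger0_norm.
move=> /cvgP/cvg_series_cvg_0/cvgcP/(_ _ ltr01)[N _ HN].
exists (1 + \sum_(k < N) normc (c k) * r ^+ k) => k.
have t0 j : 0 <= normc (c j) * r ^+ j by rewrite mulr_ge0 ?normc_ge0 ?exprn_ge0.
have [Nk|kN] := leqP N k.
  have := HN k Nk; rewrite /= subr0 normcM normcX normc_real ger0_norm // => /ltW h.
  by apply: le_trans h _; rewrite lerDl sumr_ge0.
rewrite (bigD1 (Ordinal kN)) //= addrCA lerDl addr_ge0 //.
by rewrite sumr_ge0.
Qed.

Lemma ps_coef_bound_gt rho f c x : ps rho f c -> 0 <= x -> x < rho ->
  exists s A, [/\ x < s, s < rho, 0 < s & coef_bound c s A].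
Proof.
move=> pf x0 xr; pose s := (x + rho) / 2.
have [xs sr] : x < s /\ s < rho by rewrite /s; split; lra.
have s0 : 0 < s by exact: le_lt_trans xs.
by have [A cA] := ps_coef_bound pf (ltW s0) sr; exists s, A.
Qed.

Lemma psumP rho c : (forall r, 0 <= r -> r < rho -> exists A, coef_bound c r A) ->
  ps rho (psum c) c.
Proof.
move=> H z zr; have [r1 r2] : normc z < (normc z + rho) / 2 /\ (normc z + rho) / 2 < rho.
  by split; lra.
have [|A cA] := H ((normc z + rho) / 2) _ r2; last exact: coef_bound_cvg cA r1.
by apply: ltW; apply: le_lt_trans r1; exact: normc_ge0.
Qed.

Lemma ps_psumE rho f c z : ps rho f c -> normc z < rho -> f z = psum c z.
Proof. by move=> pf zr; rewrite /psum (cvgc_lim (pf z zr)). Qed.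

Lemma ps_le rho f c s A z : ps rho f c -> coef_bound c s A -> s <= rho ->
  normc z < s -> normc (f z) <= A / (1 - normc z / s).
Proof.
move=> pf cb sr zs; rewrite (ps_psumE pf) ?(lt_le_trans zs) //.
exact: coef_bound_psum_le.
Qed.

Lemma ps_ext rho f g c : ps rho f c -> (forall z, normc z < rho -> f z = g z) ->
  ps rho g c.
Proof. by move=> pf fg z zr; rewrite -fg //; exact: pf. Qed.

Lemma ps_coef_ext rho f c d : ps rho f c -> c =1 d -> ps rho f d.
Proof. by move=> pf /funext <-. Qed.

Lemma ps_lt rho rho' f c : ps rho f c -> rho' <= rho -> ps rho' f c.
Proof. by move=> pf le z zr; apply: pf; exact: lt_le_trans zr le. Qed.

Lemma ps_add rho f g c d : ps rho f c -> ps rho g d ->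
  ps rho (fun z => f z + g z) (fun k => c k + d k).
Proof.
move=> pf pg z zr; rewrite (_ : series _ = series (fun k => c k * z ^+ k) \+
  series (fun k => d k * z ^+ k)); first exact: cvgD (pf z zr) (pg z zr).
apply/funext => n; rewrite /= !series_ordE -big_split /=; apply: eq_bigr => k _.
by rewrite mulrDl.
Qed.

Lemma ps_scale rho f c a : ps rho f c ->
  ps rho (fun z => a * f z) (fun k => a * c k).
Proof.
move=> pf z zr; rewrite (_ : series _ = (cst a) \* series (fun k => c k * z ^+ k)).
  by apply: cvgM (pf z zr); exact: cvg_cst.
apply/funext => n; rewrite /= !series_ordE mulr_sumr; apply: eq_bigr => k _.
by rewrite mulrA.
Qed.

Lemma ps_cst rho a : ps rho (fun=> a) (fun k => a *+ (k == 0)%N).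
Proof.
move=> z _; apply/cvgcP => e e0; exists 1%N => // n /= n0.
rewrite series_ordE -(prednK n0) big_ord_recl /= expr0 mulr1 big1 ?addr0 ?subrr ?normc0 //.
by move=> i _; rewrite /= mul0r.
Qed.

Lemma ps_zero rho : ps rho (fun=> 0) (fun=> 0).
Proof. by apply: (ps_coef_ext (@ps_cst rho 0)) => k; rewrite mul0rn. Qed.

Lemma ps_id rho : ps rho (fun z => z) (fun k => 1 *+ (k == 1)%N).
Proof.
move=> z _; apply/cvgcP => e e0; exists 2%N => // n /= n0.
rewrite series_ordE -(ltn_predK n0) -(@prednK n.-1) ?ltn_predRL //.
rewrite 2!big_ord_recl /= /bump /= mul0r add0r expr1 mul1r big1 ?addr0 ?subrr ?normc0 //.
by move=> i _; rewrite /= mul0r.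
Qed.

Lemma tri_sum (V : nmodType) (F : nat -> nat -> V) n :
  \sum_(k < n) \sum_(i < k.+1) F i (k - i)%N = \sum_(i < n) \sum_(j < n - i) F i j.
Proof.
elim: n => [|n IH]; first by rewrite !big_ord0.
rewrite big_ord_recr /= IH [RHS]big_ord_recr /= subSnn big_ord_recr /=.
rewrite [in RHS]big_ord_recr big_ord0 /= add0r subnn addrA -big_split /=.
congr (_ + _); apply: eq_bigr => i _.
by rewrite (subSn (ltnW (ltn_ord i))) big_ord_recr.
Qed.

Lemma big_ord_tail (V : zmodType) (b : nat -> V) m k :
  \sum_(j < m + k) b j - \sum_(j < m) b j = \sum_(j < k) b (m + j)%N.
Proof. by rewrite big_split_ord /= [LHS]addrC addKr. Qed.

Definition cauchy_prod c d k : C := \sum_(i < k.+1) c i * d (k - i)%N.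

(** The Cauchy product of the partial sums differs from their product by terms
    of total degree at least [n], which are at most [n q^n] up to a constant. *)
Lemma ps_mul rho f g c d : ps rho f c -> ps rho g d ->
  ps rho (fun z => f z * g z) (cauchy_prod c d).
Proof.
move=> pf pg z zr.
pose s := (normc z + rho) / 2.
have [zs sr] : normc z < s /\ s < rho by rewrite /s; split; lra.
have z0 := normc_ge0 z.
have s0 : 0 < s by exact: le_lt_trans zs.
have [A cA] := ps_coef_bound pf (ltW s0) sr.
have [B dB] := ps_coef_bound pg (ltW s0) sr.
pose q := normc z / s.
have q0 : 0 <= q by rewrite divr_ge0 // ltW.
have q1 : q < 1 by rewrite ltr_pdivrMr // mul1r.
have A0 := coef_bound_ge0 cA; have B0 := coef_bound_ge0 dB.
have fg : (series (fun k => c k * z ^+ k) \* series (fun k => d k * z ^+ k)) @ \oo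
  --> f z * g z by exact: cvgM (pf z zr) (pg z zr).
apply/cvgcP => e e0.
have /cvgrPdist_lt H : (fun n => A * B / (1 - q) * (n%:R * q ^+ n)) @ \oo --> (0 : R).
  by rewrite -[X in _ --> X](mulr0 (A * B / (1 - q))); apply: cvgM; [exact: cvg_cst|exact: cvg_nexp].
have e2 : 0 < e / 2 by rewrite divr_gt0.
move/cvgcP : fg => /(_ _ e2) fg; have {}H := H _ e2.
near=> n.
pose a k := c k * z ^+ k; pose b k := d k * z ^+ k.
have aq k : normc (a k) <= A * q ^+ k.
  by rewrite normcM normcX; apply: coef_bound_term.
have bq k : normc (b k) <= B * q ^+ k.
  by rewrite normcM normcX; apply: coef_bound_term.
have E : series (fun k => cauchy_prod c d k * z ^+ k) n =
         \sum_(i < n) a i * \sum_(j < n - i) b j.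
  rewrite series_ordE.
  have -> : \sum_(i < n) a i * \sum_(j < n - i) b j = \sum_(i < n) \sum_(j < n - i) a i * b j.
    by apply: eq_bigr => i _; rewrite mulr_sumr.
  rewrite -(tri_sum (fun i j => a i * b j)); apply: eq_bigr => k _.
  rewrite mulr_suml; apply: eq_bigr => i _.
  rewrite /a /b mulrACA -exprD subnKC //; by rewrite -ltnS.
have D : normc (series (fun k => cauchy_prod c d k * z ^+ k) n -
   series a n * series b n) <= A * B / (1 - q) * (n%:R * q ^+ n).
  rewrite E !series_ordE mulr_suml -sumrB.
  apply: le_trans (normc_sum _ _ _) _.
  apply: (@le_trans _ _ (\sum_(i < n) A * B / (1 - q) * q ^+ n)); last first.
    by rewrite sumr_const card_ord -[in leLHS]mulr_natr -!mulrA [_%:R * _]mulrC.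
  apply: ler_sum => i _.
  rewrite -mulrBr normcM normcB.
  have -> : \sum_(j < n) b j - \sum_(j < n - i) b j = \sum_(j < i) b (n - i + j)%N.
    by rewrite -(big_ord_tail b (n - i)%N i) subnK // ltnW.
  have h : normc (\sum_(j < i) b (n - i + j)%N) <= B * q ^+ (n - i) / (1 - q).
    apply: le_trans (normc_sum _ _ _) _.
    apply: (@le_trans _ _ (\sum_(j < i) B * q ^+ (n - i) * q ^+ j)).
      by apply: ler_sum => j _; rewrite -mulrA -exprD; exact: bq.
    rewrite -mulr_sumr ler_wpM2l //; last exact: geo_sum_le.
    by rewrite mulr_ge0 // exprn_ge0.
  apply: le_trans (ler_pM (normc_ge0 _) (normc_ge0 _) (aq i) h) _.
  rewrite le_eqVlt; apply/orP; left; apply/eqP.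
  have -> : q ^+ n = q ^+ i * q ^+ (n - i) by rewrite -exprD subnKC // ltnW.
  ring.
rewrite [e]splitr -[X in normc (X - _)](subrK (series a n * series b n)) -addrA.
apply: le_lt_trans (le_normcD _ _) _; apply: ltrD.
  apply: le_lt_trans D _; apply: le_lt_trans (ler_norm _) _.
  by rewrite -normrN -sub0r; near: n.
by near: n.
Unshelve. all: by end_near. Qed.

End PowerSeries.

Arguments ps_cst {R} rho a.
Arguments ps_zero {R} rho.
Arguments ps_id {R} rho.
Arguments ps_scale {R rho f c} a.

(** * Division by z - a, continuity and derivatives *)

Section Division.
Variable R : realType.
Local Notation C := (Cplx R).
Implicit Types (z a : C) (r s A rho : R) (c d : nat -> C) (f g : C -> C).

Lemma near_normc_lt a r : normc a < r -> \forall z \near a, normc z < r.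
Proof.
move=> ar; have h0 : (fun t : C => t) @ nbhs a --> a by exact: cvg_id.
have h : normc t @[t --> a] --> normc a by exact: (cvgc_norm h0).
exact: cvgr_lt _ h _ ar.
Qed.

Lemma near_normcB_lt a r : 0 < r -> \forall z \near a, normc (z - a) < r.
Proof. have h0 : (fun t : C => t) @ nbhs a --> a by exact: cvg_id.
by move=> r0; exact: ((cvgcP _ _).1 h0 r r0). Qed.

Definition coef_shift m c i : C := c (m + i)%N.

Lemma coef_bound_shift c s A m : 0 < s -> coef_bound c s A ->
  coef_bound (coef_shift m c) s (A / s ^+ m).
Proof.
move=> s0 cA k; rewrite ler_pdivlMr ?exprn_gt0 // -mulrA -exprD addnC.
exact: cA.
Qed.

Lemma psum_rec c s A a : coef_bound c s A -> normc a < s ->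
  psum c a = c 0%N + a * psum (coef_shift 1 c) a.
Proof.
move=> cA as_; have s0 : 0 < s by exact: le_lt_trans (normc_ge0 a) as_.
have h1 := coef_bound_cvg cA as_.
have h2 := coef_bound_cvg (coef_bound_shift 1 s0 cA) as_.
apply: (@cvgc_unique R nat \oo _ (fun n => series (fun k => c k * a ^+ k) (n + 1)%N)).
  by rewrite (cvg_shiftn 1 (series (fun k => c k * a ^+ k))); exact: h1.
rewrite (_ : (fun n => _) = (cst (c 0%N)) \+
    (cst a \* series (fun k => coef_shift 1 c k * a ^+ k))).
  apply: cvgD; first exact: cvg_cst.
  by apply: cvgM h2; exact: cvg_cst.
apply/funext => n; rewrite /= addn1 !series_ordE big_ord_recl expr0 mulr1; congr (_ + _).
rewrite mulr_sumr; apply: eq_bigr => k _; rewrite /= exprS.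
by rewrite /coef_shift ?add1n mulrCA.
Qed.

Lemma psum_shift_rec c s A a k : coef_bound c s A -> normc a < s ->
  psum (coef_shift k c) a = c k + a * psum (coef_shift k.+1 c) a.
Proof.
move=> cA as_; have s0 : 0 < s by exact: le_lt_trans (normc_ge0 a) as_.
rewrite (psum_rec (coef_bound_shift k s0 cA) as_) /coef_shift addn0.
congr (_ + _ * psum _ _); apply/funext => i.
by rewrite addnA addn1.
Qed.

(** The coefficients of the difference quotient [(f z - f a) / (z - a)]. *)
Definition quot c a k : C := psum (coef_shift k.+1 c) a.

Lemma coef_bound_quot c s A a : coef_bound c s A -> normc a < s ->
  coef_bound (quot c a) s (A / (s - normc a)).
Proof.
move=> cA as_ k; have s0 : 0 < s by exact: le_lt_trans (normc_ge0 a) as_.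
have := coef_bound_psum_le (coef_bound_shift k.+1 s0 cA) as_.
rewrite -(ler_pM2r (x := s ^+ k)) ?exprn_gt0 //; move/le_trans; apply.
rewrite le_eqVlt; apply/orP; left; apply/eqP.
rewrite exprS; field.
by rewrite subr_eq0 !gt_eqF // exprn_gt0.
Qed.

Lemma ps_quot rho f c a : ps rho f c -> normc a < rho ->
  ps rho (psum (quot c a)) (quot c a).
Proof.
move=> pf ar; apply: psumP => r r0 rr.
have m0 : 0 <= Num.max (normc a) r by rewrite le_max r0 orbT.
have m1 : Num.max (normc a) r < rho by rewrite gt_max ar rr.
have [s [A [ms sr s0 cA]]] := ps_coef_bound_gt pf m0 m1.
move: ms; rewrite gt_max => /andP[as_ rs].
exists (A / (s - normc a)) => k; apply: le_trans (coef_bound_quot cA as_ k).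
apply: ler_wpM2l; first exact: normc_ge0.
by rewrite lerXn2r ?nnegrE //; [exact: le_trans (ltW rs)|exact: ltW].
Qed.

(** The recursion [quot_k = c_(k+1) + a quot_(k+1)] telescopes. *)
Lemma quot_tele rho f c a z n : ps rho f c -> normc a < rho ->
  (z - a) * \sum_(k < n) quot c a k * z ^+ k =
  \sum_(k < n) c k * z ^+ k + psum (coef_shift n c) a * z ^+ n - f a.
Proof.
move=> pf ar.
have [s [A [as_ sr s0 cA]]] := ps_coef_bound_gt pf (normc_ge0 a) ar.
have rec k := psum_shift_rec k cA as_.
elim: n => [|n IH].
  rewrite !big_ord0 mulr0 add0r expr0 mulr1 (ps_psumE pf ar).
  by rewrite (_ : coef_shift 0 c = c) ?subrr //; apply/funext => i; rewrite /coef_shift add0n.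
rewrite !big_ord_recr /= mulrDr IH rec /quot exprS; ring.
Qed.

(** Dividing by [z - a] is the one operation from which continuity, derivatives
    and re-expansions of power series are all obtained below. *)
Lemma ps_div rho f c a z : ps rho f c -> normc a < rho -> normc z < rho ->
  f z = f a + (z - a) * psum (quot c a) z.
Proof.
move=> pf ar zr; have pq := ps_quot pf ar.
suff : (z - a) * psum (quot c a) z = f z - f a by move=> ->; rewrite addrC subrK.
apply: (@cvgc_unique R nat \oo _ (fun n => (z - a) *
    series (fun k => quot c a k * z ^+ k) n)).
  by apply: cvgM (pq z zr); exact: cvg_cst.
have -> : (fun n => (z - a) * series (fun k => quot c a k * z ^+ k) n) =
   series (fun k => c k * z ^+ k) \+ (fun n => psum (coef_shift n c) a * z ^+ n) \- cst (f a).
  apply/funext => n; rewrite !series_ordE (quot_tele _ _ pf ar) /=.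
  by rewrite series_ordE.
apply: cvgB; last exact: cvg_cst.
rewrite -[X in _ --> X]addr0; apply: cvgD; first exact: pf.
have h : cst z \* (fun n => quot c a n * z ^+ n) @ \oo --> z * 0.
  apply: cvgM; first exact: cvg_cst.
  by apply: cvg_series_cvg_0; apply/cvg_ex; exists (psum (quot c a) z); exact: pq.
rewrite mulr0 in h; rewrite -(cvg_shiftn 1).
rewrite (_ : (fun n => _) = cst z \* (fun n => quot c a n * z ^+ n)) //.
by apply/funext => n; rewrite /= addn1 exprS mulrCA.
Qed.

Lemma ps_bounded rho f c r : ps rho f c -> r < rho ->
  exists K, 0 <= K /\ forall z, normc z <= r -> normc (f z) <= K.
Proof.
move=> pf rr; have [r0|r0] := leP 0 r; last first.
  by exists 0; split=> // z zr; have := le_lt_trans zr r0; rewrite ltNge normc_ge0.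
have [s [A [rs sr s0 cA]]] := ps_coef_bound_gt pf r0 rr.
have A0 := coef_bound_ge0 cA.
have h : 0 < 1 - r / s by rewrite subr_gt0 ltr_pdivrMr // mul1r.
exists (A / (1 - r / s)); split; first by rewrite divr_ge0 // ltW.
move=> z zr; apply: le_trans (ps_le pf cA (ltW sr) (le_lt_trans zr rs)) _.
rewrite ler_wpM2l // lef_pV2 ?posrE //.
  by rewrite lerD2l lerN2 ler_wpM2r // invr_ge0 ltW.
by apply: lt_le_trans h _; rewrite lerD2l lerN2 ler_wpM2r // invr_ge0 ltW.
Qed.

Lemma ps_continuous rho f c a : ps rho f c -> normc a < rho -> f z @[z --> a] --> f a.
Proof.
move=> pf ar; have pq := ps_quot pf ar.
pose s := (normc a + rho) / 2.
have [as_ sr] : normc a < s /\ s < rho by rewrite /s; split; lra.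
have [K [K0 HK]] := ps_bounded pq sr.
apply/(cvgcP (F := nbhs a)) => e e0.
have e1 : 0 < e / (K + 1) by rewrite divr_gt0 // ltr_wpDl.
near=> z.
have zs : normc z < s by near: z; exact: near_normc_lt.
rewrite (ps_div pf ar (lt_trans zs sr)) addrC addKr normcM.
have h1 : normc (z - a) < e / (K + 1) by near: z; exact: near_normcB_lt.
apply: (@le_lt_trans _ _ (normc (z - a) * (K + 1))).
  rewrite ler_wpM2l ?normc_ge0 //; apply: le_trans (HK _ (ltW zs)) _.
  by rewrite lerDl.
by rewrite -ltr_pdivlMr // ltr_wpDl.
Unshelve. all: by end_near. Qed.

Definition dcoef c k : C := k.+1%:R * c k.+1.

(** With [t_k = quot_k a^k], the recursion for [quot] gives
    [sum_(k < n) (k+1) c_(k+1) a^k = sum_(k < n) t_k - n t_n]. *)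
Lemma ps_dcoef rho f c a : ps rho f c -> normc a < rho ->
  series (fun k => dcoef c k * a ^+ k) @ \oo --> psum (quot c a) a.
Proof.
move=> pf ar.
have [s [A [as_ sr s0 cA]]] := ps_coef_bound_gt pf (normc_ge0 a) ar.
have rec k := psum_shift_rec k cA as_.
pose t k := quot c a k * a ^+ k.
have tE n : series t n = series (fun k => dcoef c k * a ^+ k) n + n%:R * t n.
  elim: n => [|n IH]; first by rewrite !series_ordE !big_ord0 mul0r addr0.
  rewrite !seriesS_c IH /t /dcoef /quot (rec n.+1) exprS -(natr1 n); ring.
rewrite (_ : series _ = series t \- (fun n => n%:R * t n)); last first.
  by apply/funext => n; rewrite /= tE addrK.
rewrite -[X in _ --> X]subr0; apply: cvgB; first exact: (ps_quot pf ar).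
pose q := normc a / s.
have q0 : 0 <= q by rewrite divr_ge0 ?normc_ge0 // ltW.
have q1 : q < 1 by rewrite ltr_pdivrMr // mul1r.
pose A' := A / (s - normc a).
have cq := coef_bound_quot cA as_.
have A0 := coef_bound_ge0 cq.
have /cvgrPdist_lt H : (fun n => A' * (n%:R * q ^+ n)) @ \oo --> (0 : R).
  by rewrite -[X in _ --> X](mulr0 A'); apply: cvgM; [exact: cvg_cst|exact: cvg_nexp].
apply/cvgcP => e e0; apply: filterS (H e e0) => n.
rewrite sub0r normrN subr0; apply: le_lt_trans; apply: le_trans (ler_norm _).
rewrite normcM normc_nat mulrCA ler_wpM2l ?ler0n // /t normcM normcX.
by apply: coef_bound_term => //; exact: normc_ge0.
Qed.

Lemma ps_diffq_cvg rho f c a : ps rho f c -> normc a < rho ->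
  h^-1 *: (f (h + a) - f a) @[h --> 0^'] --> psum (quot c a) a.
Proof.
move=> pf ar; have pq := ps_quot pf ar.
have cg := ps_continuous pq ar.
have ca : h + a @[h --> (0 : C)^'] --> a.
  apply/(cvgcP (F := (0 : C)^')) => e e0; apply: nbhs_dnbhs.
  by apply: filterS (near_normcB_lt 0 e0) => h; rewrite subr0 addrK.
have hr0 : \forall h \near (0 : C)^', normc (h + a) < rho.
  exact: (ca _ (near_normc_lt ar)).
have := cvg_comp _ _ ca cg; apply: cvg_trans; apply: near_eq_cvg.
near=> h.
have h0 : h != 0 by near: h; exact: nbhs_dnbhs_neq.
have hr : normc (h + a) < rho by near: h.
rewrite /= (ps_div pf ar hr) (addrC (f a)) addrK addrK /GRing.scale /= mulKf //.
Unshelve. all: by end_near. Qed.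

(** The difference quotient at [a] is the sum of [quot c a], by [ps_div], and it
    is continuous at [a]. *)
Lemma ps_derive1 rho f c : ps rho f c -> ps rho (derive1 f) (dcoef c).
Proof.
move=> pf a ar; rewrite /derive1 (cvgc_lim (ps_diffq_cvg pf ar)).
exact: ps_dcoef pf ar.
Qed.

Lemma ps_derive1n rho f c n : ps rho f c ->
  ps rho (derive1n n f) (fun k => ((k + n) ^_ n)%:R * c (k + n)%N).
Proof.
move=> pf; elim: n => [|n IH].
  by apply: ps_coef_ext pf _ => k; rewrite addn0 ffactn0 mul1r.
rewrite derive1nS; apply: ps_coef_ext (ps_derive1 IH) _ => k.
rewrite /dcoef mulrA -natrM addSnnS mulnC; congr (_%:R * _).
by rewrite ffactnSr addnS subSn ?leq_addl // addnK.
Qed.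

Lemma ps0 rho f c : ps rho f c -> 0 < rho -> f 0 = c 0%N.
Proof.
move=> pf r0; have /pf : normc (0 : C) < rho by rewrite normc0.
move/cvgc_unique; apply; apply/cvgcP => e e0; exists 1%N => // n /= n0.
rewrite series_ordE -(prednK n0) big_ord_recl /= expr0 mulr1 big1 ?addr0 ?subrr ?normc0 //.
by move=> i _; rewrite /bump /= expr0n /= mulr0.
Qed.

Lemma ps_coefE rho f c k : ps rho f c -> 0 < rho -> c k = taylor_coef f k.
Proof.
move=> pf r0; rewrite /taylor_coef (ps0 (ps_derive1n (n:=k) pf) r0) add0n ffactnn.
by rewrite mulrC mulKf // pnatr_eq0 -lt0n fact_gt0.
Qed.

Lemma ps_uniq rho f g c d : 0 < rho -> ps rho f c -> ps rho g d ->
  (forall z, normc z < rho -> f z = g z) -> c =1 d.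
Proof.
move=> r0 pf pg fg k; have pg' := ps_ext pf fg.
by rewrite (ps_coefE k pg' r0) (ps_coefE k pg r0).
Qed.

End Division.

(** * Means over circles and the Parseval formula *)

Section CircleMean.
Variable R : realType.
Local Notation mu := (@lebesgue_measure R).
Local Notation I := (`[0, 2 * pi]%classic : set R).
Implicit Types (p q : R -> R) (a b t : R).

(** The argument is a function of the angle, so that the same operator serves for
    circles of all radii. *)
Definition cmean p : R := (2 * pi)^-1 * \int[mu]_(t in I) p t.

Lemma twopi_gt0 : 0 < 2 * pi :> R.
Proof. by rewrite mulr_gt0 // pi_gt0. Qed.

Lemma cont_integrable p : continuous p -> mu.-integrable I (EFin \o p).
Proof.
move=> cp; apply: continuous_compact_integrable; first exact: segment_compact.
exact: continuous_subspaceT.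
Qed.

Lemma muI : mu I = (2 * pi)%:E.
Proof. by rewrite lebesgue_measure_itv /= lte_fin twopi_gt0 oppr0 adde0. Qed.

Lemma cmeanD p q : continuous p -> continuous q ->
  cmean (fun t => p t + q t) = cmean p + cmean q.
Proof.
move=> cp cq; rewrite /cmean RintegralD //; last 2 first.
- exact: cont_integrable.
- exact: cont_integrable.
by rewrite mulrDr.
Qed.

Lemma cmeanZ a p : continuous p -> cmean (fun t => a * p t) = a * cmean p.
Proof.
move=> cp; rewrite /cmean RintegralZl; last 2 first.
- exact: measurable_itv.
- exact: cont_integrable.
by rewrite [LHS]mulrCA.
Qed.

Lemma cmean_cst a : cmean (fun=> a) = a.
Proof.
rewrite /cmean Rintegral_cst; last exact: measurable_itv.
have e : fine (mu I) = 2 * pi by rewrite muI.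
by rewrite [fine _]e [LHS]mulrCA mulVf ?mulr1 // gt_eqF // twopi_gt0.
Qed.

Lemma cmean_le p q : continuous p -> continuous q -> (forall t, p t <= q t) ->
  cmean p <= cmean q.
Proof.
move=> cp cq pq; rewrite /cmean ler_wpM2l ?invr_ge0 ?(ltW twopi_gt0) //.
by apply: le_Rintegral => //; exact: cont_integrable.
Qed.

Lemma cmeanE p : continuous p ->
  (\int[mu]_(t in I) (p t)%:E = (2 * pi * cmean p)%:E)%E.
Proof.
move=> cp; rewrite /cmean mulrA divff ?gt_eqF ?twopi_gt0 // mul1r /Rintegral fineK //.
by apply: integrable_fin_num => //; exact: cont_integrable.
Qed.

Lemma cont_sum (J : Type) (s : seq J) (F : J -> R -> R) :
  (forall j, continuous (F j)) -> continuous (fun t => \sum_(j <- s) F j t).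
Proof.
move=> cF; elim: s => [|j s IH].
  by under eq_fun do rewrite big_nil; move=> t; exact: cvg_cst.
under eq_fun do rewrite big_cons; move=> t; apply: cvgD; [exact: cF|exact: IH].
Qed.

Lemma cmean_sum (J : Type) (s : seq J) (F : J -> R -> R) :
  (forall j, continuous (F j)) ->
  cmean (fun t => \sum_(j <- s) F j t) = \sum_(j <- s) cmean (F j).
Proof.
move=> cF; elim: s => [|j s IH].
  by under eq_fun do rewrite big_nil; rewrite big_nil cmean_cst.
rewrite big_cons -IH -cmeanD //; last exact: cont_sum.
by congr cmean; apply/funext => t; rewrite big_cons.
Qed.

Lemma cmean_uniform (P : nat -> R -> R) p :
  (forall n, continuous (P n)) -> continuous p ->
  (forall e, 0 < e -> \forall n \near \oo, forall t, `|P n t - p t| <= e) ->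
  cmean (P n) @[n --> \oo] --> cmean p.
Proof.
move=> cP cp H; apply/cvgrPdist_le => e e0.
apply: filterS (H e e0) => n Hn.
have key q q' : continuous q -> continuous q' -> (forall t, `|q t - q' t| <= e) ->
    cmean q - cmean q' <= e.
  move=> cq cq' qq; rewrite lerBlDl -(cmean_cst e) -cmeanD //; last first.
    by move=> t; exact: cvg_cst.
  apply: cmean_le => //.
    by move=> t; apply: cvgD; [exact: cq'|exact: cvg_cst].
  by move=> t; rewrite -lerBlDl; apply: le_trans (qq t); exact: ler_norm.
rewrite ler_norml; apply/andP; split.
  rewrite lerNl opprB; exact: key.
by apply: key => // t; rewrite distrC.
Qed.

Lemma cont_cosn (m : nat) : continuous (fun t : R => cos (m%:R * t)).
Proof.
move=> t; apply: (@continuous_comp _ _ _ (fun t => m%:R * t) (@cos R)); last exact: continuous_cos.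
by apply: cvgM; [exact: cvg_cst|exact: cvg_id].
Qed.

Lemma cont_sinn (m : nat) : continuous (fun t : R => sin (m%:R * t)).
Proof.
move=> t; apply: (@continuous_comp _ _ _ (fun t => m%:R * t) (@sin R)); last exact: continuous_sin.
by apply: cvgM; [exact: cvg_cst|exact: cvg_id].
Qed.

Lemma cont_trig a b (m : nat) : continuous (fun t : R => a * cos (m%:R * t) + b * sin (m%:R * t)).
Proof.
move=> t; apply: cvgD; (apply: cvgM; first exact: cvg_cst).
  exact: cont_cosn.
exact: cont_sinn.
Qed.

(** The integrand has an explicit periodic primitive. *)
Lemma cmean_trig a b (m : nat) : (0 < m)%N ->
  cmean (fun t => a * cos (m%:R * t) + b * sin (m%:R * t)) = 0.
Proof.
move=> m0; have mn0 : m%:R != 0 :> R by rewrite pnatr_eq0 -lt0n.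
pose F t : R := a / m%:R * sin (m%:R * t) - b / m%:R * cos (m%:R * t).
have dF t : is_derive t 1 F (a * cos (m%:R * t) + b * sin (m%:R * t)).
  have d0 : is_derive t 1 (fun t : R => m%:R * t) m%:R.
    apply: (is_derive_eq (is_deriveZ m%:R (is_derive_id t 1))).
    by rewrite /GRing.scale /= mulr1.
  have d1 := @is_derive1_comp _ (@sin R) (fun t => m%:R * t) t _ _ (is_derive_sin _) d0.
  have d2 := @is_derive1_comp _ (@cos R) (fun t => m%:R * t) t _ _ (is_derive_cos _) d0.
  have d3 := is_deriveZ (a / m%:R) d1; have d4 := is_deriveZ (b / m%:R) d2.
  apply: is_derive_eq (is_deriveB d3 d4) _.
  by rewrite /GRing.scale /=; field.
have h : (\int[mu]_(t in I) (a * cos (m%:R * t) + b * sin (m%:R * t))%:E =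
    (F (2 * pi))%:E - (F 0)%:E)%E.
  apply: (@continuous_FTC2 R (fun t => a * cos (m%:R * t) + b * sin (m%:R * t))).
  - exact: twopi_gt0.
  - by apply: continuous_subspaceT; exact: cont_trig.
  - have cF : continuous F by move=> t; apply: differentiable_continuous; exact/derivable1_diffP/ex_derive.
    split; first by move=> t _; apply: ex_derive.
    + by apply: cvg_at_right_filter; exact: cF.
    + by apply: cvg_at_left_filter; exact: cF.
  - by move=> t _; rewrite derive1E; apply: derive_val.
rewrite /cmean /Rintegral h.
have per : F (2 * pi) = F 0.
  have e (n : nat) : n%:R * (2 * pi) = 0 + (pi *+ 2) *+ n :> R.
    by rewrite add0r -[in RHS]mulr_natl -(mulr_natl pi).
  by rewrite /F mulr0 e (periodicn (@cosD2pi R)) (periodicn (@sinD2pi R)).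
by rewrite per /= subrr mulr0.
Qed.

End CircleMean.

Section Parseval.
Variable R : realType.
Local Notation C := (Cplx R).
Implicit Types (t r s rho A : R) (c : nat -> C) (f : C -> C).

Lemma normc_circle t : normc (circle_point t : C) = 1.
Proof. by rewrite /normc /= cos2Dsin2 sqrtr1. Qed.

Lemma circle_pointX t n : (circle_point t : C) ^+ n = circle_point (n%:R * t).
Proof.
elim: n => [|n IH]; first by rewrite expr0 mul0r /circle_point cos0 sin0.
rewrite exprS IH /circle_point -natr1 mulrDl mul1r addrC cosD sinD.
by simpc; congr (_ +i* _); rewrite addrC (mulrC (cos t)) ?(mulrC (sin t)).
Qed.

Lemma normc_rcircle r t : 0 <= r -> normc (r%:C * circle_point t : C) = r.
Proof. by move=> r0; rewrite normcM normc_real normc_circle mulr1 ger0_norm. Qed.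

Lemma continuous_circle : continuous (fun t : R => circle_point t : C).
Proof.
move=> t; apply/(cvgcP (F := nbhs t)) => e e0.
have e2 : 0 < e / 2 by rewrite divr_gt0.
have /cvgrPdist_lt/(_ _ e2) Hc := @continuous_cos R t.
have /cvgrPdist_lt/(_ _ e2) Hs := @continuous_sin R t.
near=> u; apply: le_lt_trans (normc_le_ReIm _) _; rewrite [e]splitr /=.
apply: ltrD; rewrite distrC; near: u; [exact: Hc|exact: Hs].
Unshelve. all: by end_near. Qed.

Lemma continuous_circle_sq rho f c r : ps rho f c -> 0 <= r -> r < rho ->
  continuous (fun t => normc (f (r%:C * circle_point t)) ^+ 2).
Proof.
move=> pf r0 rr t.
have cz : continuous (fun t : R => r%:C * circle_point t : C).
  by move=> u; apply: cvgM; [exact: cvg_cst|exact: continuous_circle].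
have cf := ps_continuous pf (_ : normc (r%:C * circle_point t) < rho).
have {}cf : f (r%:C * circle_point u) @[u --> t] --> f (r%:C * circle_point t).
  by apply: (cvg_comp _ _ (cz t)); apply: cf; rewrite normc_rcircle.
have h : normc (f (r%:C * circle_point u)) @[u --> t] -->
    normc (f (r%:C * circle_point t)) by exact: (cvgc_norm cf).
rewrite (_ : (fun t => _) = (fun u => normc (f (r%:C * circle_point u))) \*
  (fun u => normc (f (r%:C * circle_point u)))); first exact: (cvgM h h).
by apply/funext => u; rewrite expr2.
Qed.

Definition ppoly c n z : C := \sum_(k < n) c k * z ^+ k.

Lemma ps_ppoly rho c n : ps rho (ppoly c n) (fun k => if (k < n)%N then c k else 0).
Proof.
move=> z _; apply/cvgcP => e e0; exists n => // m /= nm.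
rewrite series_ordE -(subnKC nm) big_split_ord /= [X in (_ + X) - _]big1 => [|k _].
  rewrite addr0 /ppoly (eq_bigr (fun k : 'I_n => c k * z ^+ k)) ?subrr ?normc0 // => k _.
  by rewrite ltn_ord.
by rewrite ltnNge leq_addr mul0r.
Qed.

Lemma continuous_ppoly_sq c n r : 0 <= r ->
  continuous (fun t => normc (ppoly c n (r%:C * circle_point t)) ^+ 2).
Proof.
move=> r0; apply: (continuous_circle_sq (ps_ppoly (rho := r + 1) (c := c) (n := n)) r0).
by rewrite ltrDl.
Qed.

Lemma normc_add_sqr (x y : C) :
  normc (x + y) ^+ 2 = normc x ^+ 2 + normc y ^+ 2 + 2 * complex.Re (x * y^*%C).
Proof. by case: x y => [a b] [c d]; rewrite !normc_sqr /=; ring. Qed.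

Lemma Re_circle (a b : C) k m t : (k < m)%N ->
  complex.Re (a * circle_point t ^+ k * (b * circle_point t ^+ m)^*%C) =
  complex.Re (a * b^*%C) * cos ((m - k)%N%:R * t) +
  complex.Im (a * b^*%C) * sin ((m - k)%N%:R * t).
Proof.
move=> km; have -> : circle_point t ^+ m =
    circle_point t ^+ k * circle_point t ^+ (m - k) :> C.
  by rewrite -exprD subnKC // ltnW.
have -> : a * circle_point t ^+ k *
    (b * (circle_point t ^+ k * circle_point t ^+ (m - k)))^*%C =
   (a * b^*%C) * (circle_point t ^+ (m - k))^*%C
     * (circle_point t ^+ k * (circle_point t ^+ k)^*%C).
  by rewrite !rmorphM /=; ring.
have -> : circle_point t ^+ k * (circle_point t ^+ k)^*%C = 1 :> C.
  by rewrite -sqr_normc normcE_norm normcX normc_circle expr1n expr1n.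
rewrite mulr1 circle_pointX; case: (a * b^*%C) => x y /=.
by rewrite mulrN opprK.
Qed.

(** Orthogonality of the exponentials, in the form of the Pythagoras step that
    adds one monomial to a polynomial of lower degree. *)
Lemma parseval_poly c n r : 0 <= r ->
  cmean (fun t => normc (ppoly c n (r%:C * circle_point t)) ^+ 2) =
  \sum_(k < n) normc (c k) ^+ 2 * r ^+ (2 * k).
Proof.
move=> r0; elim: n => [|n IH].
  rewrite big_ord0 -[RHS](cmean_cst 0); congr cmean; apply/funext => t.
  by rewrite /ppoly big_ord0 normc0 expr0n.
rewrite big_ord_recr -IH /=.
pose X t := normc (ppoly c n (r%:C * circle_point t)) ^+ 2.
pose Z (k : 'I_n) t :=
  complex.Re (c k * r%:C ^+ k * (c n * r%:C ^+ n)^*%C) * cos ((n - k)%N%:R * t) +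
  complex.Im (c k * r%:C ^+ k * (c n * r%:C ^+ n)^*%C) * sin ((n - k)%N%:R * t).
have cZ k : continuous (Z k) by exact: cont_trig.
have -> : (fun t => normc (ppoly c n.+1 (r%:C * circle_point t)) ^+ 2) =
    (fun t => X t + (normc (c n) ^+ 2 * r ^+ (2 * n) + 2 * \sum_(k < n) Z k t)).
  apply/funext => t; rewrite /ppoly big_ord_recr /= normc_add_sqr -/(ppoly c n _).
  rewrite addrA; congr (_ + _ + _ * _).
    by rewrite normcM normcX normc_rcircle // exprMn -exprM mulnC.
  rewrite mulr_suml raddf_sum /=; apply: eq_bigr => k _.
  by rewrite !exprMn !mulrA Re_circle.
rewrite cmeanD; last 2 first.
- exact: continuous_ppoly_sq.
- move=> t; apply: cvgD; first exact: cvg_cst.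
  by apply: cvgM; [exact: cvg_cst|exact: cont_sum].
congr (_ + _); rewrite cmeanD; last 2 first.
- by move=> t; exact: cvg_cst.
- by move=> t; apply: cvgM; [exact: cvg_cst|exact: cont_sum].
rewrite cmean_cst cmeanZ; last exact: cont_sum.
rewrite cmean_sum // big1 ?mulr0 ?addr0 // => k _.
by apply: cmean_trig; rewrite subn_gt0.
Qed.

(** The partial sums converge uniformly on the circle of radius [r < rho]. *)
Lemma parseval rho f c r : ps rho f c -> 0 <= r -> r < rho ->
  (fun n => \sum_(k < n) normc (c k) ^+ 2 * r ^+ (2 * k)) @ \oo -->
  cmean (fun t => normc (f (r%:C * circle_point t)) ^+ 2).
Proof.
move=> pf r0 rr.
have -> : (fun n => \sum_(k < n) normc (c k) ^+ 2 * r ^+ (2 * k)) =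
  (fun n => cmean (fun t => normc (ppoly c n (r%:C * circle_point t)) ^+ 2)).
  by apply/funext => n; rewrite parseval_poly.
have [s [A [rs sr s0 cA]]] := ps_coef_bound_gt pf r0 rr.
have A0 := coef_bound_ge0 cA.
pose q := r / s.
have q0 : 0 <= q by rewrite divr_ge0 // ltW.
have q1 : q < 1 by rewrite ltr_pdivrMr // mul1r.
have q1' : 0 < 1 - q by rewrite subr_gt0.
pose K := A / (1 - q).
have K0 : 0 <= K by rewrite divr_ge0 // ltW.
have fK t : normc (f (r%:C * circle_point t)) <= K.
  by apply: le_trans (ps_le pf cA (ltW sr) _) _; rewrite normc_rcircle.
have pK n t : normc (ppoly c n (r%:C * circle_point t)) <= K.
  apply: le_trans (normc_sum _ _ _) _.
  by under eq_bigr do rewrite normcM normcX normc_rcircle //; exact: coef_bound_sum.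
have tail n t : normc (f (r%:C * circle_point t) - ppoly c n (r%:C * circle_point t)) <=
    K * q ^+ n.
  set z := r%:C * _; have zr : normc z < rho by rewrite normc_rcircle.
  have zz : (fun m => series (fun k => c k * z ^+ k) m - ppoly c n z) @ \oo --> f z - ppoly c n z.
    by apply: cvgB; [exact: pf|exact: cvg_cst].
  apply: (normc_lim_le zz); near=> m.
  have nm : (n <= m)%N by near: m; exact: nbhs_infty_ge.
  rewrite series_ordE /ppoly.
  rewrite -(subnKC nm) (big_ord_tail (fun j => c j * z ^+ j)); apply: le_trans (normc_sum _ _ _) _.
  apply: (@le_trans _ _ (\sum_(j < m - n) A * q ^+ n * q ^+ j)).
    apply: ler_sum => j _; rewrite normcM normcX normc_rcircle // -mulrA -exprD.
    exact: coef_bound_term.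
  rewrite -mulr_sumr /K [leRHS]mulrAC ler_wpM2l ?geo_sum_le //.
  by rewrite mulr_ge0 // exprn_ge0.
apply: cmean_uniform.
- by move=> n; exact: continuous_ppoly_sq.
- exact: continuous_circle_sq pf r0 rr.
move=> e e0.
have /cvgrPdist_lt/(_ _ e0) H : (fun n => 2 * K * K * q ^+ n) @ \oo --> (0 : R).
  by apply: (cvg_geometric (2 * K * K)); rewrite ger0_norm.
apply: filterS H => n; rewrite sub0r normrN => H t.
apply: le_trans (ltW H); apply: le_trans (ler_norm _).
set x := ppoly _ _ _; set y := f _.
rewrite subr_sqr normrM (_ : 2 * K * K * q ^+ n = (K * q ^+ n) * (2 * K)); last by ring.
apply: ler_pM => //.
  apply: le_trans (tail n t); rewrite ler_norml -/x -/y.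
  have := le_normcB x y; have := le_normcB y x; rewrite (normcB x y).
  by move=> h1 h2; apply/andP; split; lra.
rewrite ger0_norm ?addr_ge0 ?normc_ge0 //.
by have := fK t; have := pK n t; rewrite -/x -/y; lra.
Unshelve. all: by end_near. Qed.

Lemma parseval_le rho f c r n : ps rho f c -> 0 <= r -> r < rho ->
  \sum_(k < n) normc (c k) ^+ 2 * r ^+ (2 * k) <=
  cmean (fun t => normc (f (r%:C * circle_point t)) ^+ 2).
Proof.
move=> pf r0 rr; have h := parseval pf r0 rr.
rewrite -(cvg_lim _ h) //; apply: (@nondecreasing_cvgn_le _ (fun n =>
  \sum_(k < n) normc (c k) ^+ 2 * r ^+ (2 * k))); last by apply: (cvgP _ h).
apply: homo_leq => [|x y z|m]; [exact: lexx|exact: le_trans|].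
by rewrite big_ord_recr /= lerDl mulr_ge0 ?sqr_ge0 ?exprn_ge0.
Qed.

(** By Parseval, the mean of [|f|^2] dominates the square of every single term. *)
Lemma cauchy_estimate rho f c r K k : ps rho f c -> 0 <= r -> r < rho -> 0 <= K ->
  (forall z, normc z = r -> normc (f z) <= K) -> normc (c k) * r ^+ k <= K.
Proof.
move=> pf r0 rr K0 HK.
rewrite -ler_sqr ?nnegrE ?mulr_ge0 ?normc_ge0 ?exprn_ge0 //.
rewrite exprMn -exprM mulnC.
apply: (@le_trans _ _ (\sum_(j < k.+1) normc (c j) ^+ 2 * r ^+ (2 * j))).
  rewrite big_ord_recr /= lerDr sumr_ge0 // => j _.
  by rewrite mulr_ge0 ?sqr_ge0 ?exprn_ge0.
apply: le_trans (parseval_le _ pf r0 rr) _.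
rewrite -(cmean_cst (K ^+ 2)); apply: cmean_le.
- exact: continuous_circle_sq pf r0 rr.
- by move=> t; exact: cvg_cst.
- move=> t; rewrite ler_sqr ?nnegrE ?normc_ge0 //; apply: HK; exact: normc_rcircle.
Qed.

End Parseval.

(** * Expansion at other points and analytic continuation *)

Section Reexpansion.
Variable R : realType.
Local Notation C := (Cplx R).
Implicit Types (t r s rho A e : R) (a b z w : C) (c d : nat -> C) (f : C -> C).

Lemma near_disk (P : C -> Prop) a : (\forall z \near a, P z) ->
  exists e, 0 < e /\ forall z, normc (z - a) < e -> P z.
Proof.
move=> /nbhs_ballP[[e i]] /=; rewrite ltcE /= => /andP[/eqP i0 e0] H.
exists e; split => // z za; apply: H; rewrite /ball /= normcE_norm ltcE /= i0 eqxx /=.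
by rewrite normcB.
Qed.

Lemma coef_bound_le c s A s' A' : coef_bound c s A -> 0 <= s' -> s' <= s -> A <= A' ->
  coef_bound c s' A'.
Proof.
move=> cA s0 ss AA k; apply: le_trans AA; apply: le_trans (cA k).
apply: ler_wpM2l; first exact: normc_ge0.
by rewrite lerXn2r ?nnegrE //; exact: le_trans ss.
Qed.

Lemma psum_ps c s A : coef_bound c s A -> ps s (psum c) c.
Proof.
move=> cA; apply: psumP => r r0 rs; exists A.
by apply: (coef_bound_le cA) => //; exact: ltW.
Qed.

Lemma ps_unique_val rho f g c z : ps rho f c -> ps rho g c -> normc z < rho -> f z = g z.
Proof. by move=> pf pg zr; exact: (cvgc_unique (pf z zr) (pg z zr)). Qed.

(** Iterating the division by [z - a] yields the Taylor expansion at [a]. *)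
Lemma ps_reexpand f c s A a : ps s f c -> coef_bound c s A -> normc a < s ->
  exists d, ps (s - normc a) (fun w => f (a + w)) d /\
    coef_bound d (s - normc a) (A / (1 - normc a / s)).
Proof.
move=> pf cA as_; have s0 : 0 < s by exact: le_lt_trans (normc_ge0 a) as_.
have sa : 0 < s - normc a by rewrite subr_gt0.
pose q K := iter K (fun q => quot q a) c.
have qA K : coef_bound (q K) s (A / (s - normc a) ^+ K).
  elim: K => [|K IH]; first by rewrite expr0 divr1.
  apply: (coef_bound_le (coef_bound_quot IH as_)) => //; first exact: ltW.
  by rewrite exprSr invfM mulrA.
pose d K := psum (q K) a.
have dA : coef_bound d (s - normc a) (A / (1 - normc a / s)).
  move=> k; have := coef_bound_psum_le (qA k) as_.
  rewrite -(ler_pM2r (x := (s - normc a) ^+ k)) ?exprn_gt0 //; move/le_trans; apply.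
  rewrite le_eqVlt; apply/orP; left; apply/eqP; field.
  by rewrite subr_eq0 !gt_eqF // exprn_gt0.
exists d; split => // w ws.
have zs : normc (a + w) < s.
  by apply: le_lt_trans (le_normcD _ _) _; rewrite -ltrBrDl.
have stepE K : f (a + w) = \sum_(k < K) d k * w ^+ k + w ^+ K * psum (q K) (a + w).
  elim: K => [|K IH]; first by rewrite big_ord0 add0r mul1r (ps_psumE pf).
  rewrite IH big_ord_recr /= -addrA; congr (_ + _).
  rewrite (ps_div (psum_ps (qA K)) as_ zs) (addrAC a w) subrr add0r -/(d K).
  by rewrite /= exprS; ring.
pose x := normc w / (s - normc a).
have x0 : 0 <= x by rewrite divr_ge0 ?normc_ge0 // ltW.
have x1 : x < 1 by rewrite ltr_pdivrMr // mul1r.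
pose K0 := A / (1 - normc (a + w) / s).
have /cvgrPdist_lt H : (fun n => K0 * x ^+ n) @ \oo --> (0 : R).
  by apply: (cvg_geometric K0); rewrite ger0_norm.
apply/cvgcP => e e0; apply: filterS (H e e0) => n.
rewrite sub0r normrN => /(le_lt_trans (ler_norm _)); apply: le_lt_trans.
rewrite series_ordE (stepE n) opprD addrA subrr add0r normcN normcM normcX.
have := coef_bound_psum_le (qA n) zs.
move/(ler_wpM2l (exprn_ge0 n (normc_ge0 w)))/le_trans; apply.
rewrite le_eqVlt; apply/orP; left; apply/eqP.
rewrite /K0 /x expr_div_n; ring.
Qed.

Lemma derive1n_shift f a k w : derive1n k (fun w => f (a + w)) w = derive1n k f (a + w).
Proof.
elim: k w => [//|k IH] w; rewrite !derive1nS.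
have -> : derive1n k (fun w => f (a + w)) = (fun w => derive1n k f (a + w)) by exact/funext.
rewrite /derive1 (_ : (fun h => _) = (fun h => h^-1 *: (derive1n k f (h + (a + w)) - derive1n k f (a + w)))) //.
apply/funext => h.
by rewrite addrCA.
Qed.

(** Every circle is the image of a compact interval. *)
Lemma polar z : exists2 t, `[0, 2 * pi]%classic t & z = (normc z)%:C * circle_point t.
Proof.
have [->|z0] := eqVneq z 0.
  exists 0; first by rewrite /= in_itv /= lexx mulr_ge0 // pi_ge0.
  by rewrite normc0 mul0r.
have n0 : normc z != 0 by rewrite normc_eq0.
suff [t tI E] : exists2 t, `[0, 2 * pi]%classic t & z / (normc z)%:C = circle_point t.
  exists t => //; rewrite -E mulrCA divff ?mulr1 //.
  by apply: contra n0; rewrite -normc_eq0 normc_real normr_eq0.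
have : normc (z / (normc z)%:C) = 1.
  by rewrite normcM normcV normc_real ger0_norm ?normc_ge0 // divff.
case: (z / _) => x y u1.
have u2 : x ^+ 2 + y ^+ 2 = 1.
  have /= := f_equal (fun x => x ^+ 2) u1.
  by rewrite sqr_sqrtr ?addr_ge0 ?sqr_ge0 // expr1n.
have x1 : -1 <= x <= 1.
  rewrite -ler_norml -(ler_pXn2r (n:=2)) ?nnegrE // real_normK ?num_real // expr1n.
  by rewrite -u2 lerDl sqr_ge0.
have y2 : 1 - x ^+ 2 = y ^+ 2 by rewrite -u2 addrC addKr.
have [y0|y0] := leP 0 y.
  exists (acos x).
    by rewrite /= in_itv /= acos_ge0 //= (le_trans (acos_lepi x1)) // ler_peMl ?pi_ge0 // ler1n.
  by rewrite /circle_point acosK ?in_itv //= sin_acos // y2 sqrtr_sqr ger0_norm.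
exists (2 * pi - acos x).
  rewrite /= in_itv /= subr_ge0 gerBl acos_ge0 // andbT.
  by rewrite (le_trans (acos_lepi x1)) // ler_peMl ?pi_ge0 // ler1n.
have e : 2 * pi - acos x = - acos x + pi *+ 2 by rewrite addrC mulr_natl.
rewrite /circle_point e cosD2pi sinD2pi cosN sinN acosK ?in_itv //= sin_acos // y2 sqrtr_sqr.
by rewrite ltr0_norm // opprK.
Qed.

(** The radius [s] and the bound [A] are explicit because compactness has to make
    both uniform along a circle. *)
Definition expands f s A a := exists d, ps s (fun w => f (a + w)) d /\ coef_bound d s A.

Lemma expands_near f s A a b : expands f s A a -> normc (b - a) <= s / 2 ->
  expands f (s / 2) (2 * A) b.
Proof.
move=> [d [pd dA]] ba; have A0 := coef_bound_ge0 dA.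
have [s0|s0] := leP s 0.
  have E : normc (b - a) = 0 by apply/le_anti; rewrite normc_ge0 andbT; apply: le_trans ba _; lra.
  move/eqP: E; rewrite normc_eq0 subr_eq0 => /eqP ->.
  have [s00|sn] := eqVneq s 0.
    exists d; split; first by rewrite s00 mul0r -s00.
    by rewrite s00 mul0r -s00; apply: (coef_bound_le dA); rewrite ?s00 //; lra.
  exists (fun=> 0); split.
    by move=> z; have := normc_ge0 z => h1 h2; exfalso; lra.
  by move=> k; rewrite normc0 mul0r; lra.
have bs : normc (b - a) < s by lra.
have [d' [pd' dA']] := ps_reexpand pd dA bs.
exists d'; split.
  apply: ps_lt (_ : s / 2 <= s - normc (b - a)); last lra.
  by apply: (ps_ext pd' _) => z _; rewrite addrA subrKC.
apply: (coef_bound_le dA'); [lra|lra|].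
have h : 1 / 2 <= 1 - normc (b - a) / s.
  have : normc (b - a) / s <= 1 / 2 by rewrite ler_pdivrMr //; lra.
  lra.
rewrite mulrC; apply: ler_wpM2r => //.
rewrite -[leRHS]invrK lef_pV2 ?posrE; lra.
Qed.

Lemma expands_le f s A a s' A' : expands f s A a -> 0 <= s' -> s' <= s -> A <= A' ->
  expands f s' A' a.
Proof.
move=> [d [pd dA]] s0 ss AA; exists d; split; first exact: (ps_lt pd ss).
exact: (coef_bound_le dA).
Qed.

Lemma expands_coef f s A a k : expands f s A a -> 0 < s ->
  normc (derive1n k f a) * s ^+ k <= k`!%:R * A.
Proof.
move=> [d [pd dA]] s0.
have := ps_coefE k pd s0; rewrite /taylor_coef derive1n_shift addr0 => E.
have -> : derive1n k f a = k`!%:R * d k.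
  by rewrite E mulrC divfK // pnatr_eq0 -lt0n fact_gt0.
by rewrite normcM normc_nat -mulrA ler_wpM2l.
Qed.

(** One natural number encodes both constants, as [s = 1 / (n+1)] and [A = n], so
    that the covering form of compactness applies. *)
Lemma expands_uniform f rho : 0 <= rho ->
  (forall a, normc a = rho -> exists s A, 0 < s /\ expands f s A a) ->
  exists s A, 0 < s /\ forall a, normc a = rho -> expands f s A a.
Proof.
move=> r0 H.
have cI : compact `[0, 2 * pi : R]%classic by exact: segment_compact.
move/compact_near_coveringP : cI => cI.
pose P (n : nat) t := expands f (n.+1%:R^-1) n%:R (rho%:C * circle_point t).
have {}cI : \forall n \near \oo, `[0, 2 * pi : R]%classic `<=` P n.
  apply: cI => t _.
  have [s [A [s0 ex]]] := H (rho%:C * circle_point t) (normc_rcircle t r0).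
  have s2 : 0 < s / 2 by rewrite divr_gt0.
  have Ht : \forall t' \near t, normc (rho%:C * circle_point t' - rho%:C * circle_point t : C) < s / 2.
    have cz : rho%:C * circle_point u @[u --> t] --> (rho%:C * circle_point t : C).
      by apply: cvgM; [exact: cvg_cst|exact: continuous_circle].
    exact: ((cvgcP _ _).1 cz _ s2).
  have Hn : \forall n \near \oo, n.+1%:R^-1 <= s / 2 /\ 2 * A <= n%:R.
    near=> n; split.
      rewrite -[leRHS]invrK lef_pV2 ?posrE ?invr_gt0 //.
      apply: le_trans (_ : n%:R <= _); last by rewrite ler_nat.
      by near: n; exact: nbhs_infty_ger.
    by near: n; exact: nbhs_infty_ger.
  exists ([set t' | normc (rho%:C * circle_point t' - rho%:C * circle_point t : C) < s / 2],
          [set n : nat | n.+1%:R^-1 <= s / 2 /\ 2 * A <= n%:R]) => //=.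
  move=> [t' n] [ht [h1 h2]].
  have ex' : expands f (s / 2) (2 * A) (rho%:C * circle_point t').
    by apply: (expands_near ex); exact: (ltW ht).
  rewrite /P /=; apply: (expands_le ex' _ h1 h2).
  by rewrite invr_ge0.
near \oo => n.
exists n.+1%:R^-1, n%:R; split; first by rewrite invr_gt0.
move=> a ar; have [t tI ->] := polar a; rewrite ar.
by move: t tI; near: n.
Unshelve. all: by end_near. Qed.

(** The Cauchy estimates of all derivatives near the circle bounding the disk add
    up, by the binomial theorem, to a bound on the original coefficients that is
    valid beyond this circle. *)
Lemma ps_extend f c rho : 0 < rho -> ps rho f c ->
  (forall a, normc a = rho -> exists s A, 0 < s /\ expands f s A a) ->
  exists2 rho', rho < rho' & ps rho' f c.
Proof.
move=> r0 pf loc.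
have [s0 [A [s00 ex0]]] := expands_uniform (ltW r0) loc.
pose s := Num.min s0 rho.
have s1 : 0 < s by rewrite lt_min s00 r0.
have sr : s <= rho by rewrite ge_min lexx orbT.
have ex a : normc a = rho -> expands f s A a.
  move=> /ex0 h; apply: (expands_le h) => //; first exact: ltW.
  by rewrite ge_min lexx.
have A0 : 0 <= A.
  have [d [_ dA]] : expands f s A (rho%:C) by apply: ex; rewrite normc_real gtr0_norm.
  exact: coef_bound_ge0 dA.
have radial z (x : R) : normc z != 0 -> 0 <= x ->
   normc ((x / normc z)%:C * z) = x /\ normc (z - (x / normc z)%:C * z) = `|normc z - x|.
  move=> z0 x0; split.
    by rewrite normcM normc_real ger0_norm ?divr_ge0 ?normc_ge0 // divfK.
  have -> : z - (x / normc z)%:C * z = (1 - x / normc z)%:C * z.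
    by rewrite rmorphB rmorph1 mulrBl mul1r.
  rewrite normcM normc_real -[X in _ * X]ger0_norm ?normc_ge0 // -normrM.
  by rewrite mulrBl mul1r divfK.
have exin a : rho - s / 2 <= normc a -> normc a < rho -> expands f (s / 2) (2 * A) a.
  move=> h1 h2.
  have an0 : normc a != 0 by rewrite gt_eqF //; lra.
  have [e1 e2] := radial a rho an0 (ltW r0).
  apply: expands_near (ex _ e1) _; rewrite e2 ltr0_norm; lra.
(* The estimates are made on the circle of radius [r], around whose points the
   function expands on disks of radius [s / 2]; since [r + s / 4 > rho], this
   bounds the coefficients on a disk larger than that of radius [rho]. *)
pose r := rho - s / 8.
have cb : coef_bound c (rho + s / 8) (4 * A).
  move=> N.
  have key k : (k <= N)%N -> 'C(N, k)%:R * normc (c N) * r ^+ (N - k) * (s / 4) ^+ k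
      <= 2 * A * 2^-1 ^+ k.
    move=> kN.
    have pk := ps_derive1n (n := k) pf.
    pose Kk := k`!%:R * (2 * A) / (s / 2) ^+ k.
    have s2k : 0 < (s / 2) ^+ k by rewrite exprn_gt0 // divr_gt0.
    have Kk0 : 0 <= Kk by rewrite divr_ge0 // ?mulr_ge0 // ltW.
    have r00 : 0 <= r by rewrite /r; lra.
    have rr : r < rho by rewrite /r; lra.
    have := @cauchy_estimate _ rho _ _ r Kk (N - k)%N pk r00 rr Kk0.
    rewrite subnK // normcM normc_nat => ce.
    have {}ce : (N ^_ k)%:R * normc (c N) * r ^+ (N - k) <= Kk.
      apply: ce => z zr; rewrite ler_pdivlMr //.
      apply: expands_coef; last by rewrite divr_gt0.
      by apply: exin; rewrite zr // /r; lra.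
    have f0 : 0 < k`!%:R :> R by rewrite ltr0n fact_gt0.
    rewrite -(ler_pM2l f0).
    have -> : k`!%:R * ('C(N, k)%:R * normc (c N) * r ^+ (N - k) * (s / 4) ^+ k) =
       ((N ^_ k)%:R * normc (c N) * r ^+ (N - k)) * (s / 4) ^+ k.
      by rewrite -bin_ffact natrM; ring.
    have -> : k`!%:R * (2 * A * 2^-1 ^+ k) = Kk * (s / 4) ^+ k.
      have -> : s / 4 = (s / 2) * 2^-1 by field.
      by rewrite exprMn [RHS]mulrA /Kk divfK ?gt_eqF // !mulrA.
    by apply: ler_wpM2r => //; rewrite exprn_ge0 // divr_ge0 // ltW.
  have -> : rho + s / 8 = r + s / 4 by rewrite /r; field.
  rewrite exprDn mulr_sumr.
  apply: (@le_trans _ _ (\sum_(k < N.+1) 2 * A * 2^-1 ^+ k)).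
    apply: ler_sum => k _; apply: le_trans (key k _); last by rewrite -ltnS.
    by rewrite -mulr_natl le_eqVlt; apply/orP; left; apply/eqP; ring.
  rewrite -mulr_sumr.
  have : \sum_(k < N.+1) (2^-1 : R) ^+ k <= (1 - 2^-1)^-1.
    by apply: geo_sum_le; rewrite ?invr_ge0 // invf_lt1 // ltr1n.
  have -> : (1 - 2^-1)^-1 = 2 :> R by field.
  move/(ler_wpM2l (mulr_ge0 (ler0n _ 2) A0))/le_trans; apply; lra.
(* At the points [z] beyond the old circle, [f] and the sum of the series are
   compared through their expansions at a point [a] inside the old disk, whose
   coefficients agree because the two functions agree near [a]. *)
exists (rho + s / 16); first lra.
have pF := psum_ps cb.
move=> z zr; have [zlt|zge] := ltP (normc z) rho; first exact: pf.
have zlt' : normc z < rho + s / 8 by lra.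
suff -> : f z = psum c z by exact: pF.
have x0 : 0 <= rho - s / 16 by lra.
have z0 : normc z != 0 by rewrite gt_eqF //; lra.
have [e1 e2] := radial z _ z0 x0; set a := (_ * z) in e1 e2.
have [d [pd _]] : expands f (s / 2) (2 * A) a by apply: exin; rewrite e1; lra.
have [|d' [pd' _]] := @ps_reexpand (psum c) c _ _ a pF cb; first by rewrite e1; lra.
have dd : d =1 d'.
  apply: (@ps_uniq _ (s / 16) _ _ _ _ _ (ps_lt pd _) (ps_lt pd' _)); [lra|lra|rewrite e1; lra|].
  move=> w ws; apply: ps_psumE pf _.
  by apply: le_lt_trans (le_normcD _ _) _; rewrite e1; lra.
have := @ps_unique_val (s / 8) (fun w => f (a + w)) (fun w => psum c (a + w)) d (z - a).
rewrite /= !subrKC; apply.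
- by apply: (ps_lt pd _); lra.
- have pd2 : ps (s / 8) (fun w => psum c (a + w)) d' by apply: (ps_lt pd'); rewrite e1; lra.
  exact: (ps_coef_ext pd2 (fun k => esym (dd k))).
- by rewrite e2 ger0_norm; lra.
Qed.

(** The supremum of the radii on which the Taylor series at the origin represents
    [f] is attained, and [ps_extend] forbids that it be less than 1. *)
Lemma analytic_ps f : analytic_on_disk f -> ps 1 f (taylor_coef f).
Proof.
move=> an.
have loc a : normc a < 1 -> exists s A, 0 < s /\ expands f s A a.
  move=> a1; have [c /near_disk[e [e0 He]]] := an a a1.
  have pe : ps e (fun w => f (a + w)) c.
    by move=> w we; have := He (a + w); rewrite addrC addKr; apply.
  have e2 : 0 <= e / 2 by lra.
  have e3 : e / 2 < e by lra.
  have [A cA] := ps_coef_bound pe e2 e3.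
  exists (e / 2), A; split; first lra.
  by exists c; split => //; apply: (ps_lt pe); lra.
have [s [A [s0 [d [pd _]]]]] := loc 0 (in_disk0 R).
have {pd} pd : ps s f (taylor_coef f).
  have {}pd : ps s f d by apply: (ps_ext pd _) => z _; rewrite add0r.
  by apply: (ps_coef_ext pd _) => k; exact: ps_coefE pd s0.
pose X := [set rho : R | ps rho f (taylor_coef f)].
have [[rho Xr r1]|H] := pselect (exists2 rho, X rho & 1 <= rho); first exact: (ps_lt Xr r1).
have ubX : ubound X 1.
  by move=> rho Xr; rewrite leNgt; apply/negP => h; apply: H; exists rho => //; exact: ltW.
have supX : has_sup X by split; [exists s|exists 1].
have Xsup : X (sup X).
  move=> z zs; have e0 : 0 < sup X - normc z by rewrite subr_gt0.
  have [rho Xr h] := sup_adherent e0 supX; apply: Xr.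
  by move: h; lra.
have sX : s <= sup X by exact: (ub_le_sup supX.2 pd).
have sup1 : sup X <= 1 by exact: ge_sup supX.1 ubX.
have [s1|s1] := leP 1 (sup X); first exact: ps_lt Xsup s1.
have [] := @ps_extend f _ (sup X) (lt_le_trans s0 sX) Xsup.
  by move=> a as_; apply: loc; rewrite as_.
move=> rho' h1 h2; have := ub_le_sup supX.2 h2; lra.
Qed.

End Reexpansion.

(** * Analytic functions on the disk and the Hardy norm *)

Section DiskFunctions.
Variable R : realType.
Local Notation C := (Cplx R).
Implicit Types (a z : C) (c : nat -> C) (f g : C -> C).

(** Being the sum of one's Taylor series on the unit disk: this is what analytic
    means from here on, by [analytic_ps]. *)
Definition dps f := ps 1 f (taylor_coef f).

Lemma dpsI f c : ps 1 f c -> dps f.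
Proof. by move=> pf; apply: (ps_coef_ext pf) => k; exact: (ps_coefE k pf ltr01). Qed.

Lemma dps_coef f c k : ps 1 f c -> taylor_coef f k = c k.
Proof. by move=> pf; rewrite -(ps_coefE k pf ltr01). Qed.

Lemma dps_ext f g : dps f -> (forall z, in_disk z -> f z = g z) -> dps g.
Proof. by move=> pf fg; apply: (@dpsI _ (taylor_coef f)); apply: (ps_ext pf). Qed.

Lemma dps_coef_ext f g k : dps f -> (forall z, in_disk z -> f z = g z) ->
  taylor_coef f k = taylor_coef g k.
Proof. by move=> pf fg; rewrite -(ps_coefE k (ps_ext pf fg) ltr01). Qed.

Lemma dps_cst a : dps (fun=> a).
Proof. exact: (dpsI (ps_cst 1 a)). Qed.

Lemma dps_id : dps (fun z => z).
Proof. exact: (dpsI (ps_id 1)). Qed.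

End DiskFunctions.

Arguments dps_cst {R} a.

Section DiskFunctions.
Variable R : realType.
Local Notation C := (Cplx R).
Implicit Types (s : R) (a b z : C) (c : nat -> C) (f g : C -> C).

Lemma dpsD f g : dps f -> dps g -> dps (fun z => f z + g z).
Proof. by move=> pf pg; exact: (dpsI (ps_add pf pg)). Qed.

Lemma dpsM f g : dps f -> dps g -> dps (fun z => f z * g z).
Proof. by move=> pf pg; exact: (dpsI (ps_mul pf pg)). Qed.

Lemma dpsN f : dps f -> dps (fun z => - f z).
Proof.
move=> pf; apply: (dps_ext (dpsM (dps_cst (-1)) pf)) => z _.
by rewrite mulN1r.
Qed.

Lemma dpsB f g : dps f -> dps g -> dps (fun z => f z - g z).
Proof. by move=> pf pg; exact: (dpsD pf (dpsN pg)). Qed.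

Lemma dpsX f n : dps f -> dps (fun z => f z ^+ n).
Proof.
move=> pf; elim: n => [|n IH]; first exact: (dps_cst 1).
by apply: (dps_ext (dpsM pf IH)) => z _; rewrite exprS.
Qed.

Lemma dps_sum (J : Type) (s : seq J) (P : pred J) (F : J -> C -> C) :
  (forall j, P j -> dps (F j)) -> dps (fun z => \sum_(j <- s | P j) F j z).
Proof.
move=> pF; elim: s => [|j s IH].
  by apply: (dps_ext (dps_cst 0)) => z _; rewrite big_nil.
case Pj: (P j); last by apply: (dps_ext IH) => z _; rewrite big_cons Pj.
by apply: (dps_ext (dpsD (pF j Pj) IH)) => z _; rewrite big_cons Pj.
Qed.

Lemma dps_prod (J : Type) (s : seq J) (P : pred J) (F : J -> C -> C) :
  (forall j, P j -> dps (F j)) -> dps (fun z => \prod_(j <- s | P j) F j z).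
Proof.
move=> pF; elim: s => [|j s IH].
  by apply: (dps_ext (dps_cst 1)) => z _; rewrite big_nil.
case Pj: (P j); last by apply: (dps_ext IH) => z _; rewrite big_cons Pj.
by apply: (dps_ext (dpsM (pF j Pj) IH)) => z _; rewrite big_cons Pj.
Qed.

Lemma dps_derive1 f : dps f -> dps (derive1 f).
Proof. by move=> pf; exact: (dpsI (ps_derive1 pf)). Qed.

Lemma dps_derive1n f n : dps f -> dps (derive1n n f).
Proof. by move=> pf; exact: (dpsI (ps_derive1n (n := n) pf)). Qed.

Lemma dps_derive1_ext f g z : dps f -> (forall z, in_disk z -> f z = g z) ->
  in_disk z -> derive1 f z = derive1 g z.
Proof.
move=> pf fg z1; have pg := dps_ext pf fg.
apply: (ps_unique_val (ps_derive1 pf) _ z1); apply: (ps_coef_ext (ps_derive1 pg)) => k.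
by rewrite /dcoef (dps_coef_ext _ pf fg).
Qed.

Lemma dps_derive1n_ext f g n z : dps f -> (forall z, in_disk z -> f z = g z) ->
  in_disk z -> derive1n n f z = derive1n n g z.
Proof.
move=> pf fg; elim: n z => [|n IH] z z1; first exact: fg.
rewrite !derive1nS; exact: (dps_derive1_ext (dps_derive1n (n := n) pf) IH z1).
Qed.

Lemma ps_mulX rho f c : ps rho f c ->
  ps rho (fun z => z * f z) (fun k => if k is k'.+1 then c k' else 0).
Proof.
move=> pf z zr; rewrite -(cvg_shiftn 1).
rewrite (_ : (fun n => _) = cst z \* series (fun k => c k * z ^+ k)).
  by apply: cvgM (pf z zr); exact: cvg_cst.
apply/funext => n; rewrite /= addn1 !series_ordE big_ord_recl mul0r add0r mulr_sumr.
by apply: eq_bigr => k _ /=; rewrite exprS mulrCA.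
Qed.

Lemma ps_mul_lin rho f c a b : ps rho f c ->
  ps rho (fun z => (a + b * z) * f z)
    (fun k => a * c k + b * (if k is k'.+1 then c k' else 0)).
Proof.
move=> pf; apply: (ps_ext (ps_add (ps_scale a pf) (ps_scale b (ps_mulX pf)))) => z _.
by rewrite mulrDl mulrA.
Qed.

End DiskFunctions.

Arguments ps_mul_lin {R rho f c} a b.
Arguments dpsX {R f} n.

Section SzegoKernel.
Variable R : realType.
Local Notation C := (Cplx R).
Implicit Types (e K : R) (a b z : C).

Lemma denom_neq0 a z : in_disk a -> in_disk z -> 1 - a^*%C * z != 0.
Proof.
move=> a1 z1; rewrite -normc_gt0; apply: lt_le_trans (le_normcB _ _).
rewrite normc1 normcM normc_conj subr_gt0.
by apply: le_lt_trans z1; rewrite ler_piMl ?normc_ge0 // ltW.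
Qed.

Definition szego a z : C := (1 - a^*%C * z)^-1.

Lemma ps_szego a : in_disk a -> ps 1 (szego a) (fun k => a^*%C ^+ k).
Proof.
move=> a1 z z1.
have dn := denom_neq0 a1 z1.
have q1 : normc a * normc z < 1.
  by apply: le_lt_trans z1; rewrite ler_piMl ?normc_ge0 // ltW.
have q0 : 0 <= normc a * normc z by rewrite mulr_ge0 ?normc_ge0.
pose K0 := (normc (1 - a^*%C * z))^-1.
have /cvgrPdist_lt H : (fun n => K0 * (normc a * normc z) ^+ n) @ \oo --> (0 : R).
  by apply: (cvg_geometric K0); rewrite ger0_norm.
apply/cvgcP => e e0; apply: filterS (H e e0) => n.
rewrite sub0r normrN => /(le_lt_trans (ler_norm _)); apply: le_lt_trans.
rewrite series_ordE.
have -> : \sum_(k < n) a^*%C ^+ k * z ^+ k - szego a z = - (szego a z * (a^*%C * z) ^+ n).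
  apply: (mulfI dn); rewrite mulrBr mulrN mulrA /szego divff // mul1r.
  under eq_bigr do rewrite -exprMn.
  have := subrX1 (a^*%C * z) n => E.
  have -> : (1 - a^*%C * z) * (\sum_(i < n) (a^*%C * z) ^+ i) = 1 - (a^*%C * z) ^+ n.
    by rewrite -opprB mulNr -E opprB.
  by rewrite addrAC subrr add0r.
by rewrite normcN normcM normcV normcX normcM normc_conj.
Qed.

Lemma dps_szego a : in_disk a -> dps (szego a).
Proof. by move=> a1; exact: (dpsI (ps_szego a1)). Qed.

Lemma dps_lin a b : dps (fun z => a + b * z).
Proof. exact: (dpsD (dps_cst a) (dpsM (dps_cst b) (@dps_id R))). Qed.

Lemma dps_sub a : dps (fun z => z - a).
Proof. exact: (dpsB (@dps_id R) (dps_cst a)). Qed.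

End SzegoKernel.

Arguments dps_lin {R} a b.
Arguments dps_sub {R} a.

Section Radii.
Variable R : realType.

Definition rad n : R := 1 - n.+2%:R^-1.

Lemma rad_lt1 n : rad n < 1.
Proof. by rewrite gtrBl invr_gt0 ltr0n. Qed.

Lemma rad_gt0 n : 0 < rad n.
Proof. by rewrite subr_gt0 invf_lt1 ?ltr0n // ltr1n. Qed.

Lemma cvg_rad : rad n @[n --> \oo] --> (1 : R).
Proof.
apply/cvgrPdist_lt => e e0; have /cvgrPdist_lt/(_ e e0) := @cvg_harmonic R.
apply: filterS => n; rewrite sub0r normrN /rad opprB addrC subrK.
rewrite !ger0_norm ?invr_ge0 //; apply: le_lt_trans.
by rewrite /harmonic lef_pV2 ?posrE ?ltr0n // ler_nat.
Qed.

Lemma cvg_sum_rad (p : nat -> R) N :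
  \sum_(k < N) p k * rad m ^+ (2 * k) @[m --> \oo] --> \sum_(k < N) p k.
Proof.
elim: N => [|N IH]; first by rewrite big_ord0; under eq_fun do rewrite big_ord0; exact: cvg_cst.
rewrite big_ord_recr /=; under eq_fun do rewrite big_ord_recr /=.
apply: cvgD IH _; rewrite -[X in _ --> X]mulr1 -[X in _ * X](expr1n _ (2 * N)).
apply: cvgM; first exact: cvg_cst.
exact: (cvg_comp _ _ cvg_rad (@exprn_continuous _ (2 * N) _)).
Qed.

End Radii.

Section HardyNorm.
Variable R : realType.
Local Notation C := (Cplx R).
Implicit Types (t r s A B e K : R) (a z : C) (c d : nat -> C) (f g h u v : C -> C).

(** The squared norm of the Hardy space H^2, possibly infinite. It is defined by
    coefficients, without reference to boundary values, so that its invariance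
    under Blaschke factors is an identity between coefficients. *)
Definition h2 f : \bar R := (\sum_(0 <= k <oo) (normc (taylor_coef f k) ^+ 2)%:E)%E.

Lemma sqr_ge0_EFin (x : R) : (0 <= (x ^+ 2)%:E)%E.
Proof. by rewrite lee_fin sqr_ge0. Qed.

Lemma partial_ereal (p : nat -> R) n :
  (\sum_(0 <= k < n) (p k)%:E = (\sum_(k < n) p k)%:E)%E.
Proof. by rewrite sumEFin big_mkord. Qed.

Lemma nneseries_leP (p : nat -> R) K : (forall k, 0 <= p k) ->
  (\sum_(0 <= k <oo) (p k)%:E <= K%:E)%E <-> forall n, \sum_(k < n) p k <= K.
Proof.
move=> p0; split => [H n|H].
  rewrite -lee_fin -partial_ereal; apply: le_trans H.
  by apply: nneseries_lim_ge => k _ _; rewrite lee_fin.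
apply: lime_le; first by apply: is_cvg_nneseries => k _ _; rewrite lee_fin.
by near=> n; rewrite partial_ereal lee_fin.
Unshelve. all: by end_near. Qed.

Lemma h2_leP f K : (h2 f <= K%:E)%E <-> forall n, \sum_(k < n) normc (taylor_coef f k) ^+ 2 <= K.
Proof. by apply: nneseries_leP => k; exact: sqr_ge0. Qed.

Lemma h2_ge0 f : (0 <= h2 f)%E.
Proof. by apply: nneseries_ge0 => k _ _; exact: sqr_ge0_EFin. Qed.

Lemma h2_ext f g : dps f -> (forall z, in_disk z -> f z = g z) -> h2 f = h2 g.
Proof. by move=> pf fg; apply: eq_eseriesr => k _; rewrite (dps_coef_ext k pf fg). Qed.

Lemma h2_le_bounds f g : (forall K, (h2 g <= K%:E)%E -> (h2 f <= K%:E)%E) -> (h2 f <= h2 g)%E.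
Proof.
move=> H; have := h2_ge0 g; case E: (h2 g) => [K| |] // _; last exact: leey.
by apply: H; rewrite E.
Qed.

Lemma h2_scale f a : dps f -> normc a = 1 -> h2 (fun z => a * f z) = h2 f.
Proof.
move=> pf a1; apply: eq_eseriesr => k _.
by rewrite (dps_coef k (ps_scale a pf)) normcM a1 mul1r.
Qed.

(** Parseval on the circles of radius less than 1, which then tends to 1. *)
Lemma h2_bounded f K : dps f -> 0 <= K -> (forall z, in_disk z -> normc (f z) <= K) ->
  (h2 f <= (K ^+ 2)%:E)%E.
Proof.
move=> pf K0 fK; apply/h2_leP => n.
have B r : 0 <= r -> r < 1 ->
    \sum_(k < n) normc (taylor_coef f k) ^+ 2 * r ^+ (2 * k) <= K ^+ 2.
  move=> r0 r1; apply: le_trans (parseval_le n pf r0 r1) _.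
  rewrite -(cmean_cst (K ^+ 2)); apply: cmean_le.
  - exact: continuous_circle_sq pf r0 r1.
  - by move=> t; exact: cvg_cst.
  - move=> t; rewrite ler_sqr ?nnegrE ?normc_ge0 //; apply: fK.
    by rewrite /in_disk normc_rcircle.
have cs := @cvg_sum_rad R (fun k => normc (taylor_coef f k) ^+ 2) n.
rewrite -(cvg_lim _ cs) //; apply: limr_le; first exact: (cvgP _ cs).
by near=> m; apply: B; [exact: ltW (rad_gt0 _ m)|exact: rad_lt1].
Unshelve. all: by end_near. Qed.

Lemma cauchy_schwarz_sum (x y : nat -> R) n :
  (\sum_(k < n) x k * y k) ^+ 2 <= (\sum_(k < n) x k ^+ 2) * (\sum_(k < n) y k ^+ 2).
Proof.
elim: n => [|n IH]; first by rewrite !big_ord0 expr0n mul0r.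
rewrite !big_ord_recr /=; move: IH.
set S := \sum_(k < n) _ * _; set X := \sum_(k < n) x _ ^+ 2; set Y := \sum_(k < n) y _ ^+ 2.
have X0 : 0 <= X by apply: sumr_ge0 => k _; exact: sqr_ge0.
have Y0 : 0 <= Y by apply: sumr_ge0 => k _; exact: sqr_ge0.
move=> IH; set p := x n; set q := y n.
suff : 2 * (S * (p * q)) <= X * q ^+ 2 + Y * p ^+ 2 by nra.
set u := 2 * _; set v := _ + _.
have v0 : 0 <= v by rewrite addr_ge0 // mulr_ge0 // sqr_ge0.
have uv : u ^+ 2 <= v ^+ 2.
  have h1 : S ^+ 2 * (p * q) ^+ 2 <= X * Y * (p * q) ^+ 2 by rewrite ler_wpM2r // sqr_ge0.
  have h2 : 0 <= (X * q ^+ 2 - Y * p ^+ 2) ^+ 2 by exact: sqr_ge0.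
  rewrite /u /v; nra.
by apply: le_trans (ler_norm _) _; rewrite -(ger0_norm v0) -ler_sqr ?nnegrE // !real_normK ?num_real.
Qed.

(** Cauchy-Schwarz: the right-hand side is the product of [K] and of the squared
    norm of the Szego kernel at [z]. *)
Lemma h2_pointwise f K z : dps f -> (h2 f <= K%:E)%E -> in_disk z ->
  normc (f z) ^+ 2 <= K / (1 - normc z ^+ 2).
Proof.
move=> pf /h2_leP fK z1.
have K0 : 0 <= K by have := fK 0%N; rewrite big_ord0.
have z0 := normc_ge0 z.
have d0 : 0 < 1 - normc z ^+ 2.
  by rewrite subr_gt0 -[X in _ < X](expr1n _ 2) ltr_pXn2r ?nnegrE.
have B0 : 0 <= K / (1 - normc z ^+ 2) by rewrite divr_ge0 // ltW.
rewrite -(sqr_sqrtr B0) ler_sqr ?nnegrE ?normc_ge0 ?sqrtr_ge0 //.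
apply: (normc_lim_le (pf z z1)); near=> n; rewrite series_ordE.
apply: le_trans (normc_sum _ _ _) _.
rewrite -ler_sqr ?nnegrE ?sqrtr_ge0 ?sumr_ge0 // => [|k _]; last exact: normc_ge0.
rewrite sqr_sqrtr //; under eq_bigr do rewrite normcM normcX.
apply: le_trans (cauchy_schwarz_sum (fun k => normc (taylor_coef f k)) (fun k => normc z ^+ k) n) _.
apply: ler_pM; [by apply: sumr_ge0 => k _; exact: sqr_ge0|by apply: sumr_ge0 => k _; exact: sqr_ge0|exact: fK|].
under eq_bigr do rewrite exprAC.
by apply: geo_sum_le; [exact: sqr_ge0|rewrite -subr_gt0].
Unshelve. all: by end_near. Qed.

Lemma moebius_sqr (a x y : C) :
  normc (x - a^*%C * y) ^+ 2 - normc (a * x - y) ^+ 2 =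
  (1 - normc a ^+ 2) * (normc x ^+ 2 - normc y ^+ 2).
Proof. by case: a x y => [a1 a2] [x1 x2] [y1 y2]; rewrite !normc_sqr /=; ring. Qed.

(** Multiplication by a Moebius factor telescopes: the partial sums of the two
    norms differ by a multiple of one coefficient of [f / (1 - conj a z)]. *)
Lemma moebius_partial f a n : dps f -> in_disk a ->
  \sum_(k < n.+1) normc (taylor_coef f k) ^+ 2 =
  \sum_(k < n.+1) normc (taylor_coef (fun z => (a - z) * szego a z * f z) k) ^+ 2 +
  (1 - normc a ^+ 2) * normc (taylor_coef (fun z => szego a z * f z) n) ^+ 2.
Proof.
move=> pf a1; pose h z := szego a z * f z.
have ph : dps h by exact: (dpsM (dps_szego a1) pf).
pose c := taylor_coef h; pose c' k := if k is k'.+1 then c k' else 0.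
have fE k : taylor_coef f k = c k - a^*%C * c' k.
  have p := ps_mul_lin 1 (- a^*%C) ph.
  rewrite -(dps_coef_ext k (dpsI p)) ?(dps_coef k p) ?mul1r ?mulNr //.
  move=> z z1; rewrite /h /szego mulrA mulNr divff ?mul1r //.
  exact: denom_neq0.
have FE k : taylor_coef (fun z => (a - z) * szego a z * f z) k = a * c k - c' k.
  have p := ps_mul_lin a (-1) ph.
  rewrite -(dps_coef_ext k (dpsI p)) ?(dps_coef k p) ?mulN1r //.
  by move=> z z1; rewrite mulN1r mulrA.
rewrite -/h -/c addrC; apply/eqP; rewrite -subr_eq -sumrB; apply/eqP.
under eq_bigr do rewrite fE FE moebius_sqr.
rewrite -mulr_sumr; congr (_ * _).
elim: n => [|n IH].
  rewrite big_ord_recl big_ord0 addr0 (_ : c' (nat_of_ord ord0) = 0) //.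
  by rewrite normc0 expr0n subr0.
by rewrite big_ord_recr IH [LHS]addrC (_ : c' (nat_of_ord ord_max) = c n) // subrK.
Qed.

(** The coefficients of [h] recur backwards, [h_k = a h_(k+1) - F_(k+1)], with
    [|a| < 1]: they inherit the smallness of those of [F = (a - z) h]. *)
Lemma moebius_coef_small h a e N : dps h -> in_disk a ->
  (forall k, (N <= k)%N -> normc (taylor_coef (fun z => (a - z) * h z) k) <= e) ->
  normc (taylor_coef h N) <= e / (1 - normc a).
Proof.
move=> ph a1 small; have a0 := normc_ge0 a.
have d0 : 0 < 1 - normc a by rewrite subr_gt0.
pose c := taylor_coef h.
have e0 : 0 <= e by exact: le_trans (normc_ge0 _) (small N (leqnn N)).
have step k : (N <= k)%N -> normc (c k) <= normc a * normc (c k.+1) + e.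
  move=> Nk; have p := ps_mul_lin a (-1) ph.
  have E : taylor_coef (fun z => (a - z) * h z) k.+1 = a * c k.+1 - c k.
    rewrite -(dps_coef_ext k.+1 (dpsI p)) ?(dps_coef k.+1 p) ?mulN1r //.
    by move=> z _; rewrite mulN1r.
  have := small k.+1 (leqW Nk); rewrite E normcB => h1.
  have := le_normcB (c k) (a * c k.+1); rewrite [normc (a * _)]normcM; lra.
have iter m : normc (c N) <= normc a ^+ m * normc (c (N + m)%N) + e / (1 - normc a).
  have H : normc (c N) <= normc a ^+ m * normc (c (N + m)%N) + e * \sum_(i < m) normc a ^+ i.
    elim: m => [|m IH]; first by rewrite big_ord0 mulr0 addr0 mul1r addn0.
    apply: le_trans IH _; rewrite big_ord_recr /= mulrDr addrA [leRHS]addrAC.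
    rewrite lerD2r.
    have := step (N + m)%N (leq_addr _ _) => /(ler_wpM2l (exprn_ge0 m a0)).
    by rewrite addnS exprSr; lra.
  apply: le_trans H _; rewrite lerD2l ler_wpM2l //.
  exact: geo_sum_le.
have [s [A [as_ s1 s0 cA]]] := ps_coef_bound_gt ph a0 a1.
apply/ler_addgt0Pl => x x0.
pose q := normc a / s.
have q0 : 0 <= q by rewrite divr_ge0 // ltW.
have q1 : q < 1 by rewrite ltr_pdivrMr // mul1r.
pose K0 := A / s ^+ N.
have /cvgrPdist_lt/(_ x x0) [m _ H] : (fun n => K0 * q ^+ n) @ \oo --> (0 : R).
  by apply: (cvg_geometric K0); rewrite ger0_norm.
apply: le_trans (iter m) _; rewrite lerD2r.
have := H m (leqnn m); rewrite /= sub0r normrN => /(le_lt_trans (ler_norm _))/ltW; apply: le_trans.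
rewrite /K0 /q (expr_div_n (normc a) s m) [leLHS]mulrC; have := cA (N + m)%N.
rewrite exprD mulrA => h1.
have sN : 0 < s ^+ N by exact: exprn_gt0.
have sm : 0 < s ^+ m by exact: exprn_gt0.
have h2' : normc (c (N + m)%N) <= A / s ^+ N / s ^+ m.
  by rewrite !ler_pdivlMr // mulrAC.
have := ler_wpM2r (exprn_ge0 m a0) h2'; move/le_trans; apply.
by rewrite le_eqVlt; apply/orP; left; apply/eqP; rewrite [RHS]mulrA [LHS]mulrAC.
Qed.

Lemma h2_tail f e : (h2 f < +oo)%E -> 0 < e ->
  exists N, forall k, (N <= k)%N -> normc (taylor_coef f k) <= e.
Proof.
move=> fin e0.
have cv : cvgn (series (fun k => normc (taylor_coef f k) ^+ 2)).
  apply: nondecreasing_is_cvgn.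
    apply: homo_leq => [|x y z|m]; [exact: lexx|exact: le_trans|].
    by rewrite !seriesEnat /= big_nat_recr //= lerDl sqr_ge0.
  have := h2_ge0 f; move: fin; case E: (h2 f) => [K| |] // _ _.
  exists K => _ [n _ <-]; rewrite seriesEnat /= big_mkord.
  by apply: (h2_leP f K).1; rewrite E.
have /cvg_series_cvg_0/cvgrPdist_lt/(_ _ (exprn_gt0 2 e0)) [N _ H] := cv.
exists N => k Nk; have := H k Nk; rewrite /= sub0r normrN ger0_norm ?sqr_ge0 //.
by rewrite ltr_sqr ?nnegrE ?normc_ge0 ?(ltW e0) // => /ltW.
Qed.

(** The correction in [moebius_partial] is the square of a coefficient that tends
    to 0 as soon as one of the two norms is finite. The inequality from right to
    left is what allows zeros to be divided out without leaving H^2. *)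
Lemma h2_moebius f a : dps f -> in_disk a ->
  h2 (fun z => (a - z) * szego a z * f z) = h2 f.
Proof.
move=> pf a1.
have a2 : 0 < 1 - normc a ^+ 2.
  by rewrite subr_gt0 -[X in _ < X](expr1n _ 2) ltr_pXn2r ?nnegrE ?normc_ge0.
have d0 : 0 < 1 - normc a by rewrite subr_gt0.
apply/eqP; rewrite eq_le; apply/andP; split; apply: h2_le_bounds => K.
  move=> /h2_leP H; apply/h2_leP => -[|n].
    by apply: le_trans (H 0%N); rewrite !big_ord0.
  apply: le_trans (H n.+1); rewrite (moebius_partial n pf a1).
  by rewrite lerDl mulr_ge0 ?sqr_ge0 // ltW.
move=> FK; have fin : (h2 (fun z => ((a - z) * szego a z * f z)%R) < +oo)%E.
  by apply: le_lt_trans FK (ltry _).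
have /h2_leP HK := FK; apply/h2_leP => n.
apply/ler_addgt0Pr => e e0.
pose e1 := Num.sqrt e * (1 - normc a).
have e10 : 0 < e1 by rewrite mulr_gt0 // sqrtr_gt0.
have [N HN] := h2_tail fin e10.
pose m := maxn n N.
apply: (@le_trans _ _ (\sum_(k < m.+1) normc (taylor_coef f k) ^+ 2)).
  have nm : (n <= m.+1)%N by rewrite leqW // leq_maxl.
  rewrite -(subnKC nm) big_split_ord /= lerDl sumr_ge0 // => k _; exact: sqr_ge0.
rewrite (moebius_partial m pf a1); apply: lerD; first exact: HK.
have ph := dpsM (dps_szego a1) pf.
have : normc (taylor_coef (fun z => szego a z * f z) m) <= e1 / (1 - normc a).
  apply: moebius_coef_small => // k mk.
  have -> : (fun z => (a - z) * (szego a z * f z)) = (fun z => (a - z) * szego a z * f z).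
    by apply/funext => z; rewrite mulrA.
  by apply: HN; apply: leq_trans mk; exact: leq_maxr.
rewrite /e1 mulfK ?gt_eqF // => h.
have : normc (taylor_coef (fun z => szego a z * f z) m) ^+ 2 <= e.
  by rewrite -(sqr_sqrtr (ltW e0)) ler_sqr ?nnegrE ?normc_ge0 ?sqrtr_ge0.
have := sqr_ge0 (normc a); have := sqr_ge0 (normc (taylor_coef (fun z => szego a z * f z) m)).
nra.
Qed.

End HardyNorm.

(** * Blaschke factors and divisibility *)

Lemma blaschke_factor_sub1 (F : fieldType) (a b z N : F) : N != 0 -> 1 - b * z != 0 ->
  b * a = N ^+ 2 ->
  b / N * ((a - z) / (1 - b * z)) - 1 = - ((1 - N) * ((1 + b / N * z) / (1 - b * z))).
Proof.
move=> nC dn aa; have b0 : b != 0.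
  apply/eqP => b0; move: aa; rewrite b0 mul0r => /esym/eqP.
  by rewrite expf_eq0 (negPf nC) andbF.
have -> : a = N ^+ 2 / b by rewrite -aa mulrAC divff // mul1r.
by field; rewrite b0 nC dn.
Qed.

Section BlaschkeFactor.
Variable R : realType.
Local Notation C := (Cplx R).
Implicit Types (r : R) (a z : C) (m : C -> nat) (f h u : C -> C).

(** The two cases of the definition of a Blaschke factor are the same Moebius
    factor up to a unimodular constant. *)
Lemma blaschke_factorE a : exists2 u : C, normc u = 1 &
  forall z, blaschke_factor a z = u * ((a - z) * szego a z).
Proof.
rewrite /blaschke_factor; have [->|a0] := eqVneq a 0.
  exists (-1); first by rewrite normcN normc1.
  by move=> z; rewrite /szego rmorph0 mul0r subr0 invr1 mulr1 sub0r mulN1r opprK.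
exists (a^*%C / `|a|) => //.
rewrite normcM normcV normcE_norm normc_real ger0_norm ?normc_ge0 // normc_conj divff //.
by rewrite normc_eq0.
Qed.

Lemma dps_moebius a : in_disk a -> dps (fun z => (a - z) * szego a z).
Proof.
by move=> a1; apply: (dpsM _ (dps_szego a1)); apply: (dpsB (dps_cst a) (@dps_id R)).
Qed.

Lemma dps_blaschke_factor a : in_disk a -> dps (blaschke_factor a).
Proof.
move=> a1; have [u _ E] := blaschke_factorE a.
apply: (dps_ext (dpsM (dps_cst u) (dps_moebius a1))) => z _.
by rewrite E.
Qed.

Lemma h2_blaschke_factor a f : in_disk a -> dps f ->
  h2 (fun z => blaschke_factor a z * f z) = h2 f.
Proof.
move=> a1 pf; have [u u1 E] := blaschke_factorE a.
rewrite -(h2_moebius pf a1).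
have pm := dpsM (dps_moebius a1) pf.
rewrite -(h2_scale pm u1); apply: h2_ext; first exact: (dpsM (dps_blaschke_factor a1) pf).
by move=> z _; rewrite E !mulrA.
Qed.

Lemma one_sub_blaschke_factor_sqr a z : in_disk a -> in_disk z ->
  1 - normc (blaschke_factor a z) ^+ 2 =
  (1 - normc a ^+ 2) * (1 - normc z ^+ 2) * normc (szego a z) ^+ 2.
Proof.
move=> a1 z1; have [u u1 ->] := blaschke_factorE a.
have dn := denom_neq0 a1 z1.
have sn : normc (1 - a^*%C * z) != 0 by rewrite normc_eq0.
have := moebius_sqr a 1 z; rewrite mulr1 normc1 expr1n => <-.
set x := normc (a - z); rewrite !normcM u1 mul1r /szego normcV -/x.
move: sn; set y := normc _ => sn; by field.
Qed.

Lemma sqr_lt1 r : 0 <= r -> r < 1 -> 0 < 1 - r ^+ 2.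
Proof. by move=> r0 r1; rewrite subr_gt0 -[X in _ < X](expr1n _ 2) ltr_pXn2r ?nnegrE. Qed.

Lemma blaschke_factor_le1 a z : in_disk a -> in_disk z -> normc (blaschke_factor a z) <= 1.
Proof.
move=> a1 z1; rewrite -ler_sqr ?nnegrE ?normc_ge0 // expr1n -subr_ge0.
have h1 := sqr_lt1 (normc_ge0 a) a1; have h2 := sqr_lt1 (normc_ge0 z) z1.
by rewrite one_sub_blaschke_factor_sqr //; apply: mulr_ge0 (sqr_ge0 _); apply: mulr_ge0; exact: ltW.
Qed.

Lemma szego_neq0 a z : in_disk a -> in_disk z -> szego a z != 0.
Proof. by move=> a1 z1; rewrite invr_eq0 denom_neq0. Qed.

Lemma blaschke_factor_eq0 a z : in_disk a -> in_disk z ->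
  (blaschke_factor a z == 0) = (z == a).
Proof.
move=> a1 z1; have [u u1 ->] := blaschke_factorE a.
have u0 : u != 0 by rewrite -normc_eq0 u1 oner_neq0.
by rewrite !mulf_eq0 (negPf u0) (negPf (szego_neq0 a1 z1)) orbF subr_eq0 eq_sym.
Qed.

(** The normalisation [conj a / |a|] makes the factors of zeros near the circle
    close to 1: this is why Blaschke products converge. *)
Lemma blaschke_factor_near1 a z r : in_disk a -> normc z <= r -> r < 1 ->
  normc (blaschke_factor a z - 1) <= (1 - normc a) * ((1 + r) / (1 - r)).
Proof.
move=> a1 zr r1; have z1 : in_disk z by exact: le_lt_trans r1.
have r0 : 0 <= r by exact: le_trans (normc_ge0 z) zr.
have r1' : 0 < 1 - r by rewrite subr_gt0.
have q1 : 1 <= (1 + r) / (1 - r) by rewrite ler_pdivlMr //; lra.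
rewrite /blaschke_factor; have [->|a0] := eqVneq a 0.
  rewrite normc0 subr0 mul1r; apply: le_trans (le_normcD _ _) _.
  rewrite normcN normc1 addrC; apply: (@le_trans _ _ (1 + r)); first by rewrite lerD2l.
  by rewrite ler_pdivlMr //; nra.
have na0 : normc a != 0 by rewrite normc_eq0.
have dn := denom_neq0 a1 z1.
have nC : (normc a)%:C != 0 :> C by rewrite -normc_eq0 normc_real normr_eq0.
have aa : a^*%C * a = (normc a)%:C ^+ 2 by rewrite mulrC -sqr_normc normcE_norm.
have -> : a^*%C / `|a| * ((a - z) / (1 - a^*%C * z)) - 1 =
   - ((1 - normc a)%:C * ((1 + a^*%C / (normc a)%:C * z) / (1 - a^*%C * z))).
  rewrite normcE_norm rmorphB rmorph1; apply: blaschke_factor_sub1 => //.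
rewrite normcN normcM normc_real ger0_norm ?subr_ge0 ?(ltW a1) //.
apply: ler_wpM2l; first by rewrite subr_ge0 ltW.
rewrite normcM normcV; apply: ler_pM; rewrite ?normc_ge0 ?invr_ge0 ?normc_ge0 //.
  apply: le_trans (le_normcD _ _) _; rewrite normc1 lerD2l !normcM normcV normc_conj.
  by rewrite normc_real ger0_norm ?normc_ge0 // divff // mul1r.
have d1 : 1 - r <= normc (1 - a^*%C * z).
  apply: le_trans (le_normcB _ _); rewrite normc1 lerD2l lerN2 normcM normc_conj.
  apply: le_trans zr; rewrite ler_piMl ?normc_ge0 //; exact: ltW.
by rewrite lef_pV2 ?posrE //; apply: lt_le_trans d1.
Qed.

(** Indexed by a sequence rather than by a finite set, to allow inductions. *)
Definition bprod (S : seq C) m z := \prod_(a <- S | in_disk a) blaschke_factor a z ^+ m a.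

Lemma dps_bprod S m : dps (bprod S m).
Proof. by apply: dps_prod => a a1; apply: dpsX; exact: dps_blaschke_factor. Qed.

Lemma h2_blaschkeX a n f : in_disk a -> dps f ->
  h2 (fun z => blaschke_factor a z ^+ n * f z) = h2 f.
Proof.
move=> a1 pf; elim: n => [|n IH].
  by apply: esym; apply: h2_ext => // z _; rewrite mul1r.
have pn := dpsM (dpsX n (dps_blaschke_factor a1)) pf.
rewrite -IH -(h2_blaschke_factor a1 pn); apply: h2_ext.
  exact: (dpsM (dpsX n.+1 (dps_blaschke_factor a1)) pf).
by move=> z _; rewrite exprS mulrA.
Qed.

Lemma bprod_cons a S m z : bprod (a :: S) m z =
  if in_disk a then blaschke_factor a z ^+ m a * bprod S m z else bprod S m z.
Proof. by rewrite /bprod big_cons. Qed.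

Lemma h2_bprod S m f : dps f -> h2 (fun z => bprod S m z * f z) = h2 f.
Proof.
move=> pf; elim: S => [|a S IH].
  by apply: esym; apply: h2_ext => // z _; rewrite /bprod big_nil mul1r.
have pS := dpsM (@dps_bprod S m) pf.
case a1: (in_disk a).
  rewrite -IH -(h2_blaschkeX (m a) a1 pS); apply: h2_ext.
    exact: (dpsM (@dps_bprod (a :: S) m) pf).
  by move=> z _; rewrite bprod_cons a1 mulrA.
rewrite -IH; apply: h2_ext; first exact: (dpsM (@dps_bprod (a :: S) m) pf).
by move=> z _; rewrite bprod_cons a1.
Qed.

Lemma bprod_le1 S m z : in_disk z -> normc (bprod S m z) <= 1.
Proof.
move=> z1; elim: S => [|a S IH]; first by rewrite /bprod big_nil normc1.
rewrite bprod_cons; case: ifP => // a1; rewrite normcM -[1]mulr1.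
apply: ler_pM; rewrite ?normc_ge0 // normcX exprn_ile1 ?normc_ge0 //.
exact: blaschke_factor_le1.
Qed.

Lemma bprod_neq0 S m z : in_disk z -> (z \in S -> m z = 0%N) -> bprod S m z != 0.
Proof.
move=> z1; elim: S => [|a S IH] H; first by rewrite /bprod big_nil oner_neq0.
rewrite bprod_cons; have HS : bprod S m z != 0.
  by apply: IH => h; apply: H; rewrite inE h orbT.
case: ifP => // a1; rewrite mulf_neq0 // expf_eq0 blaschke_factor_eq0 //.
case: eqVneq => [E|//]; last by rewrite andbF.
by rewrite -E H ?inE ?E ?eqxx.
Qed.

End BlaschkeFactor.

Arguments dps_bprod {R} S m.

Section ZeroMultiplicity.
Variable R : realType.
Local Notation C := (Cplx R).
Implicit Types (s A e K : R) (a b z w : C) (f g h u v : C -> C).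

(** Divisibility by a power of [z - a] is used rather than the order of vanishing,
    because it is stable under sums, products and, with a loss, derivatives. *)
Definition zdvd a k f :=
  exists2 g, dps g & forall z, in_disk z -> f z = (z - a) ^+ k * g z.

Lemma zdvd0 a f : dps f -> zdvd a 0 f.
Proof. by move=> pf; exists f => // z _; rewrite mul1r. Qed.

Lemma zdvd_dps a k f : zdvd a k f -> dps f.
Proof.
move=> [g pg E]; apply: (dps_ext (dpsM (dpsX k (dps_sub a)) pg)) => z z1.
by rewrite E.
Qed.

Lemma zdvd_le a k l f : (l <= k)%N -> zdvd a k f -> zdvd a l f.
Proof.
move=> lk [g pg E]; exists (fun z => (z - a) ^+ (k - l) * g z).
  exact: (dpsM (dpsX (k - l) (dps_sub a)) pg).
by move=> z z1; rewrite E // mulrA -exprD subnKC.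
Qed.

Lemma dps_root a f : dps f -> in_disk a -> f a = 0 -> zdvd a 1 f.
Proof.
move=> pf a1 f0; exists (psum (quot (taylor_coef f) a)).
  exact: (dpsI (ps_quot pf a1)).
by move=> z z1; rewrite expr1 (ps_div pf a1 z1) f0 add0r.
Qed.

(** Comparing coefficients in [(z - b) g = 0] shows that [g = 0], also at [b]. *)
Lemma dps_cancel b u v : dps u -> dps v ->
  (forall z, in_disk z -> (z - b) * u z = (z - b) * v z) ->
  forall z, in_disk z -> u z = v z.
Proof.
move=> pu pv E z z1; apply/eqP; rewrite -subr_eq0; apply/eqP.
pose g z := u z - v z; have pg : dps g by exact: (dpsB pu pv).
have p := ps_mul_lin (- b) 1 pg.
have C0 k : - b * taylor_coef g k + 1 * (if k is k'.+1 then taylor_coef g k' else 0) = 0.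
  rewrite -(dps_coef k p) (@dps_coef_ext _ _ (fun=> 0) k (dpsI p)).
    by rewrite (dps_coef k (ps_zero 1)).
  by move=> w w1; rewrite mul1r addrC /g mulrBr E // subrr.
have g0 k : taylor_coef g k = 0.
  have [b0|b0] := eqVneq b 0.
    by have := C0 k.+1; rewrite b0 oppr0 mul0r add0r mul1r.
  elim: k => [|k IH].
    by have /eqP := C0 0%N; rewrite mulr0 addr0 mulf_eq0 oppr_eq0 (negPf b0) => /eqP.
  by have /eqP := C0 k.+1; rewrite IH mulr0 addr0 mulf_eq0 oppr_eq0 (negPf b0) => /eqP.
have h1 := ps_coef_ext pg g0.
exact: (ps_unique_val h1 (ps_zero 1) z1).
Qed.

(** A power of [z - a] is prime to a function that does not vanish at [a]. *)
Lemma zdvd_quot a k u g : in_disk a -> dps u -> dps g -> u a != 0 ->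
  zdvd a k (fun z => u z * g z) -> zdvd a k g.
Proof.
move=> a1 pu; elim: k g => [|k IH] g pg ua; first by move=> _; exact: zdvd0.
move=> [q pq E]; have /eqP := E a a1.
rewrite subrr expr0n mul0r mulf_eq0 (negPf ua) => /eqP ga.
have [g' pg' E'] := dps_root pg a1 ga.
have [] := IH g' pg' ua.
  exists q => //; apply: (@dps_cancel a); first exact: (dpsM pu pg').
    exact: (dpsM (dpsX k (dps_sub a)) pq).
  by move=> z z1; rewrite mulrCA -[X in X * g' z]expr1 -E' // E // exprS mulrA.
move=> g2 pg2 E2; exists g2 => // z z1.
by rewrite E' // E2 // expr1 exprS mulrA.
Qed.

Lemma zdvd_sum (J : Type) (s : seq J) (F : J -> C -> C) a k :
  (forall j, zdvd a k (F j)) -> zdvd a k (fun z => \sum_(j <- s) F j z).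
Proof.
move=> H; elim: s => [|j s [g pg E]].
  by exists (fun=> 0); [exact: (dps_cst 0)|move=> z _; rewrite big_nil mulr0].
have [g' pg' E'] := H j; exists (fun z => g' z + g z); first exact: (dpsD pg' pg).
by move=> z z1; rewrite big_cons E' // E // mulrDr.
Qed.

Lemma zdvd_mulr a k f g : zdvd a k f -> dps g -> zdvd a k (fun z => f z * g z).
Proof.
move=> [q pq E] pg; exists (fun z => q z * g z); first exact: (dpsM pq pg).
by move=> z z1; rewrite E // mulrA.
Qed.

(** Dividing out powers of [z - a] is the same as dividing out powers of the
    Blaschke factor of [a], which differ by invertible analytic functions. *)
Lemma zdvd_blaschke a k f : in_disk a -> zdvd a k f ->
  exists2 g, dps g & forall z, in_disk z -> f z = blaschke_factor a z ^+ k * g z.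
Proof.
move=> a1 [g pg E]; have [u u1 Eb] := blaschke_factorE a.
have u0 : u != 0 by rewrite -normc_eq0 u1 oner_neq0.
exists (fun z => (- u^-1 * (1 + (- a^*%C) * z)) ^+ k * g z).
  exact: (dpsM (dpsX k (dpsM (dps_cst (- u^-1)) (dps_lin 1 (- a^*%C)))) pg).
move=> z z1; rewrite E // mulrA -exprMn; congr (_ ^+ _ * _).
rewrite Eb /szego mulNr; field.
by rewrite u0 denom_neq0.
Qed.

(** The factors at the other points do not vanish at [a], so the zeros can be
    divided out one point after the other. *)
Lemma zdvd_bprod (S : seq C) (k : C -> nat) f : uniq S -> dps f ->
  (forall a, a \in S -> in_disk a -> zdvd a (k a) f) ->
  exists2 g, dps g & forall z, in_disk z -> f z = bprod S k z * g z.
Proof.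
move=> + pf; elim: S => [|a S IH] /=.
  by move=> _ _; exists f => // z _; rewrite /bprod big_nil mul1r.
move=> /andP[aS uS] H; have [|g pg E] := IH uS.
  by move=> b bS; apply: H; rewrite inE bS orbT.
case a1: (in_disk a); last by exists g => // z z1; rewrite bprod_cons a1 E.
have pS := dps_bprod S k.
have Sa : bprod S k a != 0 by apply: bprod_neq0 => // h; rewrite h in aS.
have [|g' pg' E'] := zdvd_blaschke a1 (zdvd_quot (k := k a) a1 pS pg Sa _).
  have [q pq Eq] := H a (mem_head _ _) a1; exists q => // z z1.
  by rewrite -E // Eq.
exists g' => // z z1; rewrite bprod_cons a1 E // E' //.
by rewrite mulrCA mulrA.
Qed.

Lemma dps_derive1_mul_sub a g z : dps g -> in_disk z ->
  derive1 (fun z => (z - a) * g z) z = (z - a) * derive1 g z + g z.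
Proof.
move=> pg z1; have p := ps_mul_lin (- a) 1 pg.
have E1 : derive1 (fun z => (z - a) * g z) z = derive1 (fun z => (- a + 1 * z) * g z) z.
  apply: esym; apply: (dps_derive1_ext (dpsI p)) => // w _; by rewrite mul1r addrC.
have p2 := ps_add (ps_mul_lin (- a) 1 (ps_derive1 pg)) pg.
rewrite E1 (ps_unique_val (ps_derive1 p) (ps_coef_ext p2 _) z1); last first.
  move=> [|k]; rewrite /dcoef.
    by rewrite mulr0 addr0 !mul1r.
  by rewrite !mul1r mulrDr -[k.+2%:R]natr1; ring.
by rewrite mul1r (addrC _ z).
Qed.

Definition has_order f a k :=
  derive1n k f a != 0 /\ forall j, (j < k)%N -> derive1n j f a = 0.

Lemma has_order_zero_mult f a k : has_order f a k -> zero_mult f a = k.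
Proof.
move=> H; apply: xget_unique => //= l [l1 l2]; have [k1 k2] := H.
case: (ltngtP l k) => // h; first by move: l1; rewrite k2 ?eqxx.
by move: k1; rewrite l2 ?eqxx.
Qed.

Lemma ps_mulXn rho g d k : ps rho g d ->
  ps rho (fun z => z ^+ k * g z) (fun i => if (i < k)%N then 0 else d (i - k)%N).
Proof.
move=> pg; elim: k => [|k IH].
  by apply: (ps_ext (ps_coef_ext pg _)) => [i|z _]; rewrite ?subn0 ?mul1r.
by apply: (ps_ext (ps_coef_ext (ps_mulX IH) _)) => [[|i]|z _] //=; rewrite exprS mulrA.
Qed.

(** The derivatives of [f] at [a] are, up to factorials, the coefficients of
    [f (a + w) = w^k g (a + w)], and [g] can be expanded at [a]. *)
Lemma has_order_exp f g a k : dps g -> in_disk a -> g a != 0 ->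
  (forall z, in_disk z -> f z = (z - a) ^+ k * g z) -> has_order f a k.
Proof.
move=> pg a1 ga E.
have [s [A [as_ s1 s0 cA]]] := ps_coef_bound_gt pg (normc_ge0 a) a1.
have [d [pd _]] := ps_reexpand (ps_lt pg (ltW s1)) cA as_.
have sa : 0 < s - normc a by rewrite subr_gt0.
have pf : ps (s - normc a) (fun w => f (a + w))
    (fun i => if (i < k)%N then 0 else d (i - k)%N).
  apply: (ps_ext (ps_mulXn (k := k) pd)) => w ws.
  have aw : in_disk (a + w) by apply: le_lt_trans (le_normcD _ _) _; lra.
  by rewrite (E _ aw) (addrC a w) addrK.
have fE j : derive1n j f a = j`!%:R * (if (j < k)%N then 0 else d (j - k)%N).
  have f0 : j`!%:R != 0 :> C by rewrite pnatr_eq0 -lt0n fact_gt0.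
  have /= -> := ps_coefE j pf sa.
  by rewrite /taylor_coef derive1n_shift addr0 mulrC divfK.
split=> [|j jk]; rewrite fE; last by rewrite jk mulr0.
by rewrite ltnn subnn -(ps0 pd sa) addr0 mulf_neq0 // pnatr_eq0 -lt0n fact_gt0.
Qed.

Lemma zero_multE f g a k : dps g -> in_disk a -> g a != 0 ->
  (forall z, in_disk z -> f z = (z - a) ^+ k * g z) -> zero_mult f a = k.
Proof. by move=> pg a1 ga E; apply: has_order_zero_mult; exact: (has_order_exp pg a1 ga E). Qed.

Lemma zdvd_derive1 a k f : in_disk a -> zdvd a k.+1 f -> zdvd a k (derive1 f).
Proof.
move=> a1 [g pg E].
have pf : dps (fun z => (z - a) ^+ k.+1 * g z) by exact: (dpsM (dpsX k.+1 (dps_sub a)) pg).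
suff [h ph Eh] : zdvd a k (derive1 (fun z => (z - a) ^+ k.+1 * g z)).
  exists h => [|z z1]; first exact: ph.
  have e := dps_derive1_ext pf (fun w hw => esym (E w hw)) z1.
  by rewrite -(Eh z z1); exact: esym e.
elim: k {E pf f} => [|k [h ph Eh]].
  exact: (zdvd0 a (dps_derive1 (dpsM (dpsX 1 (dps_sub a)) pg))).
pose q z := (z - a) ^+ k.+1 * g z.
have pq : dps q by exact: (dpsM (dpsX k.+1 (dps_sub a)) pg).
have -> : (fun z => (z - a) ^+ k.+2 * g z) = (fun z => (z - a) * q z).
  by apply/funext => z; rewrite exprS mulrA.
exists (fun z => h z + g z); first exact: (dpsD ph pg).
move=> z z1; rewrite (dps_derive1_mul_sub a pq z1) (Eh z z1) /q exprS; ring.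
Qed.

Lemma zdvd_derive1n a k n f : in_disk a -> zdvd a k f -> zdvd a (k - n) (derive1n n f).
Proof.
move=> a1 H; elim: n => [|n IH]; first by rewrite subn0.
rewrite derive1nS; have [kn|nk] := leqP k n.
  have -> : (k - n.+1 = 0)%N by apply/eqP; rewrite subn_eq0 leqW.
  exact: (zdvd0 a (dps_derive1 (dps_derive1n (n := n) (zdvd_dps H)))).
by apply: zdvd_derive1 => //; rewrite -subSn.
Qed.

(** If all powers of the Blaschke factor of [a] divided [f], the quotients would all
    have the norm of [f], and [f z0] would be smaller than all powers of the value
    of that factor at [z0], up to a constant. *)
Lemma dps_order f a K z0 : dps f -> (h2 f <= K%:E)%E -> in_disk a -> in_disk z0 -> f z0 != 0 ->
  exists k g, [/\ dps g, g a != 0 & forall z, in_disk z -> f z = (z - a) ^+ k * g z].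
Proof.
move=> pf fK a1 z01 f0.
apply/not_existsP => H.
have all_dvd k : zdvd a k f.
  elim: k => [|k [g pg E]]; first exact: zdvd0.
  have ga : g a = 0.
    by apply/eqP; apply: contrapT => /negP ga; apply: (H k); exists g.
  have [h ph Eh] := dps_root pg a1 ga; exists h => // z z1.
  by rewrite E // Eh // expr1 exprSr mulrA.
have K0 : 0 <= K by have := le_trans (h2_ge0 f) fK; rewrite lee_fin.
pose q := normc (blaschke_factor a z0) ^+ 2.
have q0 : 0 <= q by exact: sqr_ge0.
have zz := sqr_lt1 (normc_ge0 z0) z01.
have q1 : q < 1.
  have h1 := sqr_lt1 (normc_ge0 a) a1.
  rewrite -subr_gt0 one_sub_blaschke_factor_sqr //; apply: mulr_gt0; first exact: mulr_gt0.
  by rewrite exprn_gt0 // normc_gt0 szego_neq0.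
have bd k : normc (f z0) ^+ 2 <= q ^+ k * (K / (1 - normc z0 ^+ 2)).
  have [g pg E] := zdvd_blaschke a1 (all_dvd k).
  have gK : (h2 g <= K%:E)%E.
    rewrite -(h2_blaschkeX k a1 pg) (_ : h2 _ = h2 f) //; apply: esym.
    by apply: (h2_ext pf).
  rewrite (E z0 z01) normcM exprMn normcX exprAC; apply: ler_wpM2l; first exact: exprn_ge0.
  exact: (h2_pointwise pg gK z01).
have : normc (f z0) ^+ 2 <= 0.
  have cv : (fun k => q ^+ k * (K / (1 - normc z0 ^+ 2))) @ \oo --> (0 : R).
    rewrite -[X in _ --> X](mul0r (K / (1 - normc z0 ^+ 2))); apply: cvgM; last exact: cvg_cst.
    by apply: cvg_expr; rewrite ger0_norm.
  rewrite -(cvg_lim _ cv) //; apply: limr_ge; first exact: (cvgP _ cv).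
  by near=> k; exact: bd.
by rewrite leNgt exprn_gt0 // normc_gt0.
Unshelve. all: by end_near. Qed.

End ZeroMultiplicity.

(** * Infinite Blaschke products *)

(* The product over finite sets converges along the filter [totally]. *)
#[local] Existing Instance totally_filter.

Section UniformLimit.
Variable R : realType.
Local Notation C := (Cplx R).
Implicit Types (r A e K : R) (z : C) (f g h : C -> C).

(** Weierstrass: a locally uniform limit of analytic functions is analytic,
    because the Cauchy estimates make the Taylor coefficients converge. *)
Lemma dps_uniform f :
  (forall r e, 0 < r -> r < 1 -> 0 < e ->
     exists2 g, dps g & forall z, normc z <= r -> normc (f z - g z) <= e) ->
  dps f.
Proof.
move=> H.
pose q := rad R.
have q1 n : q n < 1 := rad_lt1 R n.
have q0 n : 0 < q n := rad_gt0 R n.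
pose ep (n : nat) : R := n.+1%:R^-1.
have ep0 n : 0 < ep n by rewrite invr_gt0 ltr0n.
have {}H n : exists g, dps g /\ forall z, normc z <= q n -> normc (f z - g z) <= ep n.
  by have [g pg Hg] := H (q n) (ep n) (q0 n) (q1 n) (ep0 n); exists g.
have [g Hg] := choice H.
have pg n : dps (g n) := (Hg n).1.
have gE n := (Hg n).2.
pose c n k := taylor_coef (g n) k.
have cauchy n p k r : 0 <= r -> r <= q n -> r <= q p ->
    normc (c n k - c p k) * r ^+ k <= ep n + ep p.
  move=> r0 rn rp; have pd := dpsB (pg n) (pg p).
  have -> : c n k - c p k = taylor_coef (fun z => g n z - g p z) k.
    have pD := ps_add (pg n) (ps_scale (-1) (pg p)).
    rewrite -(dps_coef_ext k (dpsI pD)) ?(dps_coef k pD) ?mulN1r // => z _.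
    by rewrite mulN1r.
  have ee : 0 <= ep n + ep p by rewrite addr_ge0 // ltW.
  apply: (cauchy_estimate k pd r0 (le_lt_trans rn (q1 n)) ee) => z zr.
  have -> : g n z - g p z = (f z - g p z) - (f z - g n z) by ring.
  apply: le_trans (le_normcD _ _) _; rewrite normcN addrC.
  by apply: lerD; apply: gE; rewrite zr.
have epl e : 0 < e -> \forall n \near \oo, ep n < e.
  move=> e0; have /cvgrPdist_lt/(_ e e0) := @cvg_harmonic R; apply: filterS => n.
  by rewrite sub0r normrN ger0_norm ?(ltW (ep0 n)).
have ql r : r < 1 -> \forall n \near \oo, r <= q n.
  move=> r1; have r1' : 0 < 1 - r by rewrite subr_gt0.
  apply: filterS (epl _ r1') => n h; rewrite /q /rad lerBrDr -lerBrDl; apply: le_trans (ltW h).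
  by rewrite lef_pV2 ?posrE ?ltr0n // ler_nat.
have cvc k : cvgn (c ^~ k).
  apply: cauchy_cvgc => e e0.
  have r2 : 0 <= (2^-1 : R) by rewrite invr_ge0.
  have r21 : (2^-1 : R) < 1 by rewrite invf_lt1 // ltr1n.
  have rk : 0 < (2^-1 : R) ^+ k by rewrite exprn_gt0 // invr_gt0.
  have e2 : 0 < e * 2^-1 ^+ k / 2 by rewrite divr_gt0 // mulr_gt0.
  have Hn : \forall n \near \oo, ep n < e * 2^-1 ^+ k / 2 /\ 2^-1 <= q n.
    by near=> n; split; near: n; [exact: epl|exact: ql].
  have [N _ HN] := Hn; exists (c N k); exists N => // n /= Nn.
  have [h1 h2] := HN n Nn; have [h3 h4] := HN N (leqnn N).
  rewrite -(ltr_pM2r rk); apply: le_lt_trans (cauchy n N k _ r2 h2 h4) _.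
  by rewrite [ltRHS]splitr; apply: ltrD.
pose d k := limn (c ^~ k).
have cd n k r : 0 <= r -> r <= q n -> normc (c n k - d k) * r ^+ k <= ep n.
  move=> r0 rn; have [rk|rk] := eqVneq (r ^+ k) 0; first by rewrite rk mulr0 ltW.
  have rk0 : 0 < r ^+ k by rewrite lt_def rk exprn_ge0.
  rewrite -ler_pdivlMr //; apply/ler_addgt0Pr => e e0.
  have cv : (fun p => c n k - c p k) @ \oo --> c n k - d k.
    by apply: cvgB; [exact: cvg_cst|exact: cvc].
  apply: (normc_lim_le cv); near=> p.
  have rp : r <= q p by near: p; apply: ql; exact: le_lt_trans (q1 n).
  have ee : ep p < e * r ^+ k by near: p; apply: epl; rewrite mulr_gt0.
  rewrite -(ler_pM2r rk0); apply: le_trans (cauchy n p k _ r0 rn rp) _.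
  by rewrite mulrDl divfK // lerD2l ltW.
apply: (@dpsI _ _ d) => z z1.
pose r := (normc z + 1) / 2.
have [zr r1] : normc z < r /\ r < 1 by move: z1; rewrite /r; split; lra.
have r0 : 0 < r by exact: le_lt_trans (normc_ge0 z) zr.
have [n0 _ Hq] := ql r r1.
have cbd n : r <= q n -> coef_bound (fun k => c n k - d k) r (ep n).
  by move=> rn k; apply: cd => //; exact: ltW.
have [A cA] := ps_coef_bound (pg n0) (ltW r0) r1.
have dA : coef_bound d r (A + ep n0).
  move=> k; have -> : d k = c n0 k - (c n0 k - d k) by rewrite opprB addrC subrK.
  apply: (@le_trans _ _ ((normc (c n0 k) + normc (c n0 k - d k)) * r ^+ k)).
    apply: ler_wpM2r; first exact: exprn_ge0 (ltW r0).
    by apply: le_trans (le_normcD _ _) _; rewrite normcN.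
  by rewrite mulrDl; apply: lerD; [exact: cA|apply: cbd; exact: Hq (leqnn n0)].
have sd := coef_bound_cvg dA zr.
suff -> : f z = psum d z by exact: sd.
apply/eqP; rewrite -subr_eq0 -normc_eq0 eq_le normc_ge0 andbT.
pose K := 1 + 1 / (1 - normc z / r).
have K0 : 0 < 1 - normc z / r by rewrite subr_gt0 ltr_pdivrMr // mul1r.
have K1 : 0 < K by rewrite addr_gt0 // divr_gt0.
apply/ler_addgt0Pr => e e0; rewrite add0r.
near \oo => n.
have rn : r <= q n by near: n; exact: ql.
have en : ep n < e / K by near: n; apply: epl; rewrite divr_gt0.
have -> : f z - psum d z = (f z - g n z) + (g n z - psum d z) by rewrite addrA subrK.
apply: le_trans (le_normcD _ _) _.
have h1 : normc (f z - g n z) <= ep n by apply: gE; apply: le_trans (ltW zr) rn.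
have h2 : normc (g n z - psum d z) <= ep n / (1 - normc z / r).
  have cv : (fun m => series (fun k => c n k * z ^+ k) m - series (fun k => d k * z ^+ k) m)
     @ \oo --> g n z - psum d z by apply: cvgB; [exact: (pg n)|exact: sd].
  apply: (normc_lim_le cv); near=> m.
  rewrite !series_ordE -sumrB; apply: le_trans (normc_sum _ _ _) _.
  apply: le_trans (coef_bound_sum m (cbd n rn) (normc_ge0 z) zr).
  by apply: ler_sum => k _; rewrite -mulrBl normcM normcX.
apply: (@le_trans _ _ (ep n * K)).
  by rewrite /K mulrDr mulr1 mul1r; apply: lerD.
by rewrite -ler_pdivlMr // ltW.
Unshelve. all: by end_near. Qed.

End UniformLimit.

Section BlaschkeProduct.
Variable R : realType.
Local Notation C := (Cplx R).
Implicit Types (r s A B e K : R) (a b z : C) (m : C -> nat) (f g h u v : C -> C).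
Implicit Types (S T : {fset C}).

Definition wt m a : R := if in_disk a then (m a)%:R * (1 - normc a) else 0.

Definition mass m S : R := \sum_(a <- S) wt m a.

(** The Blaschke condition: the sum of all [m a * (1 - |a|)] is finite. *)
Definition bcond m := exists A, forall S, mass m S <= A.

(** The two parts of a multiplicity function, on and off a finite set: their
    Blaschke products are the finite part and the tail of the product of [m]. *)
Definition restr_in S m a := if a \in S then m a else 0%N.
Definition restr_out S m a := if a \in S then 0%N else m a.

Lemma wt_ge0 m a : 0 <= wt m a.
Proof. by rewrite /wt; case: ifP => // a1; rewrite mulr_ge0 // subr_ge0 ltW. Qed.

Lemma wt_le m m' a : (m a <= m' a)%N -> wt m a <= wt m' a.
Proof.
move=> mm; rewrite /wt; case: ifP => // a1.
by rewrite ler_wpM2r ?ler_nat // subr_ge0 ltW.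
Qed.

Lemma bcond_le m m' : (forall a, (m a <= m' a)%N) -> bcond m' -> bcond m.
Proof.
move=> mm [A HA]; exists A => S; apply: le_trans (HA S).
by apply: ler_sum => a _; exact: wt_le.
Qed.

Lemma bcond_add m m' : bcond m -> bcond m' -> bcond (fun a => m a + m' a)%N.
Proof.
move=> [A HA] [B HB]; exists (A + B) => S.
apply: le_trans (lerD (HA S) (HB S)); rewrite /mass -big_split /=.
apply: ler_sum => a _; rewrite /wt; case: ifP => _; last by rewrite addr0.
by rewrite natrD mulrDl.
Qed.

Lemma bcond_sum n (m : 'I_n -> C -> nat) : (forall j, bcond (m j)) ->
  bcond (fun a => \sum_(j < n) m j a)%N.
Proof.
elim: n m => [|n IH] m H.
  exists 0 => S; rewrite /mass big1 // => a _; rewrite /wt big_ord0 mul0r.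
  by case: ifP.
have := bcond_add (IH _ (fun j => H (widen_ord (leqnSn n) j))) (H ord_max).
by apply: bcond_le => a; rewrite big_ord_recr.
Qed.

Lemma bcond_out m S : bcond m -> bcond (restr_out S m).
Proof. by apply: bcond_le => a; rewrite /restr_out; case: ifP. Qed.

Lemma mass_subset m S T : (S `<=` T)%fset -> mass m S <= mass m T.
Proof.
move=> ST; rewrite /mass [leRHS](big_fsetID _ (mem S)) /=.
have -> : \sum_(i <- [fset x in T | x \in S]%fset) wt m i = \sum_(a <- S) wt m a.
  apply: eq_fbigl => a; rewrite !inE /= andbC; case aS: (a \in S) => //=.
  by rewrite (fsubsetP ST).
by rewrite lerDl sumr_ge0 // => a _; exact: wt_ge0.
Qed.

Lemma mass_split m S T : mass m T = mass (restr_in S m) T + mass (restr_out S m) T.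
Proof.
rewrite /mass -big_split /=; apply: eq_bigr => a _.
rewrite /wt /restr_in /restr_out; case: ifP => _; last by rewrite addr0.
by case: ifP => _; rewrite mul0r ?addr0 ?add0r.
Qed.

Lemma mass_in m S T : (S `<=` T)%fset -> mass (restr_in S m) T = mass m S.
Proof.
move=> ST; rewrite /mass -(big_fset_incl _ ST); last first.
  by move=> a _ aS; rewrite /wt /restr_in (negPf aS) mul0r; case: ifP.
rewrite big_seq [RHS]big_seq; apply: eq_bigr => a aS.
by rewrite /wt /restr_in aS.
Qed.

(** The masses have a supremum, which some finite set almost attains. *)
Lemma mass_tail m e : bcond m -> 0 < e -> exists S, forall T, mass (restr_out S m) T <= e.
Proof.
move=> [A HA] e0; pose X := [set mass m S | S in [set: {fset C}]].
have supX : has_sup X.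
  by split; [exists (mass m fset0); exists fset0|exists A => _ [S _ <-]].
have [_ [S _ <-] hS] := sup_adherent e0 supX.
exists S => T.
have ST : (S `<=` S `|` T)%fset by exact: fsubsetUl.
have TS : (T `<=` S `|` T)%fset by exact: fsubsetUr.
have h : mass m (S `|` T)%fset <= sup X by apply: (ub_le_sup supX.2); exists (S `|` T)%fset.
move: h; rewrite (mass_split m S) (mass_in _ ST) => h.
have := mass_subset (restr_out S m) TS.
by move: hS h; lra.
Qed.

Lemma near1_mul (u v : C) : normc u <= 1 -> normc (u * v - 1) <= normc (u - 1) + normc (v - 1).
Proof.
move=> u1; have -> : u * v - 1 = (u - 1) + u * (v - 1) by ring.
apply: le_trans (le_normcD _ _) _; rewrite lerD2l normcM.
by rewrite ler_piMl ?normc_ge0.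
Qed.

Lemma near1_exp (u : C) k : normc u <= 1 -> normc (u ^+ k - 1) <= k%:R * normc (u - 1).
Proof.
move=> u1; elim: k => [|k IH]; first by rewrite expr0 subrr normc0 mul0r.
rewrite exprS; apply: le_trans (near1_mul _ u1) _.
by rewrite -natr1 mulrDl mul1r addrC lerD2r.
Qed.

(** The deviations from 1 of factors of modulus at most 1 add up. *)
Lemma bprod_near1 (S : seq C) m z r : normc z <= r -> r < 1 ->
  normc (bprod S m z - 1) <= (\sum_(a <- S) wt m a) * ((1 + r) / (1 - r)).
Proof.
move=> zr r1; have z1 : in_disk z by exact: le_lt_trans r1.
elim: S => [|a S IH]; first by rewrite /bprod !big_nil subrr normc0 mul0r.
rewrite bprod_cons big_cons mulrDl /wt; case: ifP => a1; last by rewrite mul0r add0r.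
have b1 := blaschke_factor_le1 a1 z1.
apply: (@le_trans _ _ (normc (blaschke_factor a z ^+ m a - 1) + normc (bprod S m z - 1))).
  by apply: near1_mul; rewrite normcX exprn_ile1 // normc_ge0.
apply: lerD IH; apply: le_trans (near1_exp _ b1) _.
by rewrite -mulrA; apply: ler_wpM2l => //; exact: blaschke_factor_near1.
Qed.

Lemma bprod_split S (T : seq C) m z :
  bprod T m z = bprod T (restr_in S m) z * bprod T (restr_out S m) z.
Proof.
rewrite /bprod -big_split /=; apply: eq_bigr => a _.
by rewrite /restr_in /restr_out; case: ifP => _; rewrite expr0 ?mulr1 ?mul1r.
Qed.

Lemma bprod_in S T m z : (S `<=` T)%fset -> bprod T (restr_in S m) z = bprod S m z.
Proof.
move=> ST; rewrite /bprod big_mkcond /= -(big_fset_incl _ ST); last first.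
  by move=> a _ aS; rewrite /restr_in (negPf aS) expr0; case: ifP.
rewrite [RHS]big_mkcond big_seq [RHS]big_seq; apply: eq_bigr => a aS.
by rewrite /restr_in aS.
Qed.

Lemma bprod_fset0 m z : bprod (fset0 : {fset C}) m z = 1.
Proof. by rewrite /bprod big_mkcond big_seq_fset0. Qed.

Lemma bprod_tail S T m z r e : (forall T, mass (restr_out S m) T <= e) ->
  normc z <= r -> r < 1 -> (S `<=` T)%fset ->
  normc (bprod T m z - bprod S m z) <= e * ((1 + r) / (1 - r)).
Proof.
move=> tl zr r1 ST; have z1 : in_disk z by exact: le_lt_trans r1.
have r0 : 0 <= r by exact: le_trans (normc_ge0 z) zr.
rewrite (bprod_split S) (bprod_in _ _ ST) -{2}[bprod S m z]mulr1 -mulrBr normcM.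
apply: (@le_trans _ _ (normc (bprod T (restr_out S m) z - 1))).
  by rewrite ler_piMl ?normc_ge0 //; exact: bprod_le1.
apply: le_trans (bprod_near1 _ _ zr r1) _; apply: ler_wpM2r; last exact: tl.
by rewrite divr_ge0 ?subr_ge0 ?(ltW r1) // addr_ge0.
Qed.

Lemma blaschke_cvg m z : bcond m -> in_disk z ->
  (fun S : {fset C} => bprod S m z) @ totally --> blaschke m z.
Proof.
move=> bm z1; apply: cauchy_cvgc => e e0.
have z0 := normc_ge0 z.
have d0 : 0 < 1 - normc z by rewrite subr_gt0.
pose K := (1 + normc z) / (1 - normc z).
have K0 : 0 < K by rewrite divr_gt0 // ltr_wpDr.
have e2 : 0 < e / (2 * K) by rewrite divr_gt0 // mulr_gt0.
have [S HS] := mass_tail bm e2.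
exists (bprod S m z); exists S => // T /= ST.
apply: le_lt_trans (bprod_tail HS (lexx _) z1 ST) _.
rewrite -/K (_ : e / (2 * K) * K = e / 2); first lra.
by field; rewrite gt_eqF.
Qed.

Lemma blaschke_tail S m z r e : bcond m -> (forall T, mass (restr_out S m) T <= e) ->
  normc z <= r -> r < 1 -> normc (blaschke m z - bprod S m z) <= e * ((1 + r) / (1 - r)).
Proof.
move=> bm tl zr r1; have z1 : in_disk z by exact: le_lt_trans r1.
have cv : (fun T : {fset C} => bprod T m z - bprod S m z) @ totally -->
    blaschke m z - bprod S m z.
  by apply: cvgB; [exact: blaschke_cvg|exact: cvg_cst].
apply: (normc_lim_le cv); exists S => // T /= ST.
exact: (bprod_tail tl zr r1 ST).
Qed.

Lemma blaschke_tail_near1 S m z r e : bcond m ->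
  (forall T, mass (restr_out S m) T <= e) -> normc z <= r -> r < 1 ->
  normc (blaschke (restr_out S m) z - 1) <= e * ((1 + r) / (1 - r)).
Proof.
move=> bm tl zr r1; rewrite -(bprod_fset0 (restr_out S m) z).
apply: (blaschke_tail (bcond_out S bm) _ zr r1) => T.
apply: le_trans (tl T); apply: ler_sum => a _; apply: wt_le.
by rewrite /restr_out inE.
Qed.

Lemma blaschke_approx m r e : bcond m -> r < 1 -> 0 < e ->
  exists S0, forall S, (S0 `<=` S)%fset ->
    forall z, normc z <= r -> normc (blaschke m z - bprod S m z) <= e.
Proof.
move=> bm r1 e0; have [r0|r0] := leP 0 r; last first.
  exists fset0 => S _ z zr; have := le_lt_trans zr r0.
  by rewrite ltNge normc_ge0.
have d0 : 0 < 1 - r by rewrite subr_gt0.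
pose K := (1 + r) / (1 - r).
have K0 : 0 < K by rewrite divr_gt0 // ltr_wpDr.
have e2 : 0 < e / K by rewrite divr_gt0.
have [S0 HS] := mass_tail bm e2.
exists S0 => S SS z zr; have -> : e = e / K * K by rewrite divfK // gt_eqF.
apply: (blaschke_tail bm _ zr r1) => T; apply: le_trans (HS T).
apply: ler_sum => a _; apply: wt_le; rewrite /restr_out.
by case: ifP => // aS; case: ifP => // aS0; move: aS; rewrite (fsubsetP SS).
Qed.

Lemma dps_blaschke m : bcond m -> dps (blaschke m).
Proof.
move=> bm; apply: dps_uniform => r e _ r1 e0.
have [S HS] := blaschke_approx bm r1 e0.
by exists (bprod S m); [exact: dps_bprod|exact: HS (fsubset_refl S)].
Qed.

Lemma blaschke_le1 m z : bcond m -> in_disk z -> normc (blaschke m z) <= 1.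
Proof.
move=> bm z1; apply: (normc_lim_le (blaschke_cvg bm z1)).
by exists fset0 => // S _; exact: bprod_le1.
Qed.

Lemma blaschke_split m S z : bcond m -> in_disk z ->
  blaschke m z = bprod S m z * blaschke (restr_out S m) z.
Proof.
move=> bm z1.
have h1 := blaschke_cvg bm z1; have h2 := blaschke_cvg (bcond_out S bm) z1.
have h3 : (fun T : {fset C} => bprod S m z * bprod T (restr_out S m) z) @ totally -->
    bprod S m z * blaschke (restr_out S m) z.
  by apply: cvgM h2; exact: cvg_cst.
apply: (cvgc_unique h1); apply: cvg_trans h3; apply: near_eq_cvg.
by exists S => // T /= ST; rewrite (bprod_split S T m z) (bprod_in _ _ ST).
Qed.

(** A tail of small mass is close to 1, and the finitely many other factors do not
    vanish at [z]. *)
Lemma blaschke_neq0 m z : bcond m -> in_disk z -> m z = 0%N -> blaschke m z != 0.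
Proof.
move=> bm z1 mz; have d0 : 0 < 1 - normc z by rewrite subr_gt0.
have z0 := normc_ge0 z.
pose K := (1 + normc z) / (1 - normc z).
have K0 : 0 < K by rewrite divr_gt0 // ltr_wpDr.
have e2 : 0 < 1 / (2 * K) by rewrite divr_gt0 // mulr_gt0.
have [S HS] := mass_tail bm e2.
rewrite (blaschke_split S bm z1); apply: mulf_neq0; first by apply: bprod_neq0.
have := blaschke_tail_near1 bm HS (lexx (normc z)) z1; rewrite -/K => h.
apply/eqP => b0; move: h; rewrite b0 sub0r normcN normc1.
rewrite (_ : 1 / (2 * K) * K = 1 / 2); first lra.
by field; rewrite gt_eqF.
Qed.

Lemma blaschke_order m a : bcond m -> in_disk a ->
  exists q, [/\ dps q, q a != 0 &
    forall z, in_disk z -> blaschke m z = (z - a) ^+ m a * q z].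
Proof.
move=> bm a1; have [u u1 Eb] := blaschke_factorE a.
have u0 : u != 0 by rewrite -normc_eq0 u1 oner_neq0.
have bm' := bcond_out [fset a]%fset bm.
exists (fun z => (- u * szego a z) ^+ m a * blaschke (restr_out [fset a]%fset m) z); split.
- exact: (dpsM (dpsX (m a) (dpsM (dps_cst (- u)) (dps_szego a1))) (dps_blaschke bm')).
- apply: mulf_neq0; first by rewrite expf_neq0 // mulf_neq0 ?oppr_eq0 ?szego_neq0.
  by apply: blaschke_neq0 => //; rewrite /restr_out !inE eqxx.
- move=> z z1; rewrite (blaschke_split [fset a]%fset bm z1).
  rewrite /bprod big_mkcond big_seq_fset1 a1 mulrA; congr (_ * _).
  by rewrite Eb -exprMn; congr (_ ^+ _); ring.
Qed.

Lemma zero_mult_blaschke m a : bcond m -> in_disk a -> zero_mult (blaschke m) a = m a.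
Proof.
by move=> bm a1; have [q [pq qa E]] := blaschke_order bm a1; exact: (zero_multE pq a1 qa E).
Qed.

Lemma blaschke_le_bprod m S z : bcond m -> in_disk z ->
  normc (blaschke m z) <= normc (bprod S m z).
Proof.
move=> bm z1; rewrite (blaschke_split S bm z1) normcM ler_piMr ?normc_ge0 //.
by apply: blaschke_le1 => //; exact: bcond_out.
Qed.

Lemma sqr_near1 (e e' x : R) : 0 < e' -> e' <= 1 -> e' <= e -> 1 - e' / 2 <= x -> 1 - e <= x ^+ 2.
Proof. nra. Qed.

(** This is the form in which Blaschke products are inner. Removing finitely many
    factors does not change the norm, and what remains is close to 1 at the
    origin, so that its constant coefficient alone is close to 1. *)
Lemma h2_blaschke m : bcond m -> h2 (blaschke m) = 1%:E.
Proof.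
move=> bm; apply/eqP; rewrite eq_le; apply/andP; split.
  have := @h2_bounded _ (blaschke m) 1 (dps_blaschke bm) ler01.
  by rewrite expr1n; apply => z z1; exact: blaschke_le1.
have key e : 0 < e -> ((1 - e)%:E <= h2 (blaschke m))%E.
  move=> e0; have [e' [e'0 e'1 e'e]] : exists e', [/\ 0 < e', e' <= 1 & e' <= e].
    by exists (Num.min e 1); split; rewrite ?lt_min ?e0 ?ltr01 // ge_min lexx ?orbT.
  have e'2 : 0 < e' / 2 by rewrite divr_gt0.
  have [S HS] := mass_tail bm e'2.
  have bo := bcond_out S bm; have po := dps_blaschke bo.
  have -> : h2 (blaschke m) = h2 (blaschke (restr_out S m)).
    rewrite -(h2_bprod S m po); apply: (h2_ext (dps_blaschke bm)) => z z1.
    exact: blaschke_split.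
  have n00 : normc (0 : C) <= 0 by rewrite normc0.
  have := blaschke_tail_near1 bm HS n00 ltr01; rewrite addr0 subr0 divr1 mulr1 => h.
  have t0 : taylor_coef (blaschke (restr_out S m)) 0 = blaschke (restr_out S m) 0.
    by rewrite (ps0 po ltr01).
  apply: (@le_trans _ _ (normc (taylor_coef (blaschke (restr_out S m)) 0) ^+ 2)%:E).
    rewrite t0 lee_fin.
    have := le_normcB 1 (1 - blaschke (restr_out S m) 0).
    rewrite (_ : 1 - (1 - _) = blaschke (restr_out S m) 0); last by ring.
    rewrite normc1 (normcB 1) => h2'.
    apply: (sqr_near1 e'0 e'1 e'e); apply: le_trans h2'.
    by rewrite lerD2l lerN2.
  have := (h2_leP (blaschke (restr_out S m))); have := h2_ge0 (blaschke (restr_out S m)).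
  case: (h2 _) => [K| |] // _; last by rewrite leey.
  by move=> /(_ K) [+ _] => /(_ (lexx _) 1%N); rewrite big_ord_recl big_ord0 addr0 lee_fin.
move: key; have := h2_ge0 (blaschke m); case: (h2 _) => [K| |] // _; last by rewrite leey.
move=> H; rewrite lee_fin; apply/ler_addgt0Pr => e e0.
by have := H e e0; rewrite lee_fin; lra.
Qed.

Lemma normc_prod_sqr (S : seq C) (F : C -> C) :
  normc (\prod_(a <- S) F a) ^+ 2 = \prod_(a <- S) normc (F a) ^+ 2.
Proof.
elim: S => [|a S IH]; first by rewrite !big_nil normc1 expr1n.
by rewrite !big_cons normcM exprMn IH.
Qed.

(** A product of numbers [1 - x] is at most the inverse of [1 + sum x]: this turns
    a lower bound on the product into an upper bound on the sum. *)
Lemma prod_one_sub (S : seq C) (x : C -> R) (k : C -> nat) :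
  (forall a, 0 <= x a <= 1) ->
  (\prod_(a <- S) (1 - x a) ^+ k a) * (1 + \sum_(a <- S) (k a)%:R * x a) <= 1.
Proof.
move=> H.
have P0 (S' : seq C) : 0 <= \prod_(a <- S') (1 - x a) ^+ k a.
  by apply: prodr_ge0 => a _; rewrite exprn_ge0 // subr_ge0; case/andP: (H a).
have one (y : R) n p s : 0 <= y <= 1 -> 0 <= p -> 0 <= s -> p * (1 + s) <= 1 ->
   (1 - y) ^+ n * p * (1 + (n%:R * y + s)) <= 1.
  move=> /andP[y0 y1] p0 s0; elim: n => [|n IH] ps1.
    by rewrite mul1r mul0r add0r.
  apply: le_trans (IH ps1); rewrite exprS -!mulrA mulrCA -subr_ge0 -mulrBr.
  apply: mulr_ge0; first by rewrite exprn_ge0 // subr_ge0.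
  rewrite mulrCA -mulrBr; apply: mulr_ge0 => //.
  rewrite -natr1; have n0 : 0 <= n%:R * y by rewrite mulr_ge0.
  nra.
elim: S => [|a S IH]; first by rewrite !big_nil addr0 mul1r.
rewrite !big_cons; apply: one => //.
by apply: sumr_ge0 => b _; rewrite mulr_ge0 //; case/andP: (H b).
Qed.

(** Dividing by the Blaschke factors of finitely many zeros preserves the norm,
    which bounds from below the product of these factors at any point where
    [f <> 0]; the factors then cannot deviate much from 1 in total. *)
Lemma bcond_zero_mult f K z0 : dps f -> (h2 f <= K%:E)%E -> in_disk z0 -> f z0 != 0 ->
  bcond (zero_mult f).
Proof.
move=> pf fK z01 f0.
have z0p := normc_ge0 z0.
have zz := sqr_lt1 z0p z01.
pose K' := K / (1 - normc z0 ^+ 2).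
pose eta := normc (f z0) ^+ 2.
have eta0 : 0 < eta by rewrite exprn_gt0 // normc_gt0.
pose kap := (1 - normc z0 ^+ 2) / 4.
have kap0 : 0 < kap by rewrite divr_gt0.
exists (K' / eta / kap) => S.
pose k a := zero_mult f a.
have dv a : a \in (S : seq C) -> in_disk a -> zdvd a (k a) f.
  move=> _ a1; have [l [g [pg ga E]]] := dps_order pf fK a1 z01 f0.
  by rewrite /k (zero_multE pg a1 ga E); exists g.
have [g pg E] := zdvd_bprod (fset_uniq S) pf dv.
have gK : (h2 g <= K%:E)%E.
  by rewrite -(h2_bprod S k pg) -(h2_ext pf E).
have gz := h2_pointwise pg gK z01.
pose x a := if in_disk a then 1 - normc (blaschke_factor a z0) ^+ 2 else 0.
have x01 a : 0 <= x a <= 1.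
  rewrite /x; case: ifP => a1; last by rewrite lexx ler01.
  rewrite subr_ge0 gerBl sqr_ge0 andbT expr_le1 ?normc_ge0 //.
  exact: blaschke_factor_le1.
have xk a : wt k a * kap <= (k a)%:R * x a.
  rewrite /wt /x; case: ifP => a1; last by rewrite mul0r mulr0.
  rewrite -mulrA; apply: ler_wpM2l => //; rewrite (one_sub_blaschke_factor_sqr a1 z01) /kap mulrA.
  have a0 := normc_ge0 a; have a1' : normc a < 1 := a1.
  have s4 : 4^-1 <= normc (szego a z0) ^+ 2.
    rewrite /szego normcV exprVn lef_pV2 ?posrE ?exprn_gt0 ?normc_gt0 ?denom_neq0 //.
    have -> : 4 = (2 : R) ^+ 2 by rewrite -natrX.
    rewrite ler_sqr ?nnegrE ?normc_ge0 //; apply: le_trans (le_normcD _ _) _.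
    rewrite normcN normc1 normcM normc_conj -[leRHS]/(1 + 1 : R) lerD2l.
    by rewrite mulr_ile1 // ltW.
  apply: ler_pM; rewrite ?invr_ge0 ?mulr_ge0 ?subr_ge0 ?(ltW a1') ?(ltW zz) //.
    by rewrite -subr_ge0 ltW.
  apply: ler_wpM2r; first exact: ltW.
  by rewrite lerD2l lerN2 expr2 ler_piMr // ltW.
have P := @prod_one_sub S x k x01.
have bE : \prod_(a <- S) (1 - x a) ^+ k a = normc (bprod S k z0) ^+ 2.
  rewrite /bprod [in RHS]big_mkcond normc_prod_sqr; apply: eq_bigr => a _.
  rewrite /x; case: ifP => _; first by rewrite opprB addrC subrK normcX exprAC.
  by rewrite subr0 expr1n normc1 expr1n.
have M0 : 0 <= \sum_(a <- S) (k a)%:R * x a.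
  by apply: sumr_ge0 => a _; rewrite mulr_ge0 //; case/andP: (x01 a).
have etaE : eta <= normc (bprod S k z0) ^+ 2 * K'.
  by rewrite /eta (E z0 z01) normcM exprMn; apply: ler_wpM2l => //; exact: sqr_ge0.
have K'0 : 0 <= K' by exact: le_trans (sqr_ge0 _) gz.
have main : eta * (\sum_(a <- S) (k a)%:R * x a) <= K'.
  apply: (@le_trans _ _ (normc (bprod S k z0) ^+ 2 * K' * (1 + \sum_(a <- S) (k a)%:R * x a))).
    apply: ler_pM => //; first exact: ltW.
    by rewrite lerDr.
  by rewrite mulrAC -bE -[leRHS]mul1r; apply: ler_wpM2r.
rewrite ler_pdivlMr // ler_pdivlMr // mulrC; apply: le_trans main.
apply: ler_wpM2l; first exact: ltW.
by rewrite /mass mulr_suml; apply: ler_sum => a _; exact: xk.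
Qed.

End BlaschkeProduct.

(** * Boundary values *)

Section BoundaryValues.
Variable R : realType.
Local Notation C := (Cplx R).
Local Notation mu := (@lebesgue_measure R).
Local Notation I := (`[0, 2 * pi]%classic : set R).
Implicit Types (t e K M : R) (h : C -> C).

(** The half-open interval of [circle_measure] and the closed one of [cmean] differ
    by a null set. *)
Lemma circle_ae (P : R -> Prop) : (\forall t \ae (@circle_measure R), P t) ->
  {ae mu, forall t, I t -> P t}.
Proof.
move=> [N [mN N0 sub]].
have n1 : mu.-negligible (N `&` `[0, 2 * pi[%classic).
  apply/negligibleP; last exact: N0.
  by apply: measurableI => //; exact: measurable_itv.
have n2 : mu.-negligible [set (2 * pi : R)].
  by apply/negligibleP => //; exact: lebesgue_measure_set1.
apply: (negligibleS _ (negligibleU n1 n2)) => t /= /not_implyP[tI Pt].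
have [->|t2] := eqVneq t (2 * pi); [by right|left; split].
  by apply: sub.
move: tI; rewrite /= !in_itv /= => /andP[-> h] /=.
by rewrite lt_def h eq_sym t2.
Qed.

Lemma cont_min (p q : R -> R) : continuous p -> continuous q ->
  continuous (fun t => Num.min (p t) (q t)).
Proof.
move=> cp cq; under eq_fun do rewrite minr_absE.
move=> t; apply: cvgM; last exact: cvg_cst.
apply: cvgB; first by apply: cvgD; [exact: cp|exact: cq].
by apply: cvg_norm; apply: cvgB; [exact: cp|exact: cq].
Qed.

(** A Fatou lemma for circle means, by dominated convergence of the truncations
    [min (phi n) psi], which tend to [psi]. *)
Lemma fatou_circle (phi : nat -> R -> R) (psi : R -> R) K :
  (forall n, continuous (phi n)) -> continuous psi ->
  (forall n t, 0 <= phi n t) -> (forall t, 0 <= psi t) ->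
  (\forall t \ae (@circle_measure R), exists l, phi n t @[n --> \oo] --> l /\ psi t <= l) ->
  (\forall n \near \oo, cmean (phi n) <= K) -> cmean psi <= K.
Proof.
move=> cphi cpsi phi0 psi0 /circle_ae lim_ae [N _ HK].
pose chi n t := Num.min (phi (n + N)%N t) (psi t).
have cchi n : continuous (chi n) by exact: cont_min.
have lim_chi : {ae mu, forall t, I t -> (fun n => (chi n t)%:E) @ \oo --> (psi t)%:E}.
  apply: (filterS (F := almost_everywhere mu) _ lim_ae) => t H tI; have [l [hl pl]] := H tI.
  apply: cvg_EFin; first by near=> n.
  apply/cvgrPdist_lt => e e0; move/cvgrPdist_lt : hl => /(_ e e0) [M _ HM].
  exists M => // n /= Mn; rewrite /chi.
  have {HM} := HM (n + N)%N (leq_trans Mn (leq_addr _ _)).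
  rewrite /= ltr_norml => /andP[h1 h2].
  case: (leP (phi (n + N)%N t) (psi t)) => h; last by rewrite subrr normr0.
  by rewrite ger0_norm ?subr_ge0 //; lra.
have dom : {ae mu, forall t n, I t -> (`|(chi n t)%:E| <= (psi t)%:E)%E}.
  apply: aeW => t n _; rewrite abse_EFin lee_fin ger0_norm ?ge_min ?lexx ?orbT //.
  by rewrite le_min phi0 psi0.
have [_ _ cv] := @dominated_convergence _ _ R mu I (measurable_itv _)
  (fun n t => (chi n t)%:E) (fun t => (psi t)%:E) (fun t => (psi t)%:E)
  (fun n => measurable_int mu (cont_integrable (cchi n)))
  (measurable_int mu (cont_integrable cpsi)) lim_chi
  (cont_integrable cpsi) dom.
have le_K : (\int[mu]_(t in I) (psi t)%:E <= (2 * pi * K)%:E)%E.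
  rewrite -(cvg_lim _ cv) //; apply: lime_le; first exact: (cvgP _ cv).
  near=> n; rewrite /= cmeanE // lee_fin ler_pM2l ?twopi_gt0 //.
  apply: le_trans (HK (n + N)%N (leq_addl _ _)).
  by apply: cmean_le => // t; rewrite ge_min lexx.
by move: le_K; rewrite cmeanE // lee_fin ler_pM2l ?twopi_gt0.
Unshelve. all: by end_near. Qed.

End BoundaryValues.

Section BoundaryModulus.
Variable R : realType.
Local Notation C := (Cplx R).
Implicit Types (r t A D e K M : R) (a b z : C) (h u W : C -> C).

Lemma cvgc_exp (u : nat -> C) (l : C) p : u @ \oo --> l -> (fun n => u n ^+ p) @ \oo --> l ^+ p.
Proof.
move=> ul; elim: p => [|p IH]; first exact: cvg_cst.
by under eq_fun do rewrite exprS; rewrite exprS; apply: cvgM ul IH.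
Qed.

Lemma dist_circle r t : normc (r%:C * circle_point t - circle_point t : C) = `|r - 1|.
Proof.
have -> : r%:C * circle_point t - circle_point t = (r - 1)%:C * circle_point t :> C.
  by rewrite rmorphB rmorph1 mulrBl mul1r.
by rewrite normcM normc_circle mulr1 normc_real.
Qed.

Lemma cvg_rad_circle t : (rad R n)%:C * circle_point t @[n --> \oo] --> (circle_point t : C).
Proof.
apply/cvgcP => e e0; have /cvgrPdist_lt/(_ e e0) := @cvg_rad R.
by apply: filterS => n; rewrite dist_circle distrC.
Qed.

(** The radius ending at a boundary point lies in the Stolz region of aperture 2. *)
Lemma radial_limit W t (l : C) : nontangential_limit W (circle_point t) l ->
  (fun n => W ((rad R n)%:C * circle_point t)) @ \oo --> l.
Proof.
move=> H; have A1 : 1 < 2 :> R by rewrite ltr1n.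
apply: (cvg_comp _ _ _ (H 2 A1)).
have cz := @cvg_rad_circle t.
have st n : stolz_region 2 (circle_point t : C) ((rad R n)%:C * circle_point t).
  split; rewrite ?/in_disk ?normc_rcircle ?rad_lt1 ?(ltW (rad_gt0 _ _)) //.
  by rewrite dist_circle; have := rad_lt1 R n; move=> h; rewrite ler0_norm; lra.
move=> P HP; have h := cz _ HP; rewrite /nbhs /=; apply: (filterS (F := \oo) _ h) => n hn.
exact: (hn (st n)).
Qed.

Lemma circle_measure_gt0 : (0 < @circle_measure R [set: R])%E.
Proof.
rewrite /circle_measure /mrestr setTI lebesgue_measure_itv /= lte_fin twopi_gt0.
by rewrite oppr0 adde0 lte_fin twopi_gt0.
Qed.

(** Where [1/W] is bounded, the boundary value is not the default value 0 and is
    therefore a genuine nontangential limit. Hence the radial limits exist almost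
    everywhere, with moduli between [1 / D] and [M]. *)
Lemma boundary_modulus W K0 : dps W -> (forall z, in_disk z -> normc (W z) <= K0) ->
  (norm_Linfty_inv W < +oo)%E ->
  exists D M, [/\ norm_Linfty_inv W = D%:E, 0 < D, norm_Linfty W = M%:E, 0 < M &
    \forall t \ae (@circle_measure R), exists l : C,
      [/\ (fun n => W ((rad R n)%:C * circle_point t)) @ \oo --> l,
          D^-1 <= normc l & normc l <= M]].
Proof.
move=> pW WK fin.
have muT := circle_measure_gt0.
have ae1 := ess_sup_ge (@circle_measure R) (fun t => ((normc (boundary_value W t))%:E^-1)%E).
have ae2 := ess_sup_ge (@circle_measure R) (fun t => (normc (boundary_value W t))%:E).
have K00 : 0 <= K0 by apply: le_trans (WK 0 (in_disk0 R)); exact: normc_ge0.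
have bvP t : boundary_value W t != 0 ->
    nontangential_limit W (circle_point t) (boundary_value W t).
  rewrite /boundary_value; case: xgetP => [l _ //|_]; by rewrite eqxx.
have radl t : boundary_value W t != 0 ->
   (fun n => W ((rad R n)%:C * circle_point t)) @ \oo --> boundary_value W t.
  by move=> h; apply: radial_limit; exact: bvP.
have bvK t : normc (boundary_value W t) <= K0.
  have [->|h] := eqVneq (boundary_value W t) 0; first by rewrite normc0.
  apply: (normc_lim_le (radl t h)); near=> n; apply: WK.
  by rewrite /in_disk normc_rcircle ?rad_lt1 // ltW ?rad_gt0.
have ae1' : \forall t \ae (@circle_measure R), (((K0 + 1)^-1)%:E <=
     ((normc (boundary_value W t))%:E^-1))%E.
  apply: aeW => t; rewrite inver; have [_|h] := eqVneq (normc (boundary_value W t)) 0.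
    by rewrite leey.
  rewrite lee_fin lef_pV2 ?posrE; last 2 first.
  - by rewrite ltr_wpDl.
  - by rewrite lt_def h normc_ge0.
  by apply: le_trans (bvK t) _; rewrite lerDl.
have inv_ge : (((K0 + 1)^-1)%:E <= norm_Linfty_inv W)%E.
  exact: (ess_sup_gee muT ae1').
move: fin inv_ge ae1; rewrite -/(norm_Linfty_inv W).
case: (norm_Linfty_inv W) => [D| |] // _; rewrite ?lee_fin => D1 ae1.
have D0 : 0 < D by apply: lt_le_trans D1; rewrite invr_gt0 ltr_wpDl.
have lowP t : ((normc (boundary_value W t))%:E^-1 <= D%:E)%E ->
    boundary_value W t != 0 /\ D^-1 <= normc (boundary_value W t).
  rewrite inver; have [h|h] := eqVneq (normc (boundary_value W t)) 0; first by rewrite leye_eq.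
  rewrite lee_fin => hD; split; first by rewrite -normc_eq0.
  have b0 : 0 < normc (boundary_value W t) by rewrite lt_def h normc_ge0.
  by rewrite -[leRHS]invrK lef_pV2 ?posrE ?invr_gt0.
have Mub : (norm_Linfty W <= K0%:E)%E.
  by apply/ess_supP; apply: aeW => t; rewrite lee_fin.
have Mlb : ((D^-1)%:E <= norm_Linfty W)%E.
  apply: (ess_sup_gee muT); apply: (filterS (F := almost_everywhere (@circle_measure R)) _ ae1) => t.
  by move=> /lowP[_ h]; rewrite lee_fin.
move: Mub Mlb ae2; rewrite -/(norm_Linfty W).
case: (norm_Linfty W) => [M| |] //; rewrite ?lee_fin ?leye_eq // => _ M1 ae2.
exists D, M; split => //; first by apply: lt_le_trans M1; rewrite invr_gt0.
apply: (filterS (F := almost_everywhere (@circle_measure R)) _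
  (filterI (F := almost_everywhere (@circle_measure R)) ae1 ae2)) => t [h1 h2'].
have [h3 h4] := lowP t h1; exists (boundary_value W t); split => //; exact: radl.
Unshelve. all: by end_near. Qed.

(** On the unit circle the kernel at [a] coincides with the kernel at [a / r] on
    the circle of radius [r], with [|a| < r < 1], where Parseval applies. *)
Lemma cmean_szego a : in_disk a ->
  cmean (fun t => normc (szego a (circle_point t)) ^+ 2) = (1 - normc a ^+ 2)^-1 /\
  continuous (fun t => normc (szego a (circle_point t)) ^+ 2).
Proof.
move=> a1; have a0 := normc_ge0 a; have a1' : normc a < 1 := a1.
pose r := (normc a + 1) / 2.
have [ar r1] : normc a < r /\ r < 1 by rewrite /r; split; lra.
have r0 : 0 < r by exact: le_lt_trans ar.
have rC : (r%:C : C) != 0 by rewrite -normc_eq0 normc_real normr_eq0 gt_eqF.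
pose b : C := (r^-1)%:C * a.
have nb : normc b = normc a / r by rewrite normcM normc_real gtr0_norm ?invr_gt0 // mulrC.
have b1 : in_disk b by rewrite /in_disk nb ltr_pdivrMr // mul1r.
have E t : szego a (circle_point t) = szego b (r%:C * circle_point t).
  have cb : b^*%C = (r^-1)%:C * a^*%C by rewrite /b rmorphM /= oppr0.
  have rr : (r^-1)%:C * r%:C = 1 :> C by rewrite -rmorphM mulVf ?rmorph1 // gt_eqF.
  by rewrite /szego cb mulrACA rr mul1r.
have Ef : (fun t => normc (szego a (circle_point t)) ^+ 2) =
   (fun t => normc (szego b (r%:C * circle_point t)) ^+ 2) by apply/funext => t; rewrite E.
rewrite Ef; split; last exact: (continuous_circle_sq (ps_szego b1) (ltW r0) r1).
have h := parseval (ps_szego b1) (ltW r0) r1.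
rewrite -(cvg_lim _ h) //; apply/cvg_lim => //.
pose q := normc a ^+ 2.
have q0 : 0 <= q by exact: sqr_ge0.
have q1 : q < 1 by rewrite -subr_gt0; exact: sqr_lt1.
have -> : (fun n => \sum_(k < n) normc (b^*%C ^+ k) ^+ 2 * r ^+ (2 * k)) =
    series (geometric 1 q).
  apply/funext => n; rewrite seriesEnat /= big_mkord; apply: eq_bigr => k _.
  rewrite mul1r normcX normc_conj nb mulnC exprM -exprMn -exprM.
  by rewrite mulnC exprM -exprMn divfK ?gt_eqF // -exprM mulnC exprM.
rewrite -[X in _ --> X]mul1r; apply: cvg_geometric_series.
by rewrite ger0_norm.
Qed.

Section WithBounds.
Variables (W : C -> C) (K0 D M : R).
Hypothesis pW : dps W.
Hypothesis WK : forall z, in_disk z -> normc (W z) <= K0.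
Hypothesis D0 : 0 < D.
Hypothesis M0 : 0 < M.
Hypothesis bd : \forall t \ae (@circle_measure R), exists l : C,
      [/\ (fun n => W ((rad R n)%:C * circle_point t)) @ \oo --> l,
          D^-1 <= normc l & normc l <= M].

(** Because [|W| >= 1/D] on the circle, the Berezin transform
    [(1 - |a|^2) h2 (W k_a)] of [|W|^2] is at least [D^-2]. *)
Lemma h2_szego_ge a K : in_disk a -> (h2 (fun z => szego a z * W z)%R <= K%:E)%E ->
  D^-1 ^+ 2 / (1 - normc a ^+ 2) <= K.
Proof.
move=> a1 HK; have [m1 c1] := cmean_szego a1.
pose H z := szego a z * W z; have pH : dps H by exact: (dpsM (dps_szego a1) pW).
have /= := @fatou_circle R (fun n t => normc (H ((rad R n)%:C * circle_point t)) ^+ 2)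
  (fun t => D^-1 ^+ 2 * normc (szego a (circle_point t)) ^+ 2) K.
rewrite cmeanZ // m1; apply.
- by move=> n; exact: (continuous_circle_sq pH (ltW (rad_gt0 _ n)) (rad_lt1 _ n)).
- by move=> t; apply: cvgM; [exact: cvg_cst|exact: c1].
- by move=> n t; exact: sqr_ge0.
- by move=> t; apply: mulr_ge0; exact: sqr_ge0.
- apply: (filterS (F := almost_everywhere (@circle_measure R)) _ bd) => t [l [cl l1 _]].
  have cs : szego a ((rad R n)%:C * circle_point t) @[n --> \oo] --> szego a (circle_point t).
    have cz := @cvg_rad_circle t.
    apply: cvgV.
      rewrite -normc_gt0; apply: lt_le_trans (le_normcB _ _).
      by rewrite normc1 normcM normc_conj normc_circle mulr1 subr_gt0.
    by apply: cvgB; [exact: cvg_cst|apply: cvgM cz; exact: cvg_cst].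
  have cH : H ((rad R n)%:C * circle_point t) @[n --> \oo] --> szego a (circle_point t) * l.
    exact: (cvgM cs cl).
  exists (normc (szego a (circle_point t) * l) ^+ 2); split.
    have h : normc (H ((rad R n)%:C * circle_point t)) @[n --> \oo] -->
      normc (szego a (circle_point t) * l) by exact: (cvgc_norm cH).
    rewrite expr2; under eq_fun do rewrite expr2; exact: (cvgM h h).
  rewrite normcM exprMn mulrC ler_wpM2l ?sqr_ge0 // ler_sqr ?nnegrE ?normc_ge0 //.
  by rewrite invr_ge0 ltW.
- near=> n; have h := parseval pH (ltW (rad_gt0 R n)) (rad_lt1 R n).
  rewrite -(cvg_lim _ h) //; apply: limr_le; first exact: (cvgP _ h).
  near=> p; apply: le_trans ((h2_leP H K).1 HK p); apply: ler_sum => k _.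
  by rewrite ler_piMr ?sqr_ge0 // exprn_ile1 // ltW ?rad_gt0 ?rad_lt1.
Unshelve. all: by end_near. Qed.

(** Fatou's lemma, applied to [A - |W|^(2p)] with [A] an upper bound of
    [|W|^(2p)] on the disk, since the inequality has to be reversed. *)
Lemma h2_pow_le p : (h2 (fun z => W z ^+ p)%R <= ((M ^+ p) ^+ 2)%:E)%E.
Proof.
have pP : dps (fun z => W z ^+ p) by exact: (dpsX p pW).
have K00 : 0 <= K0 by apply: le_trans (WK (in_disk0 R)); exact: normc_ge0.
pose A := (Num.max K0 M ^+ p) ^+ 2.
have max0 : 0 <= Num.max K0 M by rewrite le_max K00.
have MA : (M ^+ p) ^+ 2 <= A.
  rewrite /A ler_sqr ?nnegrE ?exprn_ge0 ?(ltW M0) //.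
  by rewrite lerXn2r ?nnegrE ?(ltW M0) // le_max lexx orbT.
apply/h2_leP => N; apply/ler_addgt0Pr => e e0.
pose phi n t := A - normc (W ((rad R n)%:C * circle_point t) ^+ p) ^+ 2.
have inD n t : in_disk ((rad R n)%:C * circle_point t : C).
  by rewrite /in_disk normc_rcircle ?rad_lt1 // ltW ?rad_gt0.
have csq n := continuous_circle_sq pP (ltW (rad_gt0 R n)) (rad_lt1 R n).
have cphi n : continuous (phi n).
  by move=> t; apply: cvgB; [exact: cvg_cst|exact: csq].
suff : A - (M ^+ p) ^+ 2 <= A - \sum_(k < N) normc (taylor_coef (fun z => W z ^+ p) k) ^+ 2 + e.
  lra.
rewrite -[leLHS](cmean_cst (A - (M ^+ p) ^+ 2)).
apply: (@fatou_circle R phi).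
- exact: cphi.
- by move=> t; exact: cvg_cst.
- move=> n t; rewrite subr_ge0 /A ler_sqr ?nnegrE ?normc_ge0 ?exprn_ge0 // normcX.
  by rewrite lerXn2r ?nnegrE ?normc_ge0 // le_max WK.
- by move=> t; rewrite subr_ge0.
- apply: (filterS (F := almost_everywhere (@circle_measure R)) _ bd) => t [l [cl _ l2]].
  exists (A - normc (l ^+ p) ^+ 2); split; last first.
    rewrite lerD2l lerN2 ler_sqr ?nnegrE ?normc_ge0 ?exprn_ge0 ?(ltW M0) // normcX.
    by rewrite lerXn2r ?nnegrE ?normc_ge0 ?(ltW M0).
  apply: cvgB; first exact: cvg_cst.
  have cp : W ((rad R n)%:C * circle_point t) ^+ p @[n --> \oo] --> l ^+ p.
    exact: (cvgc_exp (p := p) cl).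
  have h : normc (W ((rad R n)%:C * circle_point t) ^+ p) @[n --> \oo] --> normc (l ^+ p).
    exact: (cvgc_norm cp).
  rewrite expr2; under eq_fun do rewrite expr2; exact: (cvgM h h).
- have := @cvg_sum_rad R (fun k => normc (taylor_coef (fun z => W z ^+ p) k) ^+ 2) N.
  move/cvgrPdist_lt/(_ e e0); apply: filterS => n; rewrite ltr_norml => /andP[h1 h2'].
  have -> : cmean (phi n) = A - cmean (fun t => normc (W ((rad R n)%:C * circle_point t) ^+ p) ^+ 2).
    have := @cmeanD R (fun=> A) (fun t => (-1) * normc (W ((rad R n)%:C * circle_point t) ^+ p) ^+ 2).
    rewrite cmean_cst cmeanZ; last exact: csq.
    rewrite mulN1r => <-.
    + by congr cmean; apply/funext => t; rewrite mulN1r.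
    + by move=> t; exact: cvg_cst.
    + by move=> t; apply: cvgM; [exact: cvg_cst|exact: csq].
  have := parseval_le N pP (ltW (rad_gt0 R n)) (rad_lt1 R n).
  lra.
Qed.

(** The maximum principle for boundary values, by the power trick: the pointwise
    bound [|W|^(2p) <= M^(2p) / (1 - |z|^2)] loses its constant as [p] grows. *)
Lemma le_boundary_sup z : in_disk z -> normc (W z) <= M.
Proof.
move=> z1; rewrite leNgt; apply/negP => Mlt.
have W0 : 0 < normc (W z) by exact: lt_trans Mlt.
pose y := (M / normc (W z)) ^+ 2.
have y0 : 0 <= y by exact: sqr_ge0.
have y1 : y < 1.
  by rewrite -subr_gt0; apply: sqr_lt1; rewrite ?divr_ge0 ?ltr_pdivrMr ?mul1r // ltW.
have zz := sqr_lt1 (normc_ge0 z) z1.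
have bp p : 1 <= y ^+ p * (1 - normc z ^+ 2)^-1.
  have pP : dps (fun z => W z ^+ p) by exact: (dpsX p pW).
  have := h2_pointwise pP (h2_pow_le p) z1; rewrite normcX => hb.
  have Wp : 0 < (normc (W z) ^+ p) ^+ 2 by rewrite exprn_gt0 // exprn_gt0.
  have -> : y ^+ p = (M ^+ p) ^+ 2 / (normc (W z) ^+ p) ^+ 2 by rewrite /y exprAC !expr_div_n.
  by rewrite mulrAC ler_pdivlMr // mul1r.
have cv : y ^+ p * (1 - normc z ^+ 2)^-1 @[p --> \oo] --> (0 : R).
  rewrite -[X in _ --> X](mul0r (1 - normc z ^+ 2)^-1); apply: cvgM; last exact: cvg_cst.
  by apply: cvg_expr; rewrite ger0_norm.
have : (1 : R) <= 0.
  rewrite -(cvg_lim _ cv) //; apply: limr_ge; first exact: (cvgP _ cv).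
  by near=> p; exact: bp.
by rewrite ler10.
Unshelve. all: by end_near. Qed.

End WithBounds.

End BoundaryModulus.

(** * Comparison on a circle *)

Section PerRadius.
Variable R : realType.
Local Notation C := (Cplx R).
Local Notation mu := (@lebesgue_measure R).
Local Notation I := (`[0, 2 * pi]%classic : set R).
Implicit Types (r t B e K H : R) (a b z w : C) (f g h : C -> C) (S : {fset C}).

Definition circ r t : C := r%:C * circle_point t.

Lemma in_disk_circ r t : 0 <= r -> r < 1 -> in_disk (circ r t).
Proof. by move=> r0 r1; rewrite /in_disk normc_rcircle. Qed.

Lemma szego_coefE f r t p : dps f -> 0 <= r -> r < 1 ->
  normc (taylor_coef (fun z => szego (circ r t) z * f z) p) =
  normc (ppoly (fun k => (taylor_coef f (p - k))^*%C) p.+1 (circ r t)).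
Proof.
move=> pf r0 r1.
rewrite (dps_coef p (ps_mul (ps_szego (in_disk_circ t r0 r1)) pf)) -normc_conj.
congr normc; move: (circ r t) => w; rewrite /cauchy_prod /ppoly rmorph_sum /=.
by apply: eq_bigr => k _; rewrite rmorphM rmorphXn /= conjcK mulrC.
Qed.

(** The Berezin transform of [|f|^2] at [a] is [(1 - |a|^2) h2 (szego a * f)]. The
    coefficients of [szego a * f] are polynomials in the conjugate of [a], to whose
    squared moduli Parseval applies; summing their means over the circle of radius
    [r] gives back the squared norm of [f]. *)
Lemma berezin_mean f r (phi : R -> R) H : dps f -> (h2 f <= H%:E)%E -> 0 <= r -> r < 1 ->
  continuous phi -> (forall t, 0 <= phi t) ->
  (forall t, ((phi t)%:E <= (1 - r ^+ 2)%:E * h2 (fun z => szego (circ r t) z * f z)%R)%E) ->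
  cmean phi <= H.
Proof.
move=> pf fH r0 r1 cphi phi0 H1.
have rr := sqr_lt1 r0 r1.
pose cc p k := (taylor_coef f (p - k)%N)^*%C.
pose g p t := (1 - r ^+ 2) * normc (ppoly (cc p) p.+1 (circ r t)) ^+ 2.
have cg p : continuous (g p).
  by move=> t; apply: cvgM; [exact: cvg_cst|exact: continuous_ppoly_sq].
have g0 p t : 0 <= g p t by rewrite mulr_ge0 ?sqr_ge0 // ltW.
have H2 t : ((phi t)%:E <= \sum_(0 <= p <oo) (g p t)%:E)%E.
  apply: le_trans (H1 t) _; rewrite /h2 -nneseriesZl; last first.
    by move=> k _; exact: sqr_ge0_EFin.
  by apply: lee_nneseries => [k _|k _]; rewrite -EFinM szego_coefE // lee_fin ?g0.
have mg p := measurable_int mu (cont_integrable (cg p)).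
have g0e p t : I t -> (0 <= (g p t)%:E)%E by rewrite lee_fin.
have step1 : (\int[mu]_(t in I) (phi t)%:E <= \sum_(0 <= p <oo) \int[mu]_(t in I) (g p t)%:E)%E.
  have <- := @integral_nneseries _ _ R mu I (measurable_itv _) (fun p t => (g p t)%:E) mg g0e.
  apply: ge0_le_integral.
  - exact: measurable_itv.
  - by move=> t _; rewrite lee_fin.
  - exact: (measurable_int mu (cont_integrable cphi)).
  - by apply: ge0_emeasurable_sum => [p t tI _|p _]; [exact: g0e|exact: mg].
  - by move=> t _; exact: H2.
have step2 : (\sum_(0 <= p <oo) \int[mu]_(t in I) (g p t)%:E <= (2 * pi * H)%:E)%E.
  under eq_eseriesr do rewrite cmeanE //.
  apply/nneseries_leP => [p|n].
    rewrite mulr_ge0 ?(ltW (twopi_gt0 R)) // -(cmean_cst 0); apply: cmean_le => //.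
    by move=> t; exact: cvg_cst.
  rewrite -mulr_sumr ler_pM2l ?twopi_gt0 //.
  have gE p : cmean (g p) = \sum_(k < p.+1) (1 - r ^+ 2) * (normc (taylor_coef f (p - k)%N) ^+ 2 * r ^+ (2 * k)).
    rewrite /g cmeanZ; last exact: continuous_ppoly_sq.
    rewrite parseval_poly // mulr_sumr; apply: eq_bigr => k _.
    by rewrite normc_conj.
  under eq_bigr do rewrite gE.
  rewrite (tri_sum (fun k i => (1 - r ^+ 2) * (normc (taylor_coef f i) ^+ 2 * r ^+ (2 * k)))).
  (* Both double sums run over the pairs [i + j < n]. *)
  have swap : \sum_(i < n) \sum_(j < n - i) (1 - r ^+ 2) * (normc (taylor_coef f j) ^+ 2 * r ^+ (2 * i)) =
     \sum_(j < n) \sum_(i < n - j) (1 - r ^+ 2) * (normc (taylor_coef f j) ^+ 2 * r ^+ (2 * i)).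
    rewrite -(tri_sum (fun i j => (1 - r ^+ 2) * (normc (taylor_coef f j) ^+ 2 * r ^+ (2 * i)))).
    rewrite -(tri_sum (fun j i => (1 - r ^+ 2) * (normc (taylor_coef f j) ^+ 2 * r ^+ (2 * i)))).
    apply: eq_bigr => k _; rewrite (reindex_inj rev_ord_inj) /=; apply: eq_bigr => i _.
    by rewrite subSS subKn // -ltnS.
  rewrite swap; apply: le_trans ((h2_leP f H).1 fH n); apply: ler_sum => j _.
  have -> : \sum_(i < n - j) (1 - r ^+ 2) * (normc (taylor_coef f j) ^+ 2 * r ^+ (2 * i)) =
    normc (taylor_coef f j) ^+ 2 * ((1 - r ^+ 2) * \sum_(i < n - j) (r ^+ 2) ^+ i).
    rewrite mulrCA mulrA !mulr_sumr; apply: eq_bigr => i _.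
    by rewrite exprM mulrA.
  rewrite ler_piMr ?sqr_ge0 // -(ler_pM2l (x := (1 - r ^+ 2)^-1)) ?invr_gt0 //.
  rewrite mulKf ?gt_eqF // mulr1; apply: geo_sum_le; first exact: sqr_ge0.
  by rewrite -subr_gt0.
have := le_trans step1 step2; rewrite cmeanE // lee_fin ler_pM2l ?twopi_gt0 //.
Qed.

Lemma bprodD (S : seq C) (m m' : C -> nat) z :
  bprod S (fun a => m a + m' a)%N z = bprod S m z * bprod S m' z.
Proof. by rewrite /bprod -big_split /=; apply: eq_bigr => a _; rewrite exprD. Qed.

Lemma bprodMn (S : seq C) (m : C -> nat) n z :
  bprod S (fun a => n * m a)%N z = bprod S m z ^+ n.
Proof.
rewrite /bprod -prodrXl; apply: eq_bigr => a _.
by rewrite mulnC exprM.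
Qed.

Lemma one_sub_exp (x : R) n : 0 <= x -> x <= 1 -> 1 - x ^+ n <= n%:R * (1 - x).
Proof.
move=> x0 x1; elim: n => [|n IH]; first by rewrite expr0 subrr mul0r.
have xn1 : x ^+ n <= 1 by exact: exprn_ile1.
have xn0 : 0 <= x ^+ n by exact: exprn_ge0.
rewrite exprS -natr1; nra.
Qed.

Section Comparison.
Variables (W : C -> C) (D M H : R).
Hypothesis pW : dps W.
Hypothesis lower : forall a K, in_disk a ->
  (h2 (fun z => szego a z * W z)%R <= K%:E)%E -> D^-1 ^+ 2 / (1 - normc a ^+ 2) <= K.
Hypothesis upper : forall z, in_disk z -> normc (W z) <= M.
Hypothesis WH : h2 W = H%:E.

Let M0 : 0 <= M.
Proof. by apply: le_trans (upper (in_disk0 R)); exact: normc_ge0. Qed.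

Lemma cont_circ_sq f r : dps f -> 0 <= r -> r < 1 ->
  continuous (fun t => normc (f (circ r t)) ^+ 2).
Proof. by move=> pf r0 r1; exact: (continuous_circle_sq pf r0 r1). Qed.

(** Like finite Blaschke products, [P] and [N] are isometric multipliers. Hence [G]
    and [W] have the same Berezin transform, which dominates [|G|^2] and [D^-2]. *)
Lemma finite_comparison (P N G : C -> C) r : 0 <= r -> r < 1 ->
  dps P -> dps N -> dps G ->
  (forall z, in_disk z -> normc (P z) <= 1) ->
  (forall f, dps f -> h2 (fun z => P z * f z) = h2 f) ->
  (forall f, dps f -> h2 (fun z => N z * f z) = h2 f) ->
  (forall z, in_disk z -> N z * W z = P z * G z) ->
  cmean (fun t => normc (N (circ r t) * W (circ r t)) ^+ 2) +
    D^-1 ^+ 2 * (1 - cmean (fun t => normc (P (circ r t)) ^+ 2)) <= H.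
Proof.
move=> r0 r1 pP pN pG P1 isoP isoN E.
pose NW z := N z * W z; have pNW : dps NW by exact: (dpsM pN pW).
have c1 := cont_circ_sq pNW r0 r1; have c2 := cont_circ_sq pP r0 r1.
pose phi t := normc (NW (circ r t)) ^+ 2 +
  (D^-1 ^+ 2 + - D^-1 ^+ 2 * normc (P (circ r t)) ^+ 2).
have c3 : continuous (fun t => - D^-1 ^+ 2 * normc (P (circ r t)) ^+ 2).
  by move=> t; apply: cvgM; [exact: cvg_cst|exact: c2].
have c4 : continuous (fun t => D^-1 ^+ 2 + - D^-1 ^+ 2 * normc (P (circ r t)) ^+ 2).
  by move=> t; apply: cvgD; [exact: cvg_cst|exact: c3].
have cphi : continuous phi.
  by move=> t; apply: cvgD; [exact: c1|exact: c4].
have phiE : cmean phi = cmean (fun t => normc (N (circ r t) * W (circ r t)) ^+ 2) +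
    D^-1 ^+ 2 * (1 - cmean (fun t => normc (P (circ r t)) ^+ 2)).
  rewrite /phi cmeanD // cmeanD //; last by move=> t; exact: cvg_cst.
  rewrite cmean_cst cmeanZ // /NW; ring.
rewrite -phiE.
have rr := sqr_lt1 r0 r1.
have Psq t : normc (P (circ r t)) ^+ 2 <= 1.
  by rewrite expr_le1 ?normc_ge0 // P1 // in_disk_circ.
apply: (berezin_mean pW _ r0 r1 cphi).
- by rewrite WH.
- move=> t; rewrite addr_ge0 ?sqr_ge0 // mulNr -[X in X - _]mulr1 -mulrBr.
  by rewrite mulr_ge0 ?sqr_ge0 // subr_ge0.
move=> t; pose a := circ r t; have a1 : in_disk a by exact: in_disk_circ.
have na : normc a = r by exact: normc_rcircle.
have ps_ := dps_szego a1.
pose X := h2 (fun z => szego a z * W z).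
rewrite -/a -/X.
have XG : h2 (fun z => szego a z * G z) = X.
  rewrite -(isoP _ (dpsM ps_ pG)) /X -(isoN _ (dpsM ps_ pW)).
  apply: (h2_ext (dpsM pP (dpsM ps_ pG))) => z z1.
  by rewrite mulrCA -E // mulrCA.
have X0 : (0 <= X)%E by exact: h2_ge0.
case EX: X X0 => [x| |] // x0; last first.
  by rewrite mulry gtr0_sg // mul1e leey.
rewrite -EFinM lee_fin.
have hD : D^-1 ^+ 2 <= (1 - r ^+ 2) * x.
  have := lower a1 (K := x); rewrite -/X EX lexx na => /(_ isT).
  by rewrite ler_pdivrMr // mulrC.
have hG : normc (G a) ^+ 2 <= (1 - r ^+ 2) * x.
  have pH := dpsM ps_ pG.
  have := h2_pointwise pH (K := x) _ a1; rewrite XG EX lexx => /(_ isT).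
  have -> : szego a a = ((1 - r ^+ 2)^-1)%:C.
    rewrite /szego mulrC -sqr_normc normcE_norm na -rmorphXn -(rmorph1 (@real_complex_def R _)).
    by rewrite -rmorphB -fmorphV.
  rewrite normcM normc_real ger0_norm ?invr_ge0 ?(ltW rr) // na exprMn => hx.
  have rn : 1 - r ^+ 2 != 0 by rewrite gt_eqF.
  have -> : normc (G a) ^+ 2 = (1 - r ^+ 2) ^+ 2 * ((1 - r ^+ 2)^-1 ^+ 2 * normc (G a) ^+ 2).
    by rewrite mulrA -exprMn divff // expr1n mul1r.
  have -> : (1 - r ^+ 2) * x = (1 - r ^+ 2) ^+ 2 * (x / (1 - r ^+ 2)) by field.
  by apply: ler_wpM2l => //; exact: sqr_ge0.
(* [|P G|^2 + (1 - |P|^2) D^-2] is a convex combination of [|G|^2] and [D^-2]. *)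
rewrite /phi -/a /NW E // normcM exprMn.
have := Psq t; rewrite -/a; have := sqr_ge0 (normc (P a)).
move: ((1 - r ^+ 2) * x) (D^-1 ^+ 2) (normc (P a) ^+ 2) (normc (G a) ^+ 2) hG hD.
move=> y d p q qy dy p0 p1.
have p1' : 0 <= 1 - p by rewrite subr_ge0.
have := ler_wpM2l p0 qy; have := ler_wpM2l p1' dy; lra.
Qed.

(** For a finite set [S] of points let [N] be the [n]th power of the product of
    [mR] over [S]. By [zdvd_bprod] the product of [mL] over [S] divides [W N], and
    [finite_comparison] applies. There, [|W|^2 - |N W|^2] is at most
    [n M^2 (1 - |blaschke mR|^2)], since an infinite product is smaller in modulus
    than its subproducts. Finally the finite products for [mL] converge uniformly
    on the circle. *)
Lemma radius_comparison (mL mR : C -> nat) n r : 0 <= r -> r < 1 ->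
  bcond mL -> bcond mR ->
  (forall a, in_disk a -> zdvd a (mL a - n * mR a) W) ->
  D^-1 ^+ 2 * (1 - cmean (fun t => normc (blaschke mL (circ r t)) ^+ 2)) <=
  (H - cmean (fun t => normc (W (circ r t)) ^+ 2)) +
  n%:R * M ^+ 2 * (1 - cmean (fun t => normc (blaschke mR (circ r t)) ^+ 2)).
Proof.
move=> r0 r1 bL bR dv.
set X := (X in _ <= X).
have pL := dps_blaschke bL; have pR := dps_blaschke bR.
have fin S : D^-1 ^+ 2 * (1 - cmean (fun t => normc (bprod S mL (circ r t)) ^+ 2)) <= X.
  pose k a := (mL a - n * mR a)%N.
  have [g pg Wg] := zdvd_bprod (fset_uniq S) pW (k := k) (fun a _ ha => dv a ha).
  pose P := bprod S mL; pose N := bprod S (fun a => n * mR a)%N.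
  (* The zeros of [N W] in excess of those of the product of [mL]. *)
  pose k' a := (n * mR a + k a - mL a)%N.
  pose G z := bprod S k' z * g z.
  have pP : dps P by exact: dps_bprod.
  have pN : dps N by exact: dps_bprod.
  have pG : dps G by exact: (dpsM (dps_bprod S k') pg).
  have E z : in_disk z -> N z * W z = P z * G z.
    move=> z1; rewrite Wg // /N /P /G !mulrA -!bprodD; congr (_ * _).
    rewrite /bprod; apply: eq_bigr => a _; congr (_ ^+ _).
    by rewrite /k' [RHS]subnKC // /k -leq_subLR.
  have := finite_comparison r0 r1 pP pN pG (fun z (hz : in_disk z) => bprod_le1 S mL hz)
     (fun f (pf : dps f) => h2_bprod S mL pf) (fun f (pf : dps f) => h2_bprod S _ pf) E.
  rewrite addrC -lerBrDr => /le_trans; apply.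
  rewrite /X -addrA lerD2l.
  have cW := cont_circ_sq pW r0 r1; have cR := cont_circ_sq pR r0 r1.
  have cNW := cont_circ_sq (dpsM pN pW) r0 r1.
  have cst_c (x : R) : continuous (fun _ : R => x) by move=> t; exact: cvg_cst.
  have cx (x : R) (q : R -> R) : continuous q -> continuous (fun t => x * q t).
    by move=> cq t; apply: cvgM; [exact: cvg_cst|exact: cq].
  have cp (q q' : R -> R) : continuous q -> continuous q' -> continuous (fun t => q t + q' t).
    by move=> cq cq' t; apply: cvgD; [exact: cq|exact: cq'].
  set nm := n%:R * M ^+ 2.
  have key : cmean (fun t => normc (W (circ r t)) ^+ 2) <=
     cmean (fun t => normc (N (circ r t) * W (circ r t)) ^+ 2 +
       (nm + - nm * normc (blaschke mR (circ r t)) ^+ 2)).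
    apply: cmean_le => //; first by apply: (cp _ _) => //; apply: (cp _ _) => //; exact: cx.
    move=> t; have z1 := in_disk_circ t r0 r1; set z := circ r t in z1 *.
    rewrite /N bprodMn normcM normcX exprMn exprAC.
    have b1 : normc (bprod S mR z) ^+ 2 <= 1.
      by rewrite expr_le1 ?normc_ge0 //; exact: bprod_le1.
    have b2 : normc (blaschke mR z) ^+ 2 <= normc (bprod S mR z) ^+ 2.
      by rewrite ler_sqr ?nnegrE ?normc_ge0 //; exact: blaschke_le_bprod.
    have o := one_sub_exp n (sqr_ge0 (normc (bprod S mR z))) b1.
    have w2 : normc (W z) ^+ 2 <= M ^+ 2 by rewrite ler_sqr ?nnegrE ?normc_ge0 // upper.
    have w0 := sqr_ge0 (normc (W z)).
    have n0 : 0 <= n%:R :> R by exact: ler0n.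
    have q1 : (normc (bprod S mR z) ^+ 2) ^+ n <= 1 by rewrite exprn_ile1 ?sqr_ge0.
    rewrite /nm mulNr -[X in _ + (X - _)]mulr1 -mulrBr.
    move: (normc (W z) ^+ 2) ((normc (bprod S mR z) ^+ 2) ^+ n) w2 w0 q1 o => w q w2 w0 q1 o.
    apply: (@le_trans _ _ (q * w + M ^+ 2 * (1 - q))); first by nra.
    rewrite lerD2l; set B2 := normc (blaschke mR z) ^+ 2 in b2 *.
    have -> : n%:R * M ^+ 2 * (1 - B2) = M ^+ 2 * (n%:R * (1 - B2)) by ring.
    apply: ler_wpM2l; first exact: sqr_ge0.
    by apply: (le_trans o); apply: (ler_wpM2l n0); rewrite lerD2l lerN2.
  move: key; rewrite cmeanD //; last by apply: (cp _ _) => //; exact: cx.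
  rewrite cmeanD //; last exact: cx.
  rewrite cmean_cst cmeanZ //; lra.
have d0 : 0 <= D^-1 ^+ 2 by exact: sqr_ge0.
apply/ler_addgt0Pr => e e0.
pose e1 := e / (3 * (D^-1 ^+ 2 + 1)).
have e10 : 0 < e1 by rewrite divr_gt0 // mulr_gt0 // ltr_wpDl.
pose e2 := Num.min e1 1.
have e20 : 0 < e2 by rewrite lt_min e10 ltr01.
have [S HS] := blaschke_approx bL r1 e20.
have {}HS := HS S (fsubset_refl S).
have cL := cont_circ_sq pL r0 r1; have cS := cont_circ_sq (dps_bprod S mL) r0 r1.
have h : cmean (fun t => normc (bprod S mL (circ r t)) ^+ 2) <=
    cmean (fun t => normc (blaschke mL (circ r t)) ^+ 2) + 3 * e1.
  rewrite -[X in _ + X]cmean_cst -cmeanD //; last by move=> t; exact: cvg_cst.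
  apply: cmean_le => //; first by move=> t; apply: cvgD; [exact: cL|exact: cvg_cst].
  move=> t; have z1 := in_disk_circ t r0 r1.
  have hh := HS (circ r t); rewrite normc_rcircle // lexx in hh; have {}hh := hh isT.
  have := le_normcB (bprod S mL (circ r t)) (blaschke mL (circ r t)).
  rewrite normcB; have := normc_ge0 (bprod S mL (circ r t)).
  have := normc_ge0 (blaschke mL (circ r t)); have := blaschke_le1 bL z1.
  have e21 : e2 <= 1 by rewrite ge_min lexx orbT.
  have e22 : e2 <= e1 by rewrite ge_min lexx.
  move: hh e21 e22 e20; clear; move: e1 e2 (normc (blaschke _ _ - _)) (normc (blaschke _ _)) (normc (bprod _ _ _)).
  move=> x1 x2 d b p; nra.
have := fin S; have := ler_wpM2l d0 h.
have : D^-1 ^+ 2 * (3 * e1) <= e.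
  have -> : e = (D^-1 ^+ 2 + 1) * (3 * e1).
    rewrite /e1.
    have : D^-1 ^+ 2 + 1 != 0 by rewrite gt_eqF // ltr_wpDl.
    by move: (D^-1 ^+ 2) => d dn; field.
  by apply: ler_wpM2r; [rewrite mulr_ge0 // ltW|rewrite lerDl].
lra.
Qed.

End Comparison.

End PerRadius.

(** * The Wronskian and its zeros *)

Section Boundedness.
Variable R : realType.
Local Notation C := (Cplx R).
Implicit Types (s A B K : R) (a z : C) (f g h : C -> C).

Definition bdd f := exists2 K, 0 <= K & forall z, in_disk z -> normc (f z) <= K.

Lemma bdd_cst a : bdd (fun=> a).
Proof. by exists (normc a) => //; exact: normc_ge0. Qed.

Lemma bddD f g : bdd f -> bdd g -> bdd (fun z => f z + g z).
Proof.
move=> [A A0 HA] [B B0 HB]; exists (A + B); first exact: addr_ge0.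
by move=> z z1; apply: le_trans (le_normcD _ _) _; apply: lerD; [exact: HA|exact: HB].
Qed.

Lemma bddM f g : bdd f -> bdd g -> bdd (fun z => f z * g z).
Proof.
move=> [A A0 HA] [B B0 HB]; exists (A * B); first exact: mulr_ge0.
by move=> z z1; rewrite normcM; apply: ler_pM; rewrite ?normc_ge0 ?HA ?HB.
Qed.

Lemma bdd_sum (J : Type) (s : seq J) (F : J -> C -> C) :
  (forall j, bdd (F j)) -> bdd (fun z => \sum_(j <- s) F j z).
Proof.
move=> H; elim: s => [|j s IH].
  by exists 0 => // z _; rewrite big_nil normc0.
have [K K0 HK] := bddD (H j) IH; exists K => // z z1.
by rewrite big_cons HK.
Qed.

Lemma bdd_prod (J : Type) (s : seq J) (F : J -> C -> C) :
  (forall j, bdd (F j)) -> bdd (fun z => \prod_(j <- s) F j z).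
Proof.
move=> H; elim: s => [|j s IH].
  by exists 1 => // z _; rewrite big_nil normc1.
have [K K0 HK] := bddM (H j) IH; exists K => // z z1.
by rewrite big_cons HK.
Qed.

(** If [f'] is bounded then [sum k^2 |c_k|^2] is finite, hence so is
    [sum |c_k|], which bounds [f]. *)
Lemma bdd_antiderivative f : dps f -> bdd (derive1 f) -> bdd f.
Proof.
move=> pf [K K0 HK]; have pd := dps_derive1 pf.
have /h2_leP h := h2_bounded pd K0 HK.
pose c := taylor_coef f.
have dE k : taylor_coef (derive1 f) k = k.+1%:R * c k.+1 by rewrite (dps_coef k (ps_derive1 pf)).
(* The sum of the inverse squares is at most 2, by telescoping; the boolean term
   makes the bound true for the empty sum. *)
have sq n : \sum_(k < n) (k.+1%:R : R)^-1 ^+ 2 <= 2.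
  apply: (@le_trans _ _ (2 - (n%:R + (n == 0%N)%:R)^-1)); last by rewrite gerBl invr_ge0 addr_ge0.
  elim: n => [|n IH]; first by rewrite big_ord0 add0r invr1; lra.
  rewrite big_ord_recr /= addr0; case: n IH => [|n] IH.
    by rewrite big_ord0 add0r invr1 expr1n; lra.
  apply: le_trans (lerD IH (lexx _)) _; rewrite addr0.
  have x0 : 0 < n.+1%:R :> R by rewrite ltr0n.
  have -> : n.+2%:R = n.+1%:R + 1 :> R by rewrite natr1.
  move: (n.+1%:R) x0 => x x0.
  have x1 : 0 < x + 1 by lra.
  rewrite -subr_ge0.
  have -> : 2 - (x + 1)^-1 - (2 - x^-1 + (x + 1)^-1 ^+ 2) = (x * (x + 1) ^+ 2)^-1.
    by field; rewrite !gt_eqF.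
  by rewrite invr_ge0 mulr_ge0 ?sqr_ge0 // ltW.
have sc n : \sum_(k < n) normc (c k) <= normc (c 0%N) + (K ^+ 2 + 2).
  case: n => [|n]; first by rewrite big_ord0 addr_ge0 ?normc_ge0 // addr_ge0 ?sqr_ge0.
  rewrite big_ord_recl lerD2l.
  apply: le_trans (lerD (h n) (sq n)); rewrite -big_split /=; apply: ler_sum => k _.
  rewrite dE (normcM k.+1%:R (c k.+1)) normc_nat.
  have k0 : 0 < k.+1%:R :> R by rewrite ltr0n.
  have := normc_ge0 (c k.+1); move: (normc (c k.+1)) (k.+1%:R) k0 => x y y0 x0.
  have : 0 <= (y * x - y^-1) ^+ 2 by exact: sqr_ge0.
  rewrite sqrrB mulrAC divff ?gt_eqF // mul1r; lra.
exists (normc (c 0%N) + (K ^+ 2 + 2)).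
  by rewrite addr_ge0 ?normc_ge0 // addr_ge0 ?sqr_ge0.
move=> z z1; apply: (normc_lim_le (pf z z1)); near=> n.
rewrite series_ordE; apply: le_trans (sc n); apply: le_trans (normc_sum _ _ _) _.
apply: ler_sum => k _; rewrite normcM normcX ler_piMr ?normc_ge0 // exprn_ile1 ?normc_ge0 //.
exact: ltW.
Unshelve. all: by end_near. Qed.

Lemma bdd_derive1n f n i : dps f -> bdd (derive1n n f) -> (i <= n)%N -> bdd (derive1n i f).
Proof.
move=> pf bf; elim: n bf => [|n IH] bf; first by rewrite leqn0 => /eqP ->.
rewrite leq_eqVlt => /predU1P[-> //|]; rewrite ltnS; apply: IH.
by apply: bdd_antiderivative; [exact: dps_derive1n|move: bf; rewrite derive1nS].
Qed.

End Boundedness.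

Section Wronskian.
Variable R : realType.
Local Notation C := (Cplx R).
Implicit Types (s A K : R) (a z : C) (f g h : C -> C).

Lemma dps_det n (A : C -> 'M[C]_n) : (forall i j, dps (fun z => A z i j)) ->
  dps (fun z => \det (A z)).
Proof.
move=> H; apply: dps_sum => s _; apply: (dpsM (dps_cst _)).
by apply: dps_prod => i _; exact: H.
Qed.

Lemma bdd_det n (A : C -> 'M[C]_n) : (forall i j, bdd (fun z => A z i j)) ->
  bdd (fun z => \det (A z)).
Proof.
move=> H; apply: bdd_sum => s; apply: (bddM (bdd_cst _)).
by apply: bdd_prod => i; exact: H.
Qed.

Lemma ps_sum rho (J : Type) (s : seq J) (F : J -> C -> C) (c : J -> nat -> C) :
  (forall j, ps rho (F j) (c j)) ->
  ps rho (fun z => \sum_(j <- s) F j z) (fun k => \sum_(j <- s) c j k).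
Proof.
move=> H; elim: s => [|j s IH].
  by apply: (ps_ext (ps_coef_ext (ps_zero rho) _)) => [k|z _]; rewrite big_nil.
by apply: (ps_ext (ps_coef_ext (ps_add (H j) IH) _)) => [k|z _]; rewrite big_cons.
Qed.

Lemma derive1n_sum (J : Type) (s : seq J) (F : J -> C -> C) n z :
  (forall j, dps (F j)) -> in_disk z ->
  derive1n n (fun z => \sum_(j <- s) F j z) z = \sum_(j <- s) derive1n n (F j) z.
Proof.
move=> pF z1.
have p1 := ps_derive1n (n := n) (ps_sum (s := s) pF).
have p2 := ps_sum (s := s) (fun j => ps_derive1n (n := n) (pF j)).
apply: (ps_unique_val p1 (ps_coef_ext p2 _) z1) => k.
by rewrite mulr_sumr.
Qed.

Variables (n : nat) (f : 'I_n.+1 -> C -> C).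
Hypothesis pf : forall j, dps (f j).

Let A z : 'M[C]_n.+1 := \matrix_(i < n.+1, j < n.+1) derive1n i (f j) z.

Lemma dps_wronskian : dps (wronskian f).
Proof.
apply: (@dps_det n.+1 (fun z => A z)) => i j.
have h := dps_derive1n (n := i) (@pf j).
by apply: (dps_ext h) => z _; rewrite mxE.
Qed.

Lemma bdd_wronskian : (forall j, bdd (derive1n n (f j))) -> bdd (wronskian f).
Proof.
move=> H; apply: bdd_det => i j.
have [K K0 HK] := bdd_derive1n (@pf j) (H j) (leq_ord i).
by exists K => // z z1; rewrite mxE HK.
Qed.

Lemma dps_append_sum j : dps (append_sum f j).
Proof.
rewrite /append_sum; case: unliftP => [i _|_]; first exact: pf.
by apply: dps_sum => i _; exact: pf.
Qed.

Lemma bdd_append_sum j : (forall i, bdd (f i)) -> bdd (append_sum f j).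
Proof.
move=> H; rewrite /append_sum; case: unliftP => [i _|_]; first exact: H.
exact: bdd_sum.
Qed.

(** The Wronskian is a linear combination of the derivatives of each of
    [f_0, ..., f_n] and of their sum: for [f_j] this is the expansion along a
    column, and adding the other columns to one column changes nothing. *)
Lemma wronskian_expand (j : 'I_n.+2) : exists cof : 'I_n.+1 -> C -> C,
  (forall i, dps (cof i)) /\
  forall z, in_disk z ->
    wronskian f z = \sum_(i < n.+1) derive1n i (append_sum f j) z * cof i z.
Proof.
pose cof (k i : 'I_n.+1) z := cofactor (A z) i k.
have pcof k i : dps (cof k i).
  apply: (dpsM (dps_cst _)); apply: (@dps_det _ (fun z => row' i (col' k (A z)))) => i' k'.
  have h := dps_derive1n (n := lift i i') (@pf (lift k k')).
  by apply: (dps_ext h) => z _; rewrite !mxE.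
rewrite /append_sum; case: unliftP => [k _|_].
  exists (cof k); split=> [i|z z1]; first exact: pcof.
  rewrite /wronskian (expand_det_col _ k); apply: eq_bigr => i _.
  by rewrite mxE.
exists (cof ord0); split=> [i|z z1]; first exact: pcof.
(* Any row of the adjugate times [A] sums to the determinant; the sum over the
   columns of [A] produces the derivatives of the sum of the functions. *)
have dA : wronskian f z = \sum_(k < n.+1) (\adj (A z) *m A z) ord0 k.
  rewrite mul_adj_mx (bigD1 ord0) //= big1 => [|k k0]; last first.
    by rewrite mxE eq_sym (negPf k0) mulr0n.
  by rewrite mxE eqxx mulr1n addr0.
rewrite dA; under eq_bigr do rewrite mxE.
rewrite exchange_big /=; apply: eq_bigr => i _.
rewrite (derive1n_sum _ _ pf z1) mulr_suml; apply: eq_bigr => k _.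
by rewrite !mxE mulrC.
Qed.

(** Otherwise its derivatives, and by [wronskian_expand] the Wronskian, would
    vanish. *)
Lemma append_sum_neq0 j z0 : in_disk z0 -> wronskian f z0 != 0 ->
  exists2 z, in_disk z & append_sum f j z != 0.
Proof.
move=> z01 W0; apply: contrapT => H.
have g0 z : in_disk z -> append_sum f j z = 0.
  by move=> z1; apply/eqP; apply: contrapT => /negP gz; apply: H; exists z.
have [cof [pcof E]] := wronskian_expand j.
have pg := @dps_append_sum j.
move: W0; rewrite E // big1 ?eqxx // => i _.
rewrite (dps_derive1n_ext i pg g0 z01).
suff -> : derive1n i (fun=> 0 : C) z0 = 0 by rewrite mul0r.
have h := @ps_zero R 1.
apply: (ps_unique_val (ps_derive1n (n := i) h) (ps_coef_ext h _) z01) => k.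
by rewrite mulr0.
Qed.

(** A derivative of order at most [n] loses at most [n] from the multiplicity of a
    zero, and all terms of [wronskian_expand] contain such a derivative. *)
Lemma zdvd_wronskian j a m : in_disk a -> zdvd a m (append_sum f j) ->
  zdvd a (m - n) (wronskian f).
Proof.
move=> a1 H; have [cof [pcof E]] := wronskian_expand j.
have [q pq Eq] : zdvd a (m - n)
    (fun z => \sum_(i < n.+1) derive1n i (append_sum f j) z * cof i z).
  apply: zdvd_sum => i; apply: zdvd_mulr => //.
  by apply: (zdvd_le _ (zdvd_derive1n i a1 H)); apply: leq_sub2l; exact: leq_ord.
by exists q => // z z1; rewrite E // Eq.
Qed.

End Wronskian.

(** * The Dirichlet norm as a superposition over radii *)

Section Weights.
Variable R : realType.
Variable alpha : R.
Hypothesis alpha01 : 0 < alpha < 1.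

(** The sum over [j] of [weight j k] is comparable with [k^alpha], uniformly in [k]:
    this writes the Dirichlet norm as a superposition of quantities attached to
    the radii [dyad j]. *)
Definition beta : R := 2 `^ alpha.

Definition dyad j : R := 1 - 2^-1 ^+ j.

Definition weight j k : R := beta ^+ j * (1 - dyad j ^+ (2 * k)).

Definition wconst : R := beta / (beta - 1) + 4 * beta / (2 - beta).

Lemma beta_gt1 : 1 < beta.
Proof.
have /andP[a0 a1] := alpha01.
have := gt0_ltr_powR a0 (x := 1) (y := 2); rewrite powR1; apply; rewrite ?nnegrE //.
by rewrite ltr1n.
Qed.

Lemma beta_lt2 : beta < 2.
Proof.
have /andP[a0 a1] := alpha01.
have b0 : 0 < 1 - alpha by rewrite subr_gt0.
have h : 1 < 2 `^ (1 - alpha).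
  have := gt0_ltr_powR b0 (x := 1) (y := 2); rewrite powR1; apply; rewrite ?nnegrE //.
  by rewrite ltr1n.
have E : beta * 2 `^ (1 - alpha) = 2.
  rewrite /beta -powRD; last by apply/implyP => _; rewrite pnatr_eq0.
  by rewrite addrC subrK powRr1.
have p0 : 0 < beta by exact: powR_gt0.
by rewrite -E ltr_pMr.
Qed.

Lemma betaX j : beta ^+ j = (2 ^+ j) `^ alpha.
Proof. by rewrite -powR_mulrn ?powR_ge0 // /beta powRAC powR_mulrn. Qed.

Lemma dyad_ge0 j : 0 <= dyad j.
Proof. by rewrite subr_ge0 exprn_ile1 ?invr_ge0 // invf_le1 // ler1n. Qed.

Lemma dyad_lt1 j : dyad j < 1.
Proof. by rewrite gtrBl exprn_gt0 // invr_gt0. Qed.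

Lemma weight_ge0 j k : 0 <= weight j k.
Proof.
have b0 : 0 <= beta by apply: ltW; exact: lt_trans ltr01 beta_gt1.
rewrite mulr_ge0 ?exprn_ge0 // subr_ge0.
by rewrite exprn_ile1 ?dyad_ge0 // ltW // dyad_lt1.
Qed.

Lemma one_sub_exp_le (x : R) n : 0 <= x -> x <= 1 -> (1 - x) ^+ n * (1 + n%:R * x) <= 1.
Proof.
move=> x0 x1; have x01 : 0 <= x <= 1 by rewrite x0 x1.
have := @prod_one_sub R [:: 0] (fun=> x) (fun=> n) (fun=> x01).
by rewrite !big_seq1.
Qed.

Lemma dyadic_bounds k : (0 < k)%N ->
  exists J, [/\ 2 ^+ J <= k%:R :> R, k%:R <= 2 ^+ J.+1 :> R,
    beta ^+ J <= k%:R `^ alpha & k%:R `^ alpha <= beta ^+ J.+1].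
Proof.
have /andP[a0 a1] := alpha01.
move=> k0; exists (trunc_log 2 k).
have h1 : 2 ^+ trunc_log 2 k <= k%:R :> R by rewrite -natrX ler_nat trunc_logP.
have h2 : k%:R <= 2 ^+ (trunc_log 2 k).+1 :> R.
  by rewrite -natrX ler_nat ltnW // trunc_log_ltn.
split => //; rewrite betaX; apply: ge0_ler_powR; rewrite ?nnegrE ?exprn_ge0 //; exact: ltW.
Qed.

(** The scale [2^j ~ k] alone gives the lower bound. *)
Lemma weight_lower k : (0 < k)%N -> exists J, 4^-1 * k%:R `^ alpha <= weight J k.
Proof.
move=> k0; have [J [h1 _ _ h4]] := dyadic_bounds k0; exists J.
have b2 := beta_lt2; have b1 := beta_gt1.
have bJ0 : 0 <= beta ^+ J by rewrite exprn_ge0 // ltW // (lt_trans ltr01).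
have kb : k%:R `^ alpha <= 2 * beta ^+ J.
  by apply: le_trans h4 _; rewrite exprS; apply: ler_wpM2r => //; exact: ltW.
have x0 : 0 < (2^-1 : R) ^+ J by rewrite exprn_gt0 // invr_gt0.
have x1 : (2^-1 : R) ^+ J <= 1 by rewrite exprn_ile1 ?invr_ge0 // invf_le1 // ler1n.
have P := one_sub_exp_le (2 * k) (ltW x0) x1.
have kx : 1 <= k%:R * (2^-1 : R) ^+ J.
  by rewrite exprVn -ler_pdivrMr ?invr_gt0 ?exprn_gt0 // invrK mul1r.
have d0 : 0 <= dyad J ^+ (2 * k) by rewrite exprn_ge0 // dyad_ge0.
have dle : dyad J ^+ (2 * k) <= 2^-1.
  move: P d0; rewrite -/(dyad J) natrM -mulrA => P d0.
  move: (k%:R * 2^-1 ^+ J) (dyad J ^+ (2 * k)) kx P d0 => y d y1 P d0; nra.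
rewrite /weight.
have : beta ^+ J * 2^-1 <= beta ^+ J * (1 - dyad J ^+ (2 * k)).
  by apply: ler_wpM2l => //; move: dle; lra.
by apply: le_trans; move: kb; lra.
Qed.

(** The scales [2^j <= k] contribute a geometric sum of [beta^j], and the larger
    ones a geometric sum of [k (beta / 2)^j]. Here [1 < beta < 2] is used, that is
    [0 < alpha < 1]. *)
Lemma weight_upper k n : (0 < k)%N -> \sum_(j < n) weight j k <= wconst * k%:R `^ alpha.
Proof.
move=> k0; have [J [_ h2 h3 _]] := dyadic_bounds k0.
have b2 := beta_lt2; have b1 := beta_gt1.
have b0 : 0 < beta by exact: lt_trans ltr01 b1.
have w1 j : weight j k <= beta ^+ j.
  rewrite /weight ler_piMr ?exprn_ge0 ?(ltW b0) // gerBl.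
  by rewrite exprn_ge0 // dyad_ge0.
have w2 j : weight j k <= 2 * k%:R * (beta / 2) ^+ j.
  rewrite /weight expr_div_n -exprVn mulrCA; apply: ler_wpM2l.
    by rewrite exprn_ge0 // ltW.
  have := @one_sub_exp R (dyad j) (2 * k) (dyad_ge0 j) (ltW (dyad_lt1 j)).
  have dj : 1 - dyad j = 2^-1 ^+ j by rewrite /dyad opprB addrC subrK.
  by rewrite natrM dj.
have q0 : 0 <= beta / 2 by rewrite divr_ge0 // ltW.
have q1 : beta / 2 < 1 by rewrite ltr_pdivrMr // mul1r.
apply: (@le_trans _ _ (\sum_(j < J.+1 + n) weight j k)).
  rewrite addnC big_split_ord /= lerDl sumr_ge0 // => j _; exact: weight_ge0.
rewrite big_split_ord /=.
apply: (@le_trans _ _ (wconst * beta ^+ J)); last first.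
  apply: ler_wpM2l => //; rewrite /wconst addr_ge0 // divr_ge0 ?subr_ge0 ?(ltW b0) ?(ltW b1) ?(ltW b2) //.
  by rewrite mulr_ge0 // ltW.
rewrite /wconst mulrDl; apply: lerD.
  apply: (@le_trans _ _ (\sum_(j < J.+1) beta ^+ j)); first by apply: ler_sum => j _; exact: w1.
  rewrite mulrAC -exprS ler_pdivlMr ?subr_gt0 // mulrC -subrX1.
  by rewrite gerBl.
apply: (@le_trans _ _ (\sum_(i < n) 2 * k%:R * (beta / 2) ^+ J.+1 * (beta / 2) ^+ i)).
  by apply: ler_sum => i _; rewrite -mulrA -exprD; exact: w2.
rewrite -mulr_sumr.
have kb : k%:R * (beta / 2) ^+ J.+1 <= beta ^+ J.+1.
  rewrite expr_div_n mulrCA -[leRHS]mulr1; apply: ler_wpM2l; first by rewrite exprn_ge0 // ltW.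
  by rewrite ler_pdivrMr ?exprn_gt0 // mul1r.
have g := geo_sum_le n q0 q1.
apply: (@le_trans _ _ (2 * beta ^+ J.+1 * (1 - beta / 2)^-1)).
  apply: ler_pM => //.
  - by rewrite mulr_ge0 ?exprn_ge0 // mulr_ge0.
  - by apply: sumr_ge0 => i _; exact: exprn_ge0.
  - by rewrite -mulrA; apply: ler_wpM2l.
have e : (1 - beta / 2)^-1 = 2 / (2 - beta).
  by field; rewrite !subr_eq0 !gt_eqF.
rewrite e exprS le_eqVlt; apply/orP; left; apply/eqP; ring.
Qed.

End Weights.

Section DirichletNorm.
Variable R : realType.
Local Notation C := (Cplx R).
Implicit Types (r H : R) (b w : C) (f h u v : C -> C).
Local Open Scope ereal_scope.

(** For [f] in H^2 this is [h2 f] minus the mean of [|f|^2] over the circle of radius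
    [r], by [defectE]. For an inner function it is the mean of [1 - |f|^2]. *)
Definition defect r f : \bar R :=
  \sum_(0 <= k <oo) ((1 - r ^+ (2 * k)) * normc (taylor_coef f k) ^+ 2)%:E.

Lemma nneseries_EFin (p : nat -> R) H : (fun n => (\sum_(k < n) p k)%R) @ \oo --> H ->
  \sum_(0 <= k <oo) (p k)%:E = H%:E.
Proof.
move=> cv; apply/cvg_lim => //; under eq_fun do rewrite partial_ereal.
by apply: cvg_EFin cv; exact: nearW.
Qed.

Lemma nneseries_EFin_cvg (p : nat -> R) H : (forall k, (0 <= p k)%R) ->
  \sum_(0 <= k <oo) (p k)%:E = H%:E -> (fun n => (\sum_(k < n) p k)%R) @ \oo --> H.
Proof.
move=> p0 E.
have : (fun n => \sum_(0 <= k < n) (p k)%:E) @ \oo --> H%:E.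
  by rewrite -E; apply: is_cvg_nneseries => k _ _; rewrite lee_fin.
under eq_fun do rewrite partial_ereal.
by move/fine_cvg.
Qed.

Lemma defectE r f H : dps f -> h2 f = H%:E -> (0 <= r)%R -> (r < 1)%R ->
  defect r f = (H - cmean (fun t => (normc (f (circ r t)) ^+ 2)%R))%:E.
Proof.
move=> pf fH r0 r1; apply: nneseries_EFin.
have c1 := nneseries_EFin_cvg (fun k => sqr_ge0 (normc (taylor_coef f k))) fH.
have c2 := parseval pf r0 r1.
rewrite (_ : (fun n => _) = (fun n => (\sum_(k < n) normc (taylor_coef f k) ^+ 2)%R -
  (\sum_(k < n) normc (taylor_coef f k) ^+ 2 * r ^+ (2 * k))%R)%R); first exact: (cvgB c1 c2).
apply/funext => n; rewrite -sumrB; apply: eq_bigr => k _.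
by rewrite mulrBl mul1r mulrC.
Qed.

Lemma defect_ge0 r f : (0 <= r)%R -> (r < 1)%R -> 0 <= defect r f.
Proof.
move=> r0 r1; apply: nneseries_ge0 => k _ _.
by rewrite lee_fin mulr_ge0 ?sqr_ge0 // subr_ge0 exprn_ile1 // ltW.
Qed.

Variable alpha : R.
Hypothesis alpha01 : (0 < alpha < 1)%R.

Definition wdefect f : \bar R := \sum_(0 <= j <oo) ((beta alpha ^+ j)%:E * defect (dyad R j) f).

(** The coefficient of degree 0 has weight 0, as in the Dirichlet norm. *)
Lemma wdefectE f : wdefect f =
  \sum_(1 <= k <oo) \sum_(0 <= j <oo) (weight alpha j k * normc (taylor_coef f k) ^+ 2)%:E.
Proof.
have b0 j : (0 <= beta alpha ^+ j)%R by rewrite exprn_ge0 // ltW // (lt_trans ltr01) // beta_gt1.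
have d0 j k : (0 <= (1 - dyad R j ^+ (2 * k)) * normc (taylor_coef f k) ^+ 2)%R.
  by rewrite mulr_ge0 ?sqr_ge0 // subr_ge0 exprn_ile1 ?dyad_ge0 // ltW // dyad_lt1.
have w0 j k : 0 <= (weight alpha j k * normc (taylor_coef f k) ^+ 2)%:E.
  by rewrite lee_fin mulr_ge0 ?sqr_ge0 // weight_ge0.
have -> : wdefect f = \sum_(0 <= j <oo) \sum_(0 <= k <oo)
    (weight alpha j k * normc (taylor_coef f k) ^+ 2)%:E.
  apply: eq_eseriesr => j _; rewrite /defect -nneseriesZl; last by move=> k _; rewrite lee_fin.
  by apply: eq_eseriesr => k _; rewrite -EFinM mulrA.
rewrite nneseries_interchange // nneseries_recl //; last by move=> k _; exact: nneseries_ge0.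
rewrite eseries0 ?add0e // => j _ _.
by rewrite /weight muln0 expr0 subrr mulr0 mul0r.
Qed.

Lemma lee_nneseries_ge1 (u v : nat -> \bar R) : (forall k, (0 < k)%N -> 0 <= u k) ->
  (forall k, (0 < k)%N -> u k <= v k) -> \sum_(1 <= k <oo) u k <= \sum_(1 <= k <oo) v k.
Proof.
move=> u0 uv; apply: lee_lim.
- by apply: is_cvg_nneseries => k k1 _; exact: u0.
- by apply: is_cvg_nneseries => k k1 _; apply: le_trans (uv k k1); exact: u0.
- near=> n; rewrite big_nat_cond [leRHS]big_nat_cond.
  by apply: lee_sum => k /andP[/andP[k1 _] _]; exact: uv.
Unshelve. all: by end_near. Qed.

Lemma wdefect_lower f : (4^-1)%:E * dirichlet_norm_sq alpha f <= wdefect f.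
Proof.
rewrite wdefectE /dirichlet_norm_sq -nneseriesZl; last first.
  by move=> k _; rewrite lee_fin mulr_ge0 ?sqr_ge0 // powR_ge0.
have w0 j k : 0 <= (weight alpha j k * normc (taylor_coef f k) ^+ 2)%:E.
  by rewrite lee_fin mulr_ge0 ?sqr_ge0 // weight_ge0.
apply: lee_nneseries_ge1 => k k0.
  by rewrite -EFinM lee_fin mulr_ge0 // mulr_ge0 ?sqr_ge0 // powR_ge0.
have [J HJ] := weight_lower alpha01 k0.
apply: (@le_trans _ _ (weight alpha J k * normc (taylor_coef f k) ^+ 2)%:E).
  by rewrite -EFinM lee_fin mulrA ler_wpM2r ?sqr_ge0.
apply: le_trans (nneseries_lim_ge J.+1 (fun j _ _ => w0 j k)).
by rewrite big_nat_recr //= leeDr // sume_ge0.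
Qed.

Lemma wdefect_upper f : wdefect f <= (wconst alpha)%:E * dirichlet_norm_sq alpha f.
Proof.
rewrite wdefectE /dirichlet_norm_sq -nneseriesZl; last first.
  by move=> k _; rewrite lee_fin mulr_ge0 ?sqr_ge0 // powR_ge0.
have w0 j k : (0 <= weight alpha j k * normc (taylor_coef f k) ^+ 2)%R.
  by rewrite mulr_ge0 ?sqr_ge0 // weight_ge0.
apply: lee_nneseries_ge1 => k k0.
  by apply: nneseries_ge0 => j _ _; rewrite lee_fin.
rewrite -EFinM; apply/nneseries_leP => [j|n]; first exact: w0.
rewrite -mulr_suml [leRHS]mulrA; apply: ler_wpM2r; first exact: sqr_ge0.
exact: weight_upper.
Qed.

End DirichletNorm.

(** * Multiplicities of the least common multiple and of the radical *)

Section Assembly.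
Variable R : realType.
Local Notation C := (Cplx R).
Implicit Types (r A D e K H M : R) (a b z w : C) (g h u W : C -> C).

Lemma bcond_le_disk (m m' : C -> nat) : (forall a, in_disk a -> (m a <= m' a)%N) ->
  bcond m' -> bcond m.
Proof.
move=> mm [A HA]; exists A => S; apply: le_trans (HA S); apply: ler_sum => a _.
by rewrite /wt; case: ifP => // a1; rewrite ler_wpM2r ?ler_nat ?mm // subr_ge0 ltW.
Qed.

Lemma wdefect_comb (alpha x y : R) f g h : 0 <= x -> 0 <= y ->
  (0 < alpha < 1) ->
  (forall j, (x%:E * defect (dyad R j) f <= defect (dyad R j) g + y%:E * defect (dyad R j) h)%E) ->
  (x%:E * wdefect alpha f <= wdefect alpha g + y%:E * wdefect alpha h)%E.
Proof.
move=> x0 y0 al H.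
have b0 j : (0 <= beta alpha ^+ j)%R by rewrite exprn_ge0 // ltW // (lt_trans ltr01) // beta_gt1.
have d0 j u : (0 <= (beta alpha ^+ j)%:E * defect (dyad R j) u)%E.
  by apply: mule_ge0; [rewrite lee_fin|apply: defect_ge0; rewrite ?dyad_ge0 ?dyad_lt1].
rewrite /wdefect -nneseriesZl; last by move=> j _; exact: d0.
rewrite -[X in (_ + X)%E]nneseriesZl; last by move=> j _; exact: d0.
rewrite -nneseriesD; last 2 first.
- by move=> j _ _; exact: d0.
- by move=> j _ _; apply: mule_ge0; rewrite ?lee_fin.
apply: lee_nneseries => [j _ _|j _].
  by apply: mule_ge0; rewrite ?lee_fin.
rewrite muleCA [X in (_ + X)%E]muleCA -ge0_muleDr; last 2 first.
- by apply: defect_ge0; rewrite ?dyad_ge0 ?dyad_lt1.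
- by apply: mule_ge0; [rewrite lee_fin|apply: defect_ge0; rewrite ?dyad_ge0 ?dyad_lt1].
by apply: lee_wpmul2l; [rewrite lee_fin|exact: H].
Qed.

Lemma wconst_gt0 (alpha : R) : 0 < alpha < 1 -> 0 < wconst alpha.
Proof.
move=> al; have b1 := beta_gt1 al; have b2 := beta_lt2 al.
have b0 : 0 < beta alpha by exact: lt_trans ltr01 b1.
by rewrite /wconst addr_gt0 // divr_gt0 ?subr_gt0 // mulr_gt0.
Qed.

(** Multiplication by [D^2 / Cc], in the extended reals. *)
Lemma rescale_estimate (Cc D M : R) (n : nat) (L w rho : \bar R) :
  0 < Cc -> 0 < D -> 0 < M -> (0 <= L)%E -> (0 <= w)%E -> (0 <= rho)%E ->
  ((D^-1 ^+ 2)%:E * ((4^-1)%:E * L) <= Cc%:E * w + (n%:R * M ^+ 2)%:E * (Cc%:E * rho))%E ->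
  ((4 * Cc)^-1%:E * L <= (sqrte w * D%:E) ^+ 2 + n%:R%:E * (M%:E * D%:E) ^+ 2 * rho)%E.
Proof.
move=> C0 D0 M0 L0 w0 r0 H.
have k0 : 0 <= D ^+ 2 / Cc by rewrite divr_ge0 ?sqr_ge0 // ltW.
have k0e : (0 <= (D ^+ 2 / Cc)%:E)%E by rewrite lee_fin.
have C1 : (0 <= Cc%:E * w)%E by apply: mule_ge0; rewrite ?lee_fin ?(ltW C0).
have C2 : (0 <= (n%:R * M ^+ 2)%:E * (Cc%:E * rho))%E.
  apply: mule_ge0; first by rewrite lee_fin mulr_ge0 ?sqr_ge0.
  by apply: mule_ge0; rewrite ?lee_fin ?(ltW C0).
have H1 := lee_wpmul2l k0e H.
rewrite (ge0_muleDr _ C1 C2) !muleA -!EFinM in H1.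
have e1 : D ^+ 2 / Cc * D^-1 ^+ 2 * 4^-1 = (4 * Cc)^-1 by field; rewrite !gt_eqF.
have e2 : D ^+ 2 / Cc * Cc = D ^+ 2 by rewrite divfK // gt_eqF.
have e3 : D ^+ 2 / Cc * (n%:R * M ^+ 2) * Cc = n%:R * (M * D) ^+ 2 by field; rewrite gt_eqF.
rewrite e1 e2 e3 in H1.
have -> : ((sqrte w * D%:E) ^+ 2 = (D ^+ 2)%:E * w)%E.
  by rewrite expe2 muleACA -expe2 sqr_sqrte // -EFinM muleC expr2.
have -> : (n%:R%:E * (M%:E * D%:E) ^+ 2 = (n%:R * (M * D) ^+ 2)%:E)%E.
  by rewrite expe2 -!EFinM expr2.
exact: H1.
Qed.

Section WronskianZeros.
Variables (n : nat) (f : 'I_n.+1 -> C -> C).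
Hypothesis pf : forall j, dps (f j).
Hypothesis bf : forall j, bdd (derive1n n (f j)).

Let W := wronskian f.
Let g j := append_sum f j.
Let m j := zero_mult (g j).
Let pW : dps W := @dps_wronskian R n f pf.
Let pg j : dps (g j) := @dps_append_sum R n f pf j.

Hypothesis W0 : exists2 z0, in_disk z0 & W z0 != 0.

Lemma g_order j a : in_disk a ->
  exists q, [/\ dps q, q a != 0 & forall z, in_disk z -> g j z = (z - a) ^+ m j a * q z].
Proof.
move=> a1; have [z0 z01 Wz] := W0.
have [z z1 gz] := append_sum_neq0 pf j z01 Wz.
have bg : bdd (g j).
  by apply: bdd_append_sum => i; exact: (bdd_derive1n (@pf i) (@bf i) (leq0n n)).
have [K K0 HK] := bg.
have [k [q [pq qa E]]] := dps_order (@pg j) (h2_bounded (@pg j) K0 HK) a1 z1 gz.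
have mE : m j a = k by exact: (zero_multE pq a1 qa E).
by exists q; rewrite mE; split.
Qed.

Lemma bcond_m j : bcond (m j).
Proof.
have [z0 z01 Wz] := W0.
have [z z1 gz] := append_sum_neq0 pf j z01 Wz.
have bg : bdd (g j).
  by apply: bdd_append_sum => i; exact: (bdd_derive1n (@pf i) (@bf i) (leq0n n)).
have [K K0 HK] := bg.
exact: (bcond_zero_mult (@pg j) (h2_bounded (@pg j) K0 HK) z1 gz).
Qed.

Let B j : C -> C := blaschke_of (g j).
Let mL a := (\max_(j < n.+2) zero_mult (B j) a)%N.
Let mR a := minn (zero_mult (fun z => \prod_(j < n.+2) B j z) a) 1.

Lemma zero_mult_B j a : in_disk a -> zero_mult (B j) a = m j a.
Proof. by move=> a1; exact: (zero_mult_blaschke (bcond_m j) a1). Qed.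

Lemma zero_mult_prod a : in_disk a ->
  zero_mult (fun z => \prod_(j < n.+2) B j z) a = (\sum_(j < n.+2) m j a)%N.
Proof.
move=> a1.
have H j : exists q, [/\ dps q, q a != 0 &
    forall z, in_disk z -> B j z = (z - a) ^+ m j a * q z].
  exact: (blaschke_order (bcond_m j) a1).
have [q Hq] := choice H.
apply: (@zero_multE _ _ (fun z => \prod_(j < n.+2) q j z)).
- by apply: dps_prod => j _; case: (Hq j).
- exact: a1.
- by apply/prodf_neq0 => j _; case: (Hq j).
- move=> z z1; rewrite -prodrXr -big_split /=; apply: eq_bigr => j _.
  by case: (Hq j) => _ _ ->.
Qed.

Lemma mL_le a : in_disk a -> (mL a <= \sum_(j < n.+2) m j a)%N.
Proof.
move=> a1; apply/bigmax_leqP => j _; rewrite zero_mult_B //.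
by rewrite (bigD1 j) //= leq_addr.
Qed.

Lemma bcond_mL : bcond mL.
Proof. exact: (bcond_le_disk mL_le (bcond_sum bcond_m)). Qed.

Lemma bcond_mR : bcond mR.
Proof.
apply: (bcond_le_disk _ (bcond_sum bcond_m)) => a a1.
by rewrite /mR zero_mult_prod // geq_minl.
Qed.

(** [mL a] is the multiplicity at [a] of one of the [n + 2] functions, and [mR a] is
    1 if one of them vanishes at [a]; so [mL a - n * mR a] is the order that
    [zdvd_wronskian] provides. *)
Lemma zdvd_mL a : in_disk a -> zdvd a (mL a - n * mR a) W.
Proof.
move=> a1; have [j Hj] : exists j, mL a = m j a.
  have c0 : (0 < #|'I_n.+2|)%N by rewrite card_ord.
  have [j _] := eq_bigmax_cond (fun j => zero_mult (B j) a) c0.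
  by move=> E; exists j; rewrite /mL E zero_mult_B.
rewrite Hj; have [mj|mj] := posnP (m j a).
  by rewrite mj sub0n; exact: (zdvd0 a pW).
have -> : mR a = 1%N.
  rewrite /mR zero_mult_prod //; apply/minn_idPr; apply: leq_trans mj _.
  by rewrite (bigD1 j) //= leq_addr.
rewrite muln1; apply: (zdvd_wronskian pf (j := j) a1).
by have [q [pq _ E]] := g_order j a1; exists q.
Qed.

End WronskianZeros.

End Assembly.

(** * The inequality *)

Theorem theorem4p1 (R : realType) (alpha : R) (halpha : 0 < alpha < 1) :
  exists c : R, 0 < c /\
  forall (n : nat) (f : 'I_n.+1 -> Cplx R -> Cplx R),
    (1 <= n)%N ->
    (forall j, analytic_on_disk (f j)) ->
    (forall j, dirichlet alpha (derive1n n (f j)) /\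
               Hinfty (derive1n n (f j))) ->
    let W := wronskian f in
    (norm_Linfty_inv W < +oo)%E ->
    let B := fun j : 'I_n.+2 => blaschke_of (append_sum f j) in
    let lcmB := blaschke_lcm B in
    let radB := blaschke_rad (fun z => \prod_(j < n.+2) B j z) in
    let lambda := (dirichlet_norm alpha W * norm_Linfty_inv W)%E in
    let mu := (norm_Linfty W * norm_Linfty_inv W)%E in
    (c%:E * dirichlet_norm_sq alpha lcmB
       <= lambda ^+ 2 + n%:R%:E * mu ^+ 2 * dirichlet_norm_sq alpha radB)%E.
Proof.
have C0 := wconst_gt0 halpha.
exists (4 * wconst alpha)^-1; split; first by rewrite invr_gt0 mulr_gt0.
move=> n f _ an hyp W fin; cbv zeta.
set B := fun j : 'I_n.+2 => blaschke_of (append_sum f j).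
set lcmB := blaschke_lcm B; set radB := blaschke_rad _.
have pf j : dps (f j) by exact: (analytic_ps (an j)).
have bf j : bdd (derive1n n (f j)).
  have [_ [_ [M HM]]] := hyp j; exists M; last exact: HM.
  by apply: le_trans (HM 0 (in_disk0 R)); exact: normc_ge0.
have pW : dps W by exact: dps_wronskian.
have [K0 K00 WK] : bdd W by exact: bdd_wronskian.
have [D [M [ED D0 EM M0 bd]]] := boundary_modulus pW WK fin.
have lower := @h2_szego_ge R W D M pW D0 bd.
have upper := @le_boundary_sup R W K0 D M pW WK M0 bd.
have [H WH] : exists H, h2 W = H%:E.
  have := h2_bounded pW K00 WK; have := h2_ge0 W.
  by case: (h2 W) => [H| |] // _ _; exists H.
(* The null function would contradict the lower bound at the origin. *)
have W0 : exists2 z0, in_disk z0 & W z0 != 0.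
  apply: contrapT => Wn0.
  have W00 hz : in_disk hz -> W hz = 0.
    by move=> z1; apply/eqP; apply: contrapT => /negP Wz; apply: Wn0; exists hz.
  have /(lower _ _ (in_disk0 R)) : (h2 (fun z => szego 0 z * W z)%R <= 0%:E)%E.
    have p0 := dpsM (dps_szego (in_disk0 R)) pW.
    have E0 : 0 = 0 ^+ 2 :> R by rewrite expr0n.
    rewrite [in X in (_ <= X)%E]E0; apply: (h2_bounded p0 (lexx 0)) => hz z1.
    by rewrite W00 // mulr0 normc0.
  rewrite normc0 expr0n subr0 divr1 => h.
  by have := exprn_gt0 2 D0; rewrite -invr_gt0 -exprVn ltNge h.
have bL := bcond_mL pf bf W0; have bR := bcond_mR pf bf W0.
(* One estimate for each radius, to be summed with the weights [beta ^+ j]. *)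
have per j : ((D^-1 ^+ 2)%:E * defect (dyad R j) lcmB <=
    defect (dyad R j) W + (n%:R * M ^+ 2)%:E * defect (dyad R j) radB)%E.
  have r0 := dyad_ge0 R j; have r1 := dyad_lt1 R j.
  rewrite (defectE (dps_blaschke bL) (h2_blaschke bL) r0 r1).
  rewrite (defectE (dps_blaschke bR) (h2_blaschke bR) r0 r1).
  rewrite (defectE pW WH r0 r1) -!EFinM -EFinD lee_fin.
  exact: (radius_comparison pW lower upper WH r0 r1 bL bR (zdvd_mL pf bf W0)).
have d0 : 0 <= D^-1 ^+ 2 by exact: sqr_ge0.
have nM0 : 0 <= n%:R * M ^+ 2 by rewrite mulr_ge0 ?sqr_ge0.
have dn0 g : (0 <= dirichlet_norm_sq alpha g)%E.
  by apply: nneseries_ge0 => k _ _; rewrite lee_fin mulr_ge0 ?sqr_ge0 // powR_ge0.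
have total := wdefect_comb d0 nM0 halpha per.
rewrite ED EM /dirichlet_norm.
apply: rescale_estimate => //.
apply: (le_trans (lee_wpmul2l _ (wdefect_lower halpha lcmB))); first by rewrite lee_fin.
apply: (le_trans total); apply: leeD; first exact: wdefect_upper.
by apply: lee_wpmul2l; [rewrite lee_fin|exact: wdefect_upper].
Qed.
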